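(* Let $n\ge1$ and suppose that $f,g\in L^2(\mathbb{H}^n)$ satisfy $$|\operatorname{supp}(V_gf)|<\infty\quad\text{and}\quad|\operatorname{supp}(\mathcal{F}(g))|<\infty.$$ Then either $f=0$ or $g=0$.
   Context: $\mathbb{H}^n=\mathbb{R}^n\times\mathbb{R}^n\times\mathbb{R}\cong\mathbb{R}^{2n+1}$ is the Heisenberg group with group law $(p,q,t)\cdot(p',q',t')=\left(p+p',q+q',t+t'+\tfrac12(pq'-qp')\right)$, where $pq$ is the Euclidean dot product on $\mathbb{R}^n$. Its Haar measure is Lebesgue measure on $\mathbb{R}^{2n+1}$, so $L^2(\mathbb{H}^n)=L^2(\mathbb{R}^{2n+1})$. $\mathcal{F}$ is the Euclidean Fourier transform on $\mathbb{R}^{2n+1}$, $\mathcal{F}(h)(Q)=\int_{\mathbb{R}^{2n+1}}h(X)e^{-2\pi i\langle Q,X\rangle}\,dX$, extended to a unitary operator on $L^2(\mathbb{R}^{2n+1})$; here $\langle Q,X\rangle$ is the Euclidean inner product on $\mathbb{R}^{2n+1}$. The short-time Fourier transform of $f\in L^2(\mathbb{H}^n)$ with window $g\in L^2(\mathbb{H}^n)$ is $$V_gf(Q,P)=\int_{\mathbb{R}^{2n+1}}\mathcal{F}(f)(X)\,\overline{\mathcal{F}(g)(X\cdot P)}\,e^{-2\pi i\langle Q,X\rangle}\,dX,\qquad Q,P\in\mathbb{H}^n,$$ with $X\cdot P$ the Heisenberg product. $|E|$ denotes the Lebesgue measure of a set $E$ (in $\mathbb{R}^{2n+1}$ or in $\mathbb{H}^n\times\mathbb{H}^n\cong\mathbb{R}^{2(2n+1)}$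 as appropriate), and $\operatorname{supp}(h)$ denotes the set where $h\ne0$, defined up to null sets. *)

(* Defs.v *)
From HB Require Import structures.
From mathcomp Require Import all_boot all_order all_algebra.
From mathcomp Require Import complex.
From mathcomp Require Import all_classical all_reals all_analysis.

Set Implicit Arguments.
Unset Strict Implicit.
Unset Printing Implicit Defensive.

Import Order.TTheory GRing.Theory Num.Theory.
Import numFieldNormedType.Exports.

Local Open Scope classical_set_scope.
Local Open Scope ring_scope.
Local Open Scope complex_scope.

Section sigma_finite_prod.
Local Open Scope ereal_scope.
Context d1 d2 (T1 : measurableType d1) (T2 : measurableType d2) (R : realType).
Variable m1 : {sigma_finite_measure set T1 -> \bar R}.
Variable m2 : {sigma_finite_measure set T2 -> \bar R}.

(* A synonym of [m1 \x m2]: on [\x] itself, canonical inference of a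
   sigma-finite structure only finds the instance for subprobabilities. *)
Definition sigma_finite_prod : set (T1 * T2) -> \bar R := m1 \x m2.

HB.instance Definition _ := Measure.copy sigma_finite_prod (m1 \x m2).

Let sigma_finite_prodT : sigma_finite [set: _] sigma_finite_prod.
Proof.
have /sigma_finiteP[F [TF ndF Foo]] := sigma_finiteT m1.
have /sigma_finiteP[G [TG ndG Goo]] := sigma_finiteT m2.
exists (fun n => F n `*` G n).
  rewrite -setXTT TF TG predeqE => -[x y]; split.
    move=> [/= [n _ Fnx] [k _ Gky]]; exists (maxn n k) => //; split.
    - by move: x Fnx; exact/subsetPset/ndF/leq_maxl.
    - by move: y Gky; exact/subsetPset/ndG/leq_maxr.
  by move=> [n _ []/= ? ?]; split; exists n.
move=> k; have [? ?] := Foo k; have [? ?] := Goo k.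
split; first exact: measurableX.
rewrite /sigma_finite_prod product_measure1E//.
by rewrite lte_mul_pinfty// ge0_fin_numE.
Qed.

HB.instance Definition _ := Measure_isSigmaFinite.Build _ _ _ sigma_finite_prod
  sigma_finite_prodT.

End sigma_finite_prod.

(* The library's Lebesgue measure lives on [measurableTypeR R], which is [R]
   equipped with the sigma-algebra generated by the half-open intervals; it is
   therefore the coordinate type used here. *)
Notation euclid R n := (n.-tuple (measurableTypeR R)).

Section lebesgue_cons.
Context (R : realType) (n : nat).
Variable mu : {sigma_finite_measure set (euclid R n) -> \bar R}.
Local Open Scope ereal_scope.

Definition tuple_cons (z : measurableTypeR R * euclid R n) : euclid R n.+1 :=
  [tuple of z.1 :: z.2].

Let measurable_tuple_cons : measurable_fun [set: _] tuple_cons.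
Proof. exact: measurable_cons. Qed.

Let tuple_uncons (x : euclid R n.+1) : measurableTypeR R * euclid R n :=
  (thead x, [tuple of behead x]).

Let measurable_tuple_uncons : measurable_fun [set: _] tuple_uncons.
Proof.
apply/measurable_fun_pairP; split; first exact: measurable_tnth.
exact: measurable_behead.
Qed.

Let tuple_consK : cancel tuple_cons tuple_uncons.
Proof.
by case=> a x; rewrite /tuple_uncons theadE; congr pair; exact: val_inj.
Qed.

Definition lebesgue_cons : set (euclid R n.+1) -> \bar R :=
  pushforward (sigma_finite_prod (@lebesgue_measure R) mu) tuple_cons.

HB.instance Definition _ := Measure.copy lebesgue_cons
  (measure_function_pushforward__canonical__measure_function_Measure
     (sigma_finite_prod (@lebesgue_measure R) mu) measurable_tuple_cons).

Let sigma_finite_lebesgue_cons : sigma_finite [set: _] lebesgue_cons.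
Proof.
have [F FT mF] : sigma_finite [set: _] (sigma_finite_prod (@lebesgue_measure R) mu).
  exact: sigma_finiteT.
exists (fun i => tuple_uncons @^-1` F i).
  by rewrite -preimage_bigcup -FT preimage_setT.
move=> i; have [mFi Fioo] := mF i; split.
  by rewrite -[X in measurable X]setTI; exact: measurable_tuple_uncons.
rewrite /lebesgue_cons /pushforward -comp_preimage.
by rewrite (_ : _ \o _ = id)//; apply/funext; exact: tuple_consK.
Qed.

HB.instance Definition _ := Measure_isSigmaFinite.Build _ _ _ lebesgue_cons
  sigma_finite_lebesgue_cons.

End lebesgue_cons.

(* Lebesgue measure on R^n, as the n-fold product of the one-dimensional one. *)
Fixpoint lebesgue_euclid (R : realType) (n : nat) :
    {sigma_finite_measure set (euclid R n) -> \bar R} :=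
  match n with
  | 0 => \d_([tuple] : euclid R 0)
  | m.+1 => lebesgue_cons (lebesgue_euclid R m)
  end.

Definition euclid_dot (R : realType) n (p q : euclid R n) : R :=
  \sum_(i < n) (tnth p i : R) * (tnth q i : R).

Definition euclid_add (R : realType) n (p q : euclid R n) : euclid R n :=
  [tuple ((tnth p i : R) + (tnth q i : R) : R) | i < n].

Notation heis R n := (euclid R n * euclid R n * measurableTypeR R)%type.

Section heisenberg.
Context (R : realType) (n : nat).
Implicit Types X Y Q P : heis R n.
Implicit Types f g h : heis R n -> R[i].

Definition heis_mul X Y : heis R n :=
  let: (p, q, t) := X in let: (p', q', t') := Y in
  (euclid_add p p', euclid_add q q',
   (t : R) + (t' : R) + 2^-1 * (euclid_dot p q' - euclid_dot q p') : R).

Definition heis_dot X Y : R :=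
  let: (p, q, t) := X in let: (p', q', t') := Y in
  euclid_dot p p' + euclid_dot q q' + (t : R) * (t' : R).

Definition heis_measure : {sigma_finite_measure set (heis R n) -> \bar R} :=
  sigma_finite_prod
    (sigma_finite_prod (lebesgue_euclid R n) (lebesgue_euclid R n))
    (@lebesgue_measure R).

Definition heis2_measure :
    {sigma_finite_measure set (heis R n * heis R n)%type -> \bar R} :=
  sigma_finite_prod heis_measure heis_measure.

Definition L2norm f : \bar R :=
  Lnorm heis_measure 2%:E (fun X => (Normc.normc (f X))%:E).

Definition cmeasurable f : Prop :=
  measurable_fun [set: heis R n] (fun X => complex.Re (f X)) /\
  measurable_fun [set: heis R n] (fun X => complex.Im (f X)).

Definition L2fun f : Prop := cmeasurable f /\ (L2norm f < +oo)%E.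

Definition L1fun f : Prop :=
  heis_measure.-integrable [set: heis R n] (fun X => (complex.Re (f X))%:E) /\
  heis_measure.-integrable [set: heis R n] (fun X => (complex.Im (f X))%:E).

Definition cintegral f : R[i] :=
  (\int[heis_measure]_X complex.Re (f X)) +i*
  (\int[heis_measure]_X complex.Im (f X)).

(* e^{- 2 pi i s} *)
Definition expN2pii (s : R) : R[i] := cos (2 * pi * s) -i* sin (2 * pi * s).

Definition fourier_integral h Q : R[i] :=
  cintegral (fun X => h X * expN2pii (heis_dot Q X)).

(* Graph of the continuous extension of the Fourier integral from the dense
   subspace of integrable functions of L^2 to the whole of L^2. *)
Definition is_fourierL2 h (H : heis R n -> R[i]) : Prop :=
  L2fun H /\
  exists u : nat -> heis R n -> R[i],
    [/\ forall k, L1fun (u k) /\ L2fun (u k),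
        L2norm (fun X => u k X - h X) @[k --> \oo] --> 0%E &
        L2norm (fun Q => fourier_integral (u k) Q - H Q) @[k --> \oo] --> 0%E].

(* An L^2 function [H] in relation [is_fourierL2 h] exists, and is unique up to
   null sets, for every [h] in L^2 (Plancherel): this picks a representative. *)
Definition fourierL2 h : heis R n -> R[i] := xget (cst 0) (is_fourierL2 h).

Definition stft g f (z : (heis R n * heis R n)%type) : R[i] :=
  let: (Q, P) := z in
  cintegral (fun X => fourierL2 f X * conjc (fourierL2 g (heis_mul X P))
                      * expN2pii (heis_dot Q X)).

End heisenberg.

Definition supp (T : Type) (R : realType) (h : T -> R[i]) : set T :=
  [set x | h x != 0].

(* Main.v *)
(** For fixed [P], [stft g f (., P)] is the Fourier transform of the integrable
    function [h_P X = F X * conj (G (X P))], where [F] and [G] are the Fourier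
    transforms of [f] and [g]. Right translations preserve the measure, so the
    support of [h_P] is no larger than that of [G]; by Tonelli the transform of
    [h_P] has a support of finite measure for almost every [P]. Benedicks'
    uncertainty principle gives [h_P = 0] for almost every [P], and then
    [0 = int int |F X|^2 |G (X P)|^2 = ||F||^2 ||G||^2] because left translations
    preserve the measure too. Plancherel carries this back to [f] and [g].

    Fourier analysis on R^d is reduced to Fourier series by the Zak transform.
    Unfolding space along a lattice and frequency along the dual lattice
    factors the Fourier transform into a Fourier series on the dual cell
    followed by Fourier coefficients on the cell, up to a unimodular twist, so
    that Plancherel on R^d follows from Parseval on the torus. In Benedicks'
    argument the lattice is chosen so coarse that the periodization of [h]
    vanishes on a set of positive measure; it is a trigonometric polynomial for
    almost every frequency in the dual cell, hence zero. All these properties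
    pass to products, so everything is proved in dimension one. *)
From HB Require Import structures.
Require Import Defs.
From mathcomp Require Import all_boot all_order all_algebra.
From mathcomp Require Import complex.
From mathcomp Require Import all_classical all_reals all_analysis.
From mathcomp Require Import measurable_realfun ring lra.

Set Implicit Arguments.
Unset Strict Implicit.
Unset Printing Implicit Defensive.

Import Order.TTheory GRing.Theory Num.Theory.
Import numFieldNormedType.Exports.

Local Open Scope classical_set_scope.
Local Open Scope ring_scope.
Local Open Scope complex_scope.

(** * Complex numbers and complex-valued measurable functions *)

(** One kernel shape, [comp_kernel], does double duty: with the trivial twist it is the kernel of a
    product of two groups; with a Fourier series followed by Fourier coefficients as its factors it
    is the Zak form of the Fourier kernel. One Plancherel argument and one vanishing argument
    therefore serve both uses. Energies live in [0, +oo], and Plancherel is stated for integrable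
    functions with both sides possibly infinite. The slices produced by Fubini are integrable but
    not known to be square-integrable, so this is the form that survives iteration. Its price is
    paid on the torus, where Fourier coefficients must determine an arbitrary integrable function;
    Kuhn's polynomials are there for that. Rigidity is the one ingredient that is not about
    energies. On the torus it comes from the finiteness of the root set of a polynomial; it passes
    to products because the dual is discrete, in the sense that a set of measure below 1 is null.
    Plancherel on R^d is used only up to a positive constant, the product of the two covolumes. To
    reach a prescribed covolume, the lattice is stretched in the central coordinate alone. *)

Section complex_algebra.
Context (R : realType).
Implicit Types z w : R[i].

(** The squared modulus as a polynomial in the coordinates: identities reduce to [ring], and square
    roots appear only in the comparison with [L2norm]. *)
Definition nsq z : R := complex.Re z ^+ 2 + complex.Im z ^+ 2.

Lemma cReD z w : complex.Re (z + w) = complex.Re z + complex.Re w.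
Proof. by case: z w => [a b] [c d]. Qed.
Lemma cImD z w : complex.Im (z + w) = complex.Im z + complex.Im w.
Proof. by case: z w => [a b] [c d]. Qed.
Lemma cReN z : complex.Re (- z) = - complex.Re z.
Proof. by case: z. Qed.
Lemma cImN z : complex.Im (- z) = - complex.Im z.
Proof. by case: z. Qed.
Lemma cReM z w : complex.Re (z * w) =
  complex.Re z * complex.Re w - complex.Im z * complex.Im w.
Proof. by case: z w => [a b] [c d]. Qed.
Lemma cImM z w : complex.Im (z * w) =
  complex.Re z * complex.Im w + complex.Im z * complex.Re w.
Proof. by case: z w => [a b] [c d]. Qed.
Lemma cReJ z : complex.Re (conjc z) = complex.Re z.
Proof. by case: z. Qed.
Lemma cImJ z : complex.Im (conjc z) = - complex.Im z.
Proof. by case: z. Qed.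
Definition cReImE := (cReD, cImD, cReN, cImN, cReM, cImM, cReJ, cImJ).

Lemma complex_ext z w :
  complex.Re z = complex.Re w -> complex.Im z = complex.Im w -> z = w.
Proof. by case: z w => [a b] [c d] /= -> ->. Qed.

Lemma nsq_ge0 z : 0 <= nsq z.
Proof. by rewrite addr_ge0 ?sqr_ge0. Qed.

Lemma nsqM z w : nsq (z * w) = nsq z * nsq w.
Proof. by rewrite /nsq !cReImE; ring. Qed.

Lemma nsqJ z : nsq (conjc z) = nsq z.
Proof. by rewrite /nsq !cReImE; ring. Qed.

Lemma nsqN z : nsq (- z) = nsq z.
Proof. by rewrite /nsq !cReImE; ring. Qed.

Lemma nsq0 : nsq 0 = 0.
Proof. by rewrite /nsq /= expr0n addr0. Qed.

Lemma nsq1 : nsq 1 = 1.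
Proof. by rewrite /nsq /= expr0n addr0 expr1n. Qed.

Lemma nsq_eq0 z : (nsq z == 0) = (z == 0).
Proof.
case: z => a b; rewrite /nsq /= paddr_eq0 ?sqr_ge0// !sqrf_eq0.
by rewrite eq_complex.
Qed.

Lemma nsqD_le z w : nsq (z + w) <= 2 * nsq z + 2 * nsq w.
Proof.
rewrite -subr_ge0 [X in 0 <= X](_ : _ = nsq (z - w)) ?nsq_ge0//.
by rewrite /nsq !cReImE; ring.
Qed.

Lemma nsqB_le z w : nsq (z - w) <= 2 * nsq z + 2 * nsq w.
Proof. by rewrite -(nsqN w) nsqD_le. Qed.

Lemma mulcJ_nsq z : z * conjc z = (nsq z)%:C.
Proof. by case: z => a b; apply: complex_ext; rewrite /nsq /=; ring. Qed.

Lemma conjcM z w : conjc (z * w) = conjc z * conjc w.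
Proof. exact: rmorphM. Qed.

Lemma normc_sqr z : Normc.normc z ^+ 2 = nsq z.
Proof. by case: z => a b; rewrite /nsq /= sqr_sqrtr// addr_ge0 ?sqr_ge0. Qed.

(** The l^1 norm of the coordinate pair replaces the modulus because, for measurable functions, its
    integral is finite exactly when both coordinates are integrable. *)
Definition norm1 z : R := `|complex.Re z| + `|complex.Im z|.

Lemma norm1_ge0 z : 0 <= norm1 z.
Proof. by rewrite addr_ge0. Qed.

Lemma norm1M z w : norm1 (z * w) <= norm1 z * norm1 w.
Proof.
rewrite /norm1 !cReImE; apply: le_trans (lerD (ler_normB _ _) (ler_normD _ _)) _.
rewrite !normrM; lra.
Qed.

Lemma norm1M_unit z w : nsq w = 1 -> norm1 (z * w) <= 2 * norm1 z.
Proof.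
move=> w1; apply: le_trans (norm1M _ _) _; rewrite mulrC ler_wpM2r ?norm1_ge0//.
have [r i] : `|complex.Re w| <= 1 /\ `|complex.Im w| <= 1.
  have /= := (sqr_ge0 (complex.Re w), sqr_ge0 (complex.Im w)).
  move: w1; rewrite /nsq -(real_normK (num_real (complex.Re w))).
  rewrite -(real_normK (num_real (complex.Im w))) => w1 [r i].
  by split; rewrite -(@ler_pXn2r _ 2) ?nnegrE// expr1n; lra.
by rewrite /norm1; lra.
Qed.

(** Each coordinate satisfies [|x| <= x^2 + 1/4]. The bound makes a function of finite energy
    integrable wherever the constant 1 is. *)
Lemma norm1_le_nsq z : norm1 z <= 1 + nsq z.
Proof.
rewrite /norm1 /nsq -(real_normK (num_real (complex.Re z))).
rewrite -(real_normK (num_real (complex.Im z))).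
have := sqr_ge0 (`|complex.Re z| - 2^-1).
have := sqr_ge0 (`|complex.Im z| - 2^-1).
rewrite !sqrrB; lra.
Qed.

(** Stands in for Cauchy-Schwarz: it dominates a product of two functions of finite energy. *)
Lemma norm1M_le_nsq z w : norm1 (z * w) <= 2 * nsq z + 2 * nsq w.
Proof.
apply: le_trans (norm1M _ _) _; rewrite /norm1 /nsq.
rewrite -(real_normK (num_real (complex.Re z))).
rewrite -(real_normK (num_real (complex.Im z))).
rewrite -(real_normK (num_real (complex.Re w))).
rewrite -(real_normK (num_real (complex.Im w))).
set a := `|_|; set b := `|_|; set c := `|_|; set d := `|_|.
have := (sqr_ge0 (a - c), sqr_ge0 (a - d), sqr_ge0 (b - c), sqr_ge0 (b - d)).
by move=> /= -[[[]]]; nra.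
Qed.

Lemma expN2piiD (s t : R) : expN2pii (s + t) = expN2pii s * expN2pii t.
Proof.
by apply: complex_ext; rewrite /expN2pii /= mulrDr ?cosD ?sinD; ring.
Qed.

Lemma nsq_expN2pii (s : R) : nsq (expN2pii s) = 1.
Proof. by rewrite /nsq /= sqrrN cos2Dsin2. Qed.

Lemma expN2pii0 : expN2pii (0 : R) = 1.
Proof.
by apply: complex_ext; rewrite /expN2pii /= mulr0 ?cos0 ?sin0 ?oppr0.
Qed.

Lemma expN2piiN (s : R) : expN2pii (- s) = conjc (expN2pii s).
Proof. by apply: complex_ext; rewrite /expN2pii /= mulrN ?cosN ?sinN. Qed.

Lemma expN2pii_nat (n : nat) : expN2pii (n%:R : R) = 1.
Proof.
elim: n => [|n IH]; first exact: expN2pii0.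
rewrite -addn1 natrD expN2piiD IH mul1r.
have e : 2 * pi * 1%:R = pi *+ 2 :> R by rewrite mulr1 mulr_natl.
by apply: complex_ext; rewrite /expN2pii /= e ?cos2pi ?sin2pi ?oppr0.
Qed.

Lemma expN2pii_int (n : int) : expN2pii (n%:~R : R) = 1.
Proof.
case: n => n; first exact: expN2pii_nat.
by rewrite NegzE mulrNz expN2piiN expN2pii_nat conjc1.
Qed.

End complex_algebra.

Section complex_measurable.
Context (R : realType) d (T : measurableType d).
Implicit Types (f g : T -> R[i]).

(** [cmeas], [cL1] and [cint] make sense on any measured space; at [heis_measure] they unfold to
    [cmeasurable], [L1fun] and [cintegral], so results transfer by conversion. *)
Definition cmeas f : Prop :=
  measurable_fun [set: T] (fun x => complex.Re (f x)) /\
  measurable_fun [set: T] (fun x => complex.Im (f x)).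

Lemma cmeas_cst (z : R[i]) : cmeas (fun=> z).
Proof. by split; exact: measurable_cst. Qed.

Lemma cmeasD f g : cmeas f -> cmeas g -> cmeas (fun x => f x + g x).
Proof.
move=> [fr fi] [gr gi]; split.
- by under eq_fun do rewrite cReD; exact: measurable_funD.
- by under eq_fun do rewrite cImD; exact: measurable_funD.
Qed.

Lemma cmeasN f : cmeas f -> cmeas (fun x => - f x).
Proof.
move=> [fr fi]; split.
- by under eq_fun do rewrite cReN; exact: measurableT_comp.
- by under eq_fun do rewrite cImN; exact: measurableT_comp.
Qed.

Lemma cmeasB f g : cmeas f -> cmeas g -> cmeas (fun x => f x - g x).
Proof. by move=> mf mg; apply: cmeasD => //; exact: cmeasN. Qed.

Lemma cmeasM f g : cmeas f -> cmeas g -> cmeas (fun x => f x * g x).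
Proof.
move=> [fr fi] [gr gi]; split.
- under eq_fun do rewrite cReM.
  by apply: measurable_funB; exact: measurable_funM.
- under eq_fun do rewrite cImM.
  by apply: measurable_funD; exact: measurable_funM.
Qed.

Lemma cmeasJ f : cmeas f -> cmeas (fun x => conjc (f x)).
Proof.
move=> [fr fi]; split.
- by under eq_fun do rewrite cReJ.
- by under eq_fun do rewrite cImJ; exact: measurableT_comp.
Qed.

Lemma measurable_nsq f : cmeas f -> measurable_fun [set: T] (fun x => nsq (f x)).
Proof.
by move=> [fr fi]; apply: measurable_funD; exact: measurable_funX.
Qed.

Lemma measurable_norm1 f : cmeas f ->
  measurable_fun [set: T] (fun x => norm1 (f x)).
Proof.
by move=> [fr fi]; apply: measurable_funD; exact: measurableT_comp.
Qed.

Lemma measurable_supp f : cmeas f -> measurable (supp f).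
Proof.
move=> mf; have := measurable_nsq mf => /(_ measurableT [set~ 0]).
rewrite setTI (_ : _ @^-1` _ = supp f)//; first by apply; exact: measurableC.
apply/seteqP; split=> x /=; rewrite /supp /= -nsq_eq0.
  by move=> /eqP.
by move=> /eqP.
Qed.

Lemma cmeas_expN2pii (h : T -> R) : measurable_fun [set: T] h ->
  cmeas (fun x => expN2pii (h x)).
Proof.
move=> mh; have m2 : measurable_fun [set: T] (fun x => 2 * pi * h x).
  exact: measurable_funM.
split => /=.
  by apply: measurableT_comp => //; apply: continuous_measurable_fun; exact: continuous_cos.
apply: measurableT_comp => //; apply: measurableT_comp => //.
by apply: continuous_measurable_fun; exact: continuous_sin.
Qed.

End complex_measurable.

Lemma cmeas_comp (R : realType) d d' (T : measurableType d)
    (T' : measurableType d') (f : T -> R[i]) (h : T' -> T) :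
  cmeas f -> measurable_fun [set: T'] h -> cmeas (fun x => f (h x)).
Proof. by move=> [fr fi] mh; split; [exact: (measurableT_comp fr mh)|exact: (measurableT_comp fi mh)]. Qed.

(** * Complex integrals and energy *)

Section complex_integral.
Context (R : realType) d (T : measurableType d).
Variable mu : {measure set T -> \bar R}.
Implicit Types (f g : T -> R[i]).

Definition cL1 f : Prop :=
  mu.-integrable [set: T] (fun x => (complex.Re (f x))%:E) /\
  mu.-integrable [set: T] (fun x => (complex.Im (f x))%:E).

Definition cint f : R[i] :=
  (\int[mu]_x complex.Re (f x)) +i* (\int[mu]_x complex.Im (f x)).

Definition energy f : \bar R := \int[mu]_x (nsq (f x))%:E.

Lemma cL1_cmeas f : cL1 f -> cmeas f.
Proof.
by move=> [/measurable_int/measurable_EFinP ? /measurable_int/measurable_EFinP].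
Qed.

Lemma cL1_le f (g : T -> R) : cmeas f ->
  mu.-integrable [set: T] (EFin \o g) -> (forall x, norm1 (f x) <= g x) ->
  cL1 f.
Proof.
move=> [fr fi] gi fg; split; apply: (le_integrable measurableT _ _ gi).
- exact/measurable_EFinP.
- move=> x _ /=; rewrite lee_fin; apply: le_trans (ler_norm _).
  by apply: le_trans (fg x); rewrite /norm1 lerDl.
- exact/measurable_EFinP.
- move=> x _ /=; rewrite lee_fin; apply: le_trans (ler_norm _).
  by apply: le_trans (fg x); rewrite /norm1 lerDr.
Qed.

Lemma integrable_norm1 f : cL1 f ->
  mu.-integrable [set: T] (fun x => (norm1 (f x))%:E).
Proof.
move=> [fr fi]; rewrite (_ : (fun x => _) =
  (fun x => `|(complex.Re (f x))%:E| + `|(complex.Im (f x))%:E|)%E)//.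
by apply: integrableD => //; exact: integrable_abse.
Qed.

Lemma cL1P f : cmeas f -> (\int[mu]_x (norm1 (f x))%:E < +oo)%E -> cL1 f.
Proof.
move=> mf fi; apply: (@cL1_le _ (fun x => norm1 (f x))) => //.
apply/integrableP; split; first exact/measurable_EFinP/measurable_norm1.
rewrite (eq_integral (fun x => (norm1 (f x))%:E))// => x _ /=.
by rewrite ger0_norm// norm1_ge0.
Qed.

Lemma cL1_lty f : cL1 f -> (\int[mu]_x (norm1 (f x))%:E < +oo)%E.
Proof.
move=> /integrable_norm1/integrableP[_]; congr (_ < _)%E.
by apply: eq_integral => x _; rewrite gee0_abs// lee_fin norm1_ge0.
Qed.

Lemma cL1D f g : cL1 f -> cL1 g -> cL1 (fun x => f x + g x).
Proof.
move=> [fr fi] [gr gi]; split.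
- by under eq_fun do rewrite cReD EFinD; exact: integrableD.
- by under eq_fun do rewrite cImD EFinD; exact: integrableD.
Qed.

Lemma cL1N f : cL1 f -> cL1 (fun x => - f x).
Proof.
move=> [fr fi]; split.
- by under eq_fun do rewrite cReN EFinN; exact: integrableN.
- by under eq_fun do rewrite cImN EFinN; exact: integrableN.
Qed.

Lemma cL1B f g : cL1 f -> cL1 g -> cL1 (fun x => f x - g x).
Proof. by move=> ? ?; apply: cL1D => //; exact: cL1N. Qed.

Lemma cL1J f : cL1 f -> cL1 (fun x => conjc (f x)).
Proof.
move=> [fr fi]; split; first by under eq_fun do rewrite cReJ.
by under eq_fun do rewrite cImJ EFinN; exact: integrableN.
Qed.

Lemma cL1Z (z : R[i]) f : cL1 f -> cL1 (fun x => z * f x).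
Proof.
move=> [fr fi]; split.
- under eq_fun do rewrite cReM EFinB !EFinM.
  by apply: integrableB => //; exact: integrableZl.
- under eq_fun do rewrite cImM EFinD !EFinM.
  by apply: integrableD => //; exact: integrableZl.
Qed.

Lemma cL1_0 : cL1 (fun=> 0).
Proof. by split; exact: integrable0. Qed.

Lemma cL1_sum (I : Type) (r : seq I) (F : I -> T -> R[i]) :
  (forall i, cL1 (F i)) -> cL1 (fun x => \sum_(i <- r) F i x).
Proof.
move=> mF; elim: r => [|i r IH].
  by under eq_fun do rewrite big_nil; exact: cL1_0.
by under eq_fun do rewrite big_cons; exact: cL1D.
Qed.

Lemma cL1M_unit f g : cL1 f -> cmeas g -> (forall x, nsq (g x) = 1) ->
  cL1 (fun x => f x * g x).
Proof.
move=> f1 mg g1; apply: (@cL1_le _ (fun x => 2 * norm1 (f x))).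
- by apply: cmeasM => //; exact: cL1_cmeas.
- under [X in integrable _ _ X]eq_fun do rewrite /= EFinM.
  exact/(integrableZl measurableT)/integrable_norm1.
- by move=> x; exact: norm1M_unit.
Qed.

Lemma cL1_energyM f g : cmeas f -> cmeas g ->
  (energy f < +oo)%E -> (energy g < +oo)%E -> cL1 (fun x => f x * g x).
Proof.
move=> mf mg f2 g2.
have nI h : cmeas h -> (energy h < +oo)%E ->
    mu.-integrable [set: T] (fun x => (nsq (h x))%:E).
  move=> mh h2; apply/integrableP; split.
    exact/measurable_EFinP/measurable_nsq.
  rewrite (eq_integral (fun x => (nsq (h x))%:E))// => x _ /=.
  by rewrite ger0_norm// nsq_ge0.
apply: (@cL1_le _ (fun x => 2 * nsq (f x) + 2 * nsq (g x))).
- exact: cmeasM.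
- under [X in integrable _ _ X]eq_fun do rewrite /= EFinD !EFinM.
  apply: integrableD => //; apply: integrableZl => //; exact: nI.
- by move=> x; exact: norm1M_le_nsq.
Qed.

Lemma eq_cint f g : f =1 g -> cint f = cint g.
Proof. by move=> /funext ->. Qed.

Lemma cintD f g : cL1 f -> cL1 g -> cint (fun x => f x + g x) = cint f + cint g.
Proof.
move=> [fr fi] [gr gi]; apply: complex_ext; rewrite ?cReImE /=.
- by under eq_Rintegral do rewrite cReD; rewrite RintegralD.
- by under eq_Rintegral do rewrite cImD; rewrite RintegralD.
Qed.

Lemma cintZ z f : cL1 f -> cint (fun x => z * f x) = z * cint f.
Proof.
move=> [fr fi]; have ZI (a : R) (h : T -> R) : mu.-integrable [set: T] (EFin \o h) ->
    mu.-integrable [set: T] (EFin \o (fun x => a * h x)).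
  by move=> hi; under [X in integrable _ _ X]eq_fun do rewrite /= EFinM;
    exact: integrableZl.
apply: complex_ext; rewrite ?cReImE /=.
- under eq_Rintegral do rewrite cReM.
  by rewrite RintegralB ?RintegralZl//; exact: ZI.
- under eq_Rintegral do rewrite cImM.
  by rewrite RintegralD ?RintegralZl//; exact: ZI.
Qed.

Lemma cintZr z f : cL1 f -> cint (fun x => f x * z) = cint f * z.
Proof.
by move=> fi; rewrite mulrC -cintZ//; apply: eq_cint => x; rewrite mulrC.
Qed.

Lemma cintN f : cL1 f -> cint (fun x => - f x) = - cint f.
Proof.
move=> fi; rewrite -mulN1r -cintZ//.
by apply: eq_cint => x; rewrite mulN1r.
Qed.

Lemma cintB f g : cL1 f -> cL1 g -> cint (fun x => f x - g x) = cint f - cint g.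
Proof. by move=> f1 g1; rewrite cintD ?cintN//; exact: cL1N. Qed.

Lemma cint0 : cint (fun=> 0) = 0.
Proof. by rewrite /cint /Rintegral integral0. Qed.

Lemma cint_sum (I : Type) (r : seq I) (F : I -> T -> R[i]) :
  (forall i, cL1 (F i)) ->
  cint (fun x => \sum_(i <- r) F i x) = \sum_(i <- r) cint (F i).
Proof.
move=> F1; elim: r => [|i r IH].
  by rewrite big_nil -[RHS]cint0; apply: eq_cint => x; rewrite big_nil.
rewrite big_cons -IH -cintD//; last exact: cL1_sum.
by apply: eq_cint => x; rewrite big_cons.
Qed.

Lemma cintJ f : cL1 f -> cint (fun x => conjc (f x)) = conjc (cint f).
Proof.
move=> [fr fi]; apply: complex_ext; rewrite ?cReImE /=.
- by under eq_Rintegral do rewrite cReJ.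
- rewrite -mulN1r -RintegralZl//.
  by apply: eq_Rintegral => x _; rewrite cImJ mulN1r.
Qed.

Lemma ae_eq_cint f g : cmeas f -> cmeas g ->
  {ae mu, forall x, f x = g x} -> cint f = cint g.
Proof.
move=> [fr fi] [gr gi] fg; congr (_ +i* _); congr fine.
- apply: ae_eq_integral => //; try exact/measurable_EFinP.
  by apply: filterS fg => x -> _.
- apply: ae_eq_integral => //; try exact/measurable_EFinP.
  by apply: filterS fg => x -> _.
Qed.

Lemma energy_ge0 f : (0 <= energy f)%E.
Proof. by apply: integral_ge0 => x _; rewrite lee_fin nsq_ge0. Qed.

Lemma eq_energy f g : (forall x, nsq (f x) = nsq (g x)) -> energy f = energy g.
Proof. by move=> fg; apply: eq_integral => x _; rewrite fg. Qed.

Lemma ae_eq_energy f g : cmeas f -> cmeas g ->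
  {ae mu, forall x, f x = g x} -> energy f = energy g.
Proof.
move=> mf mg fg; apply: ae_eq_integral => //;
  try exact/measurable_EFinP/measurable_nsq.
by apply: filterS fg => x -> _.
Qed.

Lemma energy_eq0 f : cmeas f -> energy f = 0%E -> {ae mu, forall x, f x = 0}.
Proof.
move=> mf; have /(ae_eq_integral_abs mu measurableT) [+ _] :
    measurable_fun [set: T] (fun x => (nsq (f x))%:E).
  exact/measurable_EFinP/measurable_nsq.
move=> H E0; have /H : (\int[mu]_x `|(nsq (f x))%:E| = 0)%E.
  rewrite -E0; apply: eq_integral => x _.
  by rewrite gee0_abs// lee_fin nsq_ge0.
by apply: filterS => x /(_ I) /= [] /eqP; rewrite nsq_eq0 => /eqP.
Qed.

Lemma energy_ae0 f : cmeas f -> {ae mu, forall x, f x = 0} -> energy f = 0%E.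
Proof.
move=> mf f0; rewrite (@ae_eq_energy _ (fun=> 0))//.
  by rewrite /energy; under eq_integral do rewrite nsq0; rewrite integral0.
Qed.

(** Replaces the triangle inequality of L^2 without leaving squared norms, at the price of the
    factor 2. *)
Lemma energyB_le f g : cmeas f -> cmeas g ->
  (energy (fun x => f x - g x)%R <= 2%:E * energy f + 2%:E * energy g)%E.
Proof.
move=> mf mg.
have mn h : cmeas h -> measurable_fun [set: T] (fun x => (nsq (h x))%:E).
  by move=> mh; exact/measurable_EFinP/measurable_nsq.
have n0 h x : (0 <= (nsq (h x : R[i]))%:E)%E by rewrite lee_fin nsq_ge0.
rewrite -!ge0_integralZl//; [|exact: mn|exact: mn].
rewrite -ge0_integralD//; last 4 first.
- by move=> x _; rewrite mule_ge0.
- by apply: emeasurable_funM => //; exact: mn.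
- by move=> x _; rewrite mule_ge0.
- by apply: emeasurable_funM => //; exact: mn.
apply: ge0_le_integral => //.
- by apply: mn; exact: cmeasB.
- by apply: emeasurable_funD; apply: emeasurable_funM => //; exact: mn.
- by move=> x _; rewrite -!EFinM -EFinD lee_fin nsqB_le.
Qed.

Lemma ae_eq0_supp f : cmeas f -> mu (supp f) = 0%E -> {ae mu, forall x, f x = 0}.
Proof.
move=> mf f0; exists (supp f); split => //; first exact: measurable_supp.
by move=> x /= /eqP.
Qed.

Lemma supp_ae_eq0 f : cmeas f -> {ae mu, forall x, f x = 0} -> mu (supp f) = 0%E.
Proof.
move=> mf [N [mN N0 fN]]; apply/eqP; rewrite eq_le measure_ge0 andbT -N0.
apply: le_measure; rewrite ?inE//; first exact: measurable_supp.
by move=> x fx; apply: fN => /= fx0; move: fx; rewrite /supp /= fx0 eqxx.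
Qed.

End complex_integral.

Section complex_fubini.
Context (R : realType) d1 d2 (X : measurableType d1) (Y : measurableType d2).
Variable m1 : {sigma_finite_measure set X -> \bar R}.
Variable m2 : {sigma_finite_measure set Y -> \bar R}.
Local Notation m12 := (sigma_finite_prod m1 m2).
Implicit Types (f : X * Y -> R[i]) (g : X * Y -> \bar R).

Lemma measurable_slice1 d' (Z : measurableType d') (g : X * Y -> Z) y :
  measurable_fun [set: X * Y] g -> measurable_fun [set: X] (fun x => g (x, y)).
Proof. by move=> mg; exact: (measurableT_comp mg). Qed.

Lemma measurable_slice2 d' (Z : measurableType d') (g : X * Y -> Z) x :
  measurable_fun [set: X * Y] g -> measurable_fun [set: Y] (fun y => g (x, y)).
Proof. by move=> mg; exact: (measurableT_comp mg). Qed.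

Lemma cmeas_pair1 f y : cmeas f -> cmeas (fun x => f (x, y)).
Proof.
by move=> [fr fi]; split; [exact: (measurable_slice1 y fr)|exact: (measurable_slice1 y fi)].
Qed.

Lemma cmeas_pair2 f x : cmeas f -> cmeas (fun y => f (x, y)).
Proof.
by move=> [fr fi]; split; [exact: (measurable_slice2 x fr)|exact: (measurable_slice2 x fi)].
Qed.

(** Splitting into positive and negative parts avoids any integrability assumption, so that
    [cmeas_FT] can ask for measurability alone. *)
Lemma measurable_integral1 g : measurable_fun [set: X * Y] g ->
  measurable_fun [set: Y] (fun y => \int[m1]_x g (x, y))%E.
Proof.
move=> mg; under eq_fun do rewrite integralE.
apply: emeasurable_funB.
- under eq_fun do under eq_integral do rewrite funepos_comp.
  apply: (measurable_fun_fubini_tonelli_G (fun z => (g^\+ z)%E)) => //.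
  exact: measurable_funepos.
- under eq_fun do under eq_integral do rewrite funeneg_comp.
  apply: (measurable_fun_fubini_tonelli_G (fun z => (g^\- z)%E)) => //.
  exact: measurable_funeneg.
Qed.

Lemma cmeas_cint1 f : cmeas f -> cmeas (fun y => cint m1 (fun x => f (x, y))).
Proof.
move=> [fr fi]; split => /=.
- apply: measurableT_comp => //.
  apply: (measurable_integral1 (g := fun z => (complex.Re (f z))%:E)).
  exact/measurable_EFinP.
- apply: measurableT_comp => //.
  apply: (measurable_integral1 (g := fun z => (complex.Im (f z))%:E)).
  exact/measurable_EFinP.
Qed.

Lemma ae_cL1_1 f : cL1 m12 f -> {ae m2, forall y, cL1 m1 (fun x => f (x, y))}.
Proof.
by move=> [/ae_integrable2 fr /ae_integrable2 fi]; apply: filterS2 fr fi.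
Qed.

Lemma tonelli1 g : measurable_fun [set: X * Y] g -> (forall z, 0 <= g z)%E ->
  (\int[m12]_z g z = \int[m1]_x \int[m2]_y g (x, y))%E.
Proof. exact: fubini_tonelli1. Qed.

Lemma tonelli2 g : measurable_fun [set: X * Y] g -> (forall z, 0 <= g z)%E ->
  (\int[m12]_z g z = \int[m2]_y \int[m1]_x g (x, y))%E.
Proof. exact: fubini_tonelli2. Qed.

Lemma energy_prod1 f : cmeas f ->
  energy m12 f = (\int[m1]_x energy m2 (fun y => f (x, y)))%E.
Proof.
move=> mf; apply: (@tonelli1 (fun z => (nsq (f z))%:E)).
  exact/measurable_EFinP/measurable_nsq.
by move=> z; rewrite lee_fin nsq_ge0.
Qed.

Lemma energy_prod2 f : cmeas f ->
  energy m12 f = (\int[m2]_y energy m1 (fun x => f (x, y)))%E.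
Proof.
move=> mf; apply: (@tonelli2 (fun z => (nsq (f z))%:E)).
  exact/measurable_EFinP/measurable_nsq.
by move=> z; rewrite lee_fin nsq_ge0.
Qed.

Lemma integrable_fine d (T : measurableType d) (mu : {measure set T -> \bar R})
    (g : T -> \bar R) :
  mu.-integrable [set: T] g -> mu.-integrable [set: T] (fun x => (fine (g x))%:E).
Proof.
move=> gi; apply: (le_integrable measurableT _ _ gi).
  by apply/measurable_EFinP; apply: measurableT_comp => //; exact: measurable_int gi.
move=> x _ /=; case: (g x) => [r| |] //=; rewrite ?normr0 ?leey//.
Qed.

Lemma integrable_fubini_G g : m12.-integrable [set: X * Y] g ->
  m2.-integrable [set: Y] (fun y => \int[m1]_x g (x, y))%E.
Proof.
move=> gi; have mg := measurable_int _ gi.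
have mag : measurable_fun [set: X * Y] (fun z => `|g z|)%E by exact: measurableT_comp.
apply/integrableP; split; first exact: measurable_integral1.
have h : (\int[m2]_y \int[m1]_x `|g (x, y)| < +oo)%E := (integrable21ltyP m1 m2 mg).1 gi.
apply: le_lt_trans h.
apply: ge0_le_integral => //.
- by apply: measurableT_comp => //; exact: measurable_integral1.
- exact: (measurable_integral1 mag).
- by move=> y _; apply: le_abse_integral => //; exact: measurable_slice1.
Qed.

Lemma cint_fubini2 f : cL1 m12 f ->
  cL1 m2 (fun y => cint m1 (fun x => f (x, y))) /\
  cint m12 f = cint m2 (fun y => cint m1 (fun x => f (x, y))).
Proof.
move=> [fr fi]; have rr := integrable_fubini_G fr; have ri := integrable_fubini_G fi.
split; first by split; exact: integrable_fine.
have fineE (h : X * Y -> R) : m12.-integrable [set: X * Y] (EFin \o h) ->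
    \int[m12]_z h z = \int[m2]_y \int[m1]_x h (x, y).
  (* [fine] only alters infinite slice integrals, and those occur on a null set of slices; the outer
     integral is unaffected. *)
  move=> hi; congr fine; rewrite -[LHS](integral21_prod_meas1 hi).
  apply: ae_eq_integral => //.
  - exact/(measurable_int _ (integrable_fubini_G hi)).
  - exact/(measurable_int _ (integrable_fine (integrable_fubini_G hi))).
  - have := ae_integrable2 hi; apply: filterS => y /(integrable_fin_num measurableT) + _.
    by move=> /fineK e; exact: (esym e).
by congr (_ +i* _); exact: fineE.
Qed.

Lemma cint_fubini1 f : cL1 m12 f ->
  cL1 m1 (fun x => cint m2 (fun y => f (x, y))) /\
  cint m12 f = cint m1 (fun x => cint m2 (fun y => f (x, y))).
Proof.
move=> [fr fi]; have rr := integrable_fubini_F fr; have ri := integrable_fubini_F fi.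
split; first by split; exact: integrable_fine.
have fineE (h : X * Y -> R) : m12.-integrable [set: X * Y] (EFin \o h) ->
    \int[m12]_z h z = \int[m1]_x \int[m2]_y h (x, y).
  move=> hi; congr fine; rewrite -[LHS](integral12_prod_meas1 hi).
  apply: ae_eq_integral => //.
  - exact/(measurable_int _ (integrable_fubini_F hi)).
  - exact/(measurable_int _ (integrable_fine (integrable_fubini_F hi))).
  - have := ae_integrable1 hi; apply: filterS => y /(integrable_fin_num measurableT) + _.
    by move=> /fineK e; exact: (esym e).
by congr (_ +i* _); exact: fineE.
Qed.

(** Vanishing almost everywhere amounts to zero energy, and Tonelli computes the energy slice by
    slice. *)
Lemma ae_prod2 f : cmeas f ->
  {ae m12, forall z, f z = 0} <-> {ae m2, forall y, {ae m1, forall x, f (x, y) = 0}}.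
Proof.
move=> mf; split=> f0.
- have := energy_ae0 mf f0; rewrite energy_prod2// => e0.
  have me : measurable_fun [set: Y] (fun y => energy m1 (fun x => f (x, y))).
    apply: (measurable_integral1 (g := fun z => (nsq (f z))%:E)).
    exact/measurable_EFinP/measurable_nsq.
  have /(ae_eq_integral_abs m2 measurableT me) :
      (\int[m2]_y `|energy m1 (fun x => f (x, y))| = 0)%E.
    rewrite -[RHS]e0; apply: eq_integral => y _.
    by rewrite gee0_abs// energy_ge0.
  apply: filterS => y /(_ I) /=; apply: energy_eq0.
  exact: cmeas_pair1.
- apply: energy_eq0 => //; rewrite energy_prod2//.
  rewrite (ae_eq_integral (cst 0%E))//; first by rewrite integral0.
  + apply: (measurable_integral1 (g := fun z => (nsq (f z))%:E)).
    exact/measurable_EFinP/measurable_nsq.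
  + apply: filterS f0 => y f0 _; apply: energy_ae0 => //.
    exact: cmeas_pair1.
Qed.

End complex_fubini.

(** * Fourier pairs *)

Lemma measure_restrict1 (R : realType) d (T : measurableType d)
    (mu : {measure set T -> \bar R}) D : measurable D ->
  mu D = (\int[mu]_x ((fun=> 1) \_ D) x)%E.
Proof. by move=> mD; rewrite -integral_mkcond integral_cst// mul1e. Qed.

Section product_sections.
Context (R : realType) d1 d2 (X : measurableType d1) (Y : measurableType d2).
Variable m1 : {sigma_finite_measure set X -> \bar R}.
Variable m2 : {sigma_finite_measure set Y -> \bar R}.
Local Notation m12 := (sigma_finite_prod m1 m2).
Implicit Types (S : set (X * Y)).

Lemma xsection_setE S x : [set y | S (x, y)] = xsection S x.
Proof. by rewrite xsectionE. Qed.

Lemma ysection_setE S y : [set x | S (x, y)] = ysection S y.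
Proof. by rewrite ysectionE. Qed.

Lemma measurable_section1 S x : measurable S -> measurable [set y | S (x, y)].
Proof. by move=> mS; rewrite xsection_setE; exact: measurable_xsection. Qed.

Lemma measurable_section2 S y : measurable S -> measurable [set x | S (x, y)].
Proof. by move=> mS; rewrite ysection_setE; exact: measurable_ysection. Qed.

Lemma measurable_measure_section1 S : measurable S ->
  measurable_fun [set: X] (fun x => m2 [set y | S (x, y)]).
Proof.
move=> mS; under eq_fun do rewrite xsection_setE.
exact: measurable_fun_xsection.
Qed.

Lemma measurable_measure_section2 S : measurable S ->
  measurable_fun [set: Y] (fun y => m1 [set x | S (x, y)]).
Proof.
move=> mS; under eq_fun do rewrite ysection_setE.
exact: measurable_fun_ysection.
Qed.

Lemma prod_measure_section1 S : measurable S ->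
  m12 S = (\int[m1]_x m2 [set y | S (x, y)])%E.
Proof.
by move=> mS; apply: eq_integral => x _; rewrite xsection_setE.
Qed.

Lemma prod_measure_section2 S : measurable S ->
  m12 S = (\int[m2]_y m1 [set x | S (x, y)])%E.
Proof.
move=> mS; rewrite [LHS]measure_restrict1// tonelli2; last 2 first.
- by apply/(measurable_restrictT _ mS).
- by move=> z; rewrite patchE; case: ifP.
apply: eq_integral => y _; have mSy := measurable_section2 y mS.
by rewrite [RHS]measure_restrict1//.
Qed.

End product_sections.

Section measure_positive.
Context (R : realType) d (T : measurableType d).
Variable mu : {measure set T -> \bar R}.

Lemma integral_gt0_pos (g : T -> \bar R) : measurable_fun [set: T] g ->
  (forall x, 0 <= g x)%E -> (0 < \int[mu]_x g x)%E ->
  (0 < mu [set x | 0 < g x])%E.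
Proof.
move=> mg g0; apply: contraTT; rewrite -!leNgt => S0.
have mS : measurable [set x | (0 < g x)%E].
  rewrite -[X in measurable X]setTI; exact: emeasurable_fun_o_infty.
rewrite (ae_eq_integral (cst 0%E))//; first by rewrite integral0.
exists [set x | (0 < g x)%E]; split => //.
  by apply/eqP; rewrite eq_le measure_ge0 andbT.
move=> x /= /not_implyP[_ gx]; rewrite lt_neqAle g0 andbT.
by apply/eqP => gx0; apply: gx.
Qed.

Lemma ge0_integral_ae_lty (g : T -> \bar R) : measurable_fun [set: T] g ->
  (forall x, 0 <= g x)%E -> (\int[mu]_x g x < +oo)%E ->
  {ae mu, forall x, (g x < +oo)%E}.
Proof.
move=> mg g0 gi; have ig : mu.-integrable [set: T] g.
  apply/integrableP; split => //.
  by under eq_integral do rewrite gee0_abs//.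
have := integrable_ae measurableT ig; apply: filterS => x /(_ I).
by rewrite ge0_fin_numE.
Qed.

Lemma measure_setD_null (S N : set T) : measurable S -> measurable N ->
  mu N = 0%E -> mu (S `\` N) = mu S.
Proof.
move=> mS mN N0; rewrite (measureDI mu mS mN) [X in (_ + X)%E](_ : _ = 0%E) ?adde0//.
by apply/eqP; rewrite eq_le measure_ge0 andbT -N0 le_measure// inE//; exact: measurableI.
Qed.

(** Markov's inequality at level 1, the level that separates null from non-null sets for a discrete
    measure. *)
Lemma measure_ge1_le (g : T -> \bar R) : measurable_fun [set: T] g ->
  (forall x, 0 <= g x)%E -> (mu [set x | 1 <= g x] <= \int[mu]_x g x)%E.
Proof.
move=> mg g0.
have mS : measurable [set x | (1 <= g x)%E].
  rewrite -[X in measurable X]setTI; exact: emeasurable_fun_c_infty.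
rewrite [leLHS]measure_restrict1//.
apply: ge0_le_integral => //.
- by move=> x _; rewrite patchE; case: ifP.
- by apply/(measurable_restrictT _ mS).
- by move=> x _; rewrite patchE; case: ifPn => //; rewrite inE.
Qed.

End measure_positive.

Section fourier_pair.
Context (R : realType) dA dB (A : measurableType dA) (B : measurableType dB).
Variable mu : {sigma_finite_measure set A -> \bar R}.
Variable nu : {sigma_finite_measure set B -> \bar R}.
Variable e : A * B -> R[i].

Definition unimodular : Prop := cmeas e /\ forall z, nsq (e z) = 1.

Definition FT (phi : A -> R[i]) (b : B) : R[i] :=
  cint mu (fun a => phi a * e (a, b)).

Definition plancherel : Prop :=
  forall phi, cL1 mu phi -> energy nu (FT phi) = energy mu phi.

(** Abstracts the fact that a nonzero trigonometric polynomial has a null zero set: a spectrum of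
    finite measure replaces a finite set of frequencies. *)
Definition rigid : Prop :=
  forall phi (E : set A), cL1 mu phi -> (nu (supp (FT phi)) < +oo)%E ->
    measurable E -> (0 < mu E)%E -> (forall a, E a -> phi a = 0) ->
    {ae mu, forall a, phi a = 0}.

Lemma cmeas_FT phi : cmeas e -> cmeas phi -> cmeas (FT phi).
Proof.
move=> me mp; apply: (cmeas_cint1 mu (f := fun z => phi z.1 * e z)).
by apply: cmeasM => //; apply: (cmeas_comp mp).
Qed.

Lemma cL1_FT phi b : unimodular -> cL1 mu phi -> cL1 mu (fun a => phi a * e (a, b)).
Proof.
move=> [me e1] p1; apply: cL1M_unit => //; exact: cmeas_pair1.
Qed.

Lemma FTB phi psi b : unimodular -> cL1 mu phi -> cL1 mu psi ->
  FT (fun a => phi a - psi a) b = FT phi b - FT psi b.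
Proof.
move=> ue p1 q1; rewrite /FT -cintB; [|exact: cL1_FT|exact: cL1_FT].
by apply: eq_cint => a; rewrite mulrBl.
Qed.

Lemma plancherel_inj phi : unimodular -> plancherel -> cL1 mu phi ->
  {ae nu, forall b, FT phi b = 0} -> {ae mu, forall a, phi a = 0}.
Proof.
move=> ue pl p1 F0; have mp := cL1_cmeas p1; apply: energy_eq0 => //.
by rewrite -pl// energy_ae0//; apply: cmeas_FT => //; case: ue.
Qed.

End fourier_pair.

(** * Composition of two partial transforms *)

Section composite.
Context (R : realType) dX dY dZ dW (X : measurableType dX) (Y : measurableType dY)
  (Z : measurableType dZ) (W : measurableType dW).
Variable mX : {sigma_finite_measure set X -> \bar R}.
Variable mY : {sigma_finite_measure set Y -> \bar R}.
Variable mZ : {sigma_finite_measure set Z -> \bar R}.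
Variable mW : {sigma_finite_measure set W -> \bar R}.
Variables (e1 : X * Y -> R[i]) (e2 : Z * W -> R[i]) (e3 : Z * Y -> R[i]).
Hypotheses (ue1 : unimodular e1) (ue2 : unimodular e2) (ue3 : unimodular e3).
Local Notation mXZ := (sigma_finite_prod mX mZ).
Local Notation mYW := (sigma_finite_prod mY mW).
Local Notation mYZ := (sigma_finite_prod mY mZ).

(** First x is transformed into y at fixed z, then z into w at fixed y. In between, the variables
    present are y and z, and the twist [e3] depends on just these; being unimodular, it changes
    neither energies nor supports. *)
Definition comp_kernel (u : (X * Z) * (Y * W)) : R[i] :=
  e1 (u.1.1, u.2.1) * e2 (u.1.2, u.2.2) * e3 (u.1.2, u.2.1).

Lemma unimodular_comp : unimodular comp_kernel.
Proof.
case: ue1 ue2 ue3 => [m1 n1] [m2 n2] [m3 n3]; split.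
- apply: cmeasM; first apply: cmeasM.
  + apply: (cmeas_comp m1); apply: measurable_fun_pair => /=;
      exact: measurableT_comp.
  + apply: (cmeas_comp m2); apply: measurable_fun_pair => /=;
      exact: measurableT_comp.
  + apply: (cmeas_comp m3); apply: measurable_fun_pair => /=;
      exact: measurableT_comp.
- by move=> u; rewrite !nsqM n1 n2 n3 !mulr1.
Qed.

Section on_function.
Variable phi : X * Z -> R[i].
Hypothesis phi1 : cL1 mXZ phi.

(* The transform in the first variable only, twisted by [e3]. *)
Let psi (u : Y * Z) : R[i] :=
  cint mX (fun x => phi (x, u.2) * (e1 (x, u.1) * e3 (u.2, u.1))).

Let psi_cmeas : cmeas psi.
Proof.
apply: (cmeas_cint1 mX (f := fun v : X * (Y * Z) =>
  phi (v.1, v.2.2) * (e1 (v.1, v.2.1) * e3 (v.2.2, v.2.1)))).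
apply: cmeasM; last apply: cmeasM.
- apply: (cmeas_comp (cL1_cmeas phi1)); apply: measurable_fun_pair => //=.
  exact: measurableT_comp.
- apply: (cmeas_comp ue1.1); apply: measurable_fun_pair => //=.
  exact: measurableT_comp.
- apply: (cmeas_comp ue3.1); apply: measurable_fun_pair => /=;
  exact: measurableT_comp.
Qed.

Let cL1_twist y : cL1 mXZ (fun v => phi v * (e1 (v.1, y) * e3 (v.2, y))).
Proof.
apply: cL1M_unit => //; last by move=> v; rewrite nsqM ue1.2 ue3.2 mulr1.
apply: cmeasM; [apply: (cmeas_comp ue1.1)|apply: (cmeas_comp ue3.1)];
  by apply: measurable_fun_pair.
Qed.

(** Holds for every y, not merely almost every one, because the twisted [phi] is integrable on the
    whole product for each fixed y. *)
Let psi_cL1 y : cL1 mZ (fun z => psi (y, z)).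
Proof. exact: (cint_fubini2 (cL1_twist y)).1. Qed.

Let FT_comp y w : FT mXZ comp_kernel phi (y, w) = FT mZ e2 (fun z => psi (y, z)) w.
Proof.
rewrite /FT /comp_kernel /=.
pose h v := phi v * (e1 (v.1, y) * e3 (v.2, y)) * e2 (v.2, w).
have h1 : cL1 mXZ h.
  apply: cL1M_unit => //; last by move=> v; exact: ue2.2.
  by apply: (cmeas_comp ue2.1); apply: measurable_fun_pair.
rewrite (@eq_cint _ _ _ _ _ h); last by move=> -[x z]; rewrite /h /=; ring.
have [h2 ->] := cint_fubini2 h1; apply: ae_eq_cint.
- exact: cL1_cmeas h2.
- apply: cmeasM; first exact: (cL1_cmeas (psi_cL1 y)).
  exact: (cmeas_pair1 _ ue2.1).
- by have := ae_cL1_1 (cL1_twist y); apply: filterS => z /= f1; rewrite /h /= cintZr.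
Qed.

Let psiE : {ae mZ, forall z, cL1 mX (fun x => phi (x, z)) /\
  forall y, psi (y, z) = FT mX e1 (fun x => phi (x, z)) y * e3 (z, y)}.
Proof.
have := ae_cL1_1 phi1; apply: filterS => z f1; split => // y.
rewrite /psi /FT -cintZr; last exact: cL1_FT.
by apply: eq_cint => x /=; rewrite mulrA.
Qed.

Let nsq_psi : {ae mZ, forall z, cL1 mX (fun x => phi (x, z)) /\
  forall y, nsq (psi (y, z)) = nsq (FT mX e1 (fun x => phi (x, z)) y)}.
Proof.
apply: filterS psiE => z [f1 fE].
by split => // y; rewrite fE nsqM ue3.2 mulr1.
Qed.

(** Plancherel for [e1] on almost every slice of fixed z; the twist drops out of the squared
    modulus. *)
Let energy_psi : plancherel mX mY e1 -> energy mYZ psi = energy mXZ phi.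
Proof.
move=> pl; have mp := cL1_cmeas phi1.
rewrite energy_prod2// energy_prod2//; apply: ae_eq_integral => //.
- apply: (measurable_integral1 mY (g := fun v => (nsq (psi v))%:E)).
  exact/measurable_EFinP/measurable_nsq.
- apply: (measurable_integral1 mX (g := fun v => (nsq (phi v))%:E)).
  exact/measurable_EFinP/measurable_nsq.
- apply: filterS nsq_psi => z [f1 fE] _.
  by rewrite -(pl _ f1); apply: eq_energy => y; exact: fE.
Qed.

Lemma energy_comp : plancherel mX mY e1 -> plancherel mZ mW e2 ->
  energy mYW (FT mXZ comp_kernel phi) = energy mXZ phi.
Proof.
move=> pl1 pl2; rewrite -energy_psi// energy_prod1; last first.
  by apply: cmeas_FT; [exact: unimodular_comp.1|exact: (cL1_cmeas phi1)].
rewrite energy_prod1//; apply: eq_integral => y _.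
rewrite -pl2//; apply: eq_energy => w; by rewrite FT_comp.
Qed.

(** The heart of Benedicks' argument. For every y the partial transform [psi (y, z)] vanishes for z
    in [E], as an integral over x of a null function. By Tonelli the transform of [psi (y, .)] has a
    support of finite measure for almost every y, so rigidity of [e2] kills that slice. Hence [psi]
    has zero energy, and so does [phi]. *)
Lemma comp_vanish (E : set Z) : plancherel mX mY e1 -> rigid mZ mW e2 ->
  (mYW (supp (FT mXZ comp_kernel phi)) < +oo)%E ->
  measurable E -> (0 < mZ E)%E ->
  (forall z, E z -> {ae mX, forall x, phi (x, z) = 0}) ->
  {ae mXZ, forall v, phi v = 0}.
Proof.
move=> pl1 rg S mE E0 phiE.
have mF : cmeas (FT mXZ comp_kernel phi).
  by apply: cmeas_FT; [exact: unimodular_comp.1|exact: (cL1_cmeas phi1)].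
apply: energy_eq0; first exact: (cL1_cmeas phi1).
rewrite -energy_psi// energy_prod1//.
rewrite (ae_eq_integral (cst 0%E))//; first by rewrite integral0.
  apply: (measurable_fun_fubini_tonelli_F (fun v => (nsq (psi v))%:E)).
    exact/measurable_EFinP/measurable_nsq.
  by move=> v; rewrite lee_fin nsq_ge0.
have mS := measurable_supp mF.
move: S; rewrite prod_measure_section1// => S.
have := ge0_integral_ae_lty (measurable_measure_section1 mW mS) (fun=> measure_ge0 _ _) S.
apply: filterS => y Sy _; apply: energy_ae0; first exact: cmeas_pair2.
apply: (rg _ E) => //.
- apply: le_lt_trans Sy; rewrite le_eqVlt; apply/orP; left; apply/eqP; congr (mW _).
  by apply/funext => w; rewrite /supp /= FT_comp.
- move=> z Ez; rewrite /psi /=; transitivity (cint mX (fun=> 0)); last exact: cint0.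
  apply: ae_eq_cint; [|exact: cmeas_cst|].
    by have [] := cL1_cmeas (cL1_twist y) => mr mi; exact: (cmeas_pair1 z (conj mr mi)).
  by apply: filterS (phiE z Ez) => x ->; rewrite mul0r.
Qed.

(** Rigidity of [e1] is used first, on slices of fixed z, to produce the set of z required by
    [comp_vanish]. Discreteness of [W] is what bounds the y-support of those slices. *)
Lemma comp_rigid_on (E : set (X * Z)) :
  (forall S, measurable S -> mW S < 1 -> mW S = 0)%E ->
  plancherel mX mY e1 -> rigid mX mY e1 ->
  plancherel mZ mW e2 -> rigid mZ mW e2 ->
  (mYW (supp (FT mXZ comp_kernel phi)) < +oo)%E ->
  measurable E -> (0 < mXZ E)%E -> (forall v, E v -> phi v = 0) ->
  {ae mXZ, forall v, phi v = 0}.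
Proof.
move=> discW pl1 rg1 pl2 rg2 Soo mE E0 phiE; have mphi := cL1_cmeas phi1.
have mF : cmeas (FT mXZ comp_kernel phi).
  by apply: cmeas_FT => //; exact: unimodular_comp.1.
have mS := measurable_supp mF; set S := supp _ in Soo mS.
have mSy := measurable_measure_section1 mW mS.
(* The y whose section of the support is not null; by Markov this set is no larger than the support
   itself. *)
pose YS := [set y | (1 <= mW [set w | S (y, w)])%E].
have mYS : measurable YS.
  rewrite -[X in measurable X]setTI; exact: emeasurable_fun_c_infty.
have YSoo : (mY YS < +oo)%E.
  apply: le_lt_trans (measure_ge1_le mY mSy _) _ => //.
  by rewrite -prod_measure_section1.
(* The part of the support of [psi] lying off [YS]. It is null: there the transform in z vanishes
   almost everywhere, and Plancherel for [e2] is injective. *)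
pose N := supp psi `&` (~` YS `*` setT).
have mN : measurable N.
  apply: measurableI; first exact: measurable_supp.
  by apply: measurableX => //; exact: measurableC.
have N0 : mYZ N = 0%E.
  rewrite prod_measure_section1//; apply: integral0_eq => y _.
  have [Yy|/negP nYy] := pselect (YS y).
    rewrite (_ : [set z | N (y, z)] = set0) ?measure0//.
    by apply/seteqP; split => z //= [_ []].
  have Sy0 : mW [set w | S (y, w)] = 0%E.
    apply: discW; first exact: measurable_section1.
    by rewrite ltNge; apply/negP => h; move/negP: nYy; apply.
  apply/eqP; rewrite eq_le measure_ge0 andbT.
  have psi0 : {ae mZ, forall z, psi (y, z) = 0}.
    apply: (plancherel_inj ue2 pl2 (psi_cL1 y)).
    exists [set w | S (y, w)]; split => //; first exact: measurable_section1.
    by move=> w /= h; rewrite /S /supp /= FT_comp; exact/eqP.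
  rewrite -(supp_ae_eq0 (cmeas_pair2 y psi_cmeas) psi0) le_measure ?inE//.
  - exact: measurable_section1.
  - exact: (measurable_supp (cmeas_pair2 y psi_cmeas)).
  - by move=> z [].
have Nz0 : {ae mZ, forall z, mY [set y | N (y, z)] = 0%E}.
  have mNz := measurable_measure_section2 mY mN.
  move: N0; rewrite prod_measure_section2// => N0.
  have /(ae_eq_integral_abs mZ measurableT mNz) :
      (\int[mZ]_z `|mY [set y | N (y, z)]| = 0)%E.
    by rewrite -[RHS]N0; apply: eq_integral => z _; rewrite gee0_abs.
  by apply: filterS => z /(_ I).
(* For almost every z the support of [psi (., z)] lies in [YS] up to a null set, so it has finite
   measure and rigidity of [e1] applies as soon as the section of [E] is not null. *)
have [Nul [mNul Nul0 sNul]] : {ae mZ, forall z,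
    {ae mX, forall x, phi (x, z) = 0} \/ mX [set x | E (x, z)] = 0%E}.
  apply: filterS2 nsq_psi Nz0 => z [f1 fE] Nz.
  have [->|Ez] := eqVneq (mX [set x | E (x, z)]) 0%E; [by right|left].
  apply: (rg1 _ [set x | E (x, z)]) => //; last 3 first.
  - exact: measurable_section2.
  - by rewrite lt_neqAle measure_ge0 andbT eq_sym.
  - by move=> x /= /phiE.
  have mNz := measurable_section2 z mN.
  apply: (@le_lt_trans _ _ (mY (YS `|` [set y | N (y, z)]))).
    apply: le_measure; rewrite ?inE//; last first.
      move=> y; rewrite /supp /= -nsq_eq0 -fE nsq_eq0 => yz.
      by have [|] := pselect (YS y); [left|right].
    - exact: measurableU.
    - by apply: measurable_supp; apply: cmeas_FT; [exact: ue1.1|exact: (cL1_cmeas f1)].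
  by rewrite measureU0.
(* Tonelli: [E] has positive measure, so a set of z of positive measure has non-null sections. *)
pose Z0 := [set z | (0 < mX [set x | E (x, z)])%E].
have mEz := measurable_measure_section2 mX mE.
have mZ0 : measurable Z0.
  rewrite -[X in measurable X]setTI; exact: emeasurable_fun_o_infty.
apply: (comp_vanish (E := Z0 `\` Nul)) => //.
- exact: measurableD.
- rewrite measure_setD_null//; apply: integral_gt0_pos => //.
  by rewrite -prod_measure_section2.
- move=> z [/= Z0z Nz]; have [//|h] : {ae mX, forall x, phi (x, z) = 0} \/
      mX [set x | E (x, z)] = 0%E by apply: contrapT => h; apply: Nz; apply: sNul.
  by move: Z0z; rewrite /Z0 /= h ltxx.
Qed.

End on_function.

Lemma plancherel_comp : plancherel mX mY e1 -> plancherel mZ mW e2 ->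
  plancherel mXZ mYW comp_kernel.
Proof. by move=> pl1 pl2 phi p1; exact: energy_comp. Qed.

Lemma rigid_comp :
  (forall S, measurable S -> mW S < 1 -> mW S = 0)%E ->
  plancherel mX mY e1 -> rigid mX mY e1 ->
  plancherel mZ mW e2 -> rigid mZ mW e2 ->
  rigid mXZ mYW comp_kernel.
Proof. by move=> ? ? ? ? ? phi E p1; exact: comp_rigid_on. Qed.

End composite.

(** * Unfolding along a lattice *)

Lemma pmule_lty (R : realType) (c : R) (x : \bar R) :
  0 < c -> (c%:E * x < +oo)%E -> (x < +oo)%E.
Proof.
by move=> c0; rewrite !ltey; apply: contraNN => /eqP ->; rewrite gt0_muley.
Qed.

Section unfolding.
Context (R : realType) d d' (S : measurableType d) (T : measurableType d').
Variables (m : {measure set S -> \bar R}) (mu : {measure set T -> \bar R}).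
Variables (c : R) (j : S -> T).

(** [mu] is [c] times the image of [m] under [j]. This covers linear changes of variables, with [c]
    the Jacobian, measure-preserving maps, and the unfolding along a lattice of covolume [c]. *)
Definition unfolds : Prop := measurable_fun [set: S] j /\
  forall f : T -> \bar R, measurable_fun [set: T] f -> (forall x, 0 <= f x)%E ->
    (\int[mu]_x f x = c%:E * \int[m]_s f (j s))%E.

Hypotheses (c0 : 0 < c) (uj : unfolds).

Lemma unfolds_measure D : measurable D -> (mu D = c%:E * m (j @^-1` D))%E.
Proof.
move=> mD; have mjD : measurable (j @^-1` D).
  by rewrite -[X in measurable X]setTI; apply: uj.1.
rewrite [LHS]measure_restrict1// (uj.2 ((fun=> 1%E) \_ D)); last 2 first.
- by apply/(measurable_restrictT _ mD).
- by move=> x; rewrite patchE; case: ifP.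
congr (_ * _)%E; by rewrite [RHS]measure_restrict1//.
Qed.

Lemma unfolds_integrable (f : T -> \bar R) : mu.-integrable [set: T] f ->
  m.-integrable [set: S] (f \o j).
Proof.
move=> /integrableP[mf foo]; apply/integrableP; split.
  exact: (measurableT_comp mf uj.1).
move: foo; rewrite (uj.2 (fun x => `|f x|)%E)//; last exact: measurableT_comp.
exact: pmule_lty.
Qed.

Lemma unfolds_integral (f : T -> \bar R) : mu.-integrable [set: T] f ->
  (\int[mu]_x f x = c%:E * \int[m]_s f (j s))%E.
Proof.
move=> fi; have mf := measurable_int _ fi; have fji := unfolds_integrable fi.
rewrite integralE [in RHS]integralE muleBr//; last first.
  apply: fin_num_adde_defl; rewrite fin_numN.
  exact: (integrable_neg_fin_num measurableT fji).
rewrite !uj.2//; [|exact: measurable_funeneg|exact: measurable_funepos].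
rewrite -[fun x => f (j x)]/(f \o j).
congr (_ * _ - _ * _)%E; apply: eq_integral => s _.
- by rewrite [in RHS](funepos_comp f j).
- by rewrite [in RHS](funeneg_comp f j).
Qed.

Lemma unfolds_cL1 (f : T -> R[i]) : cL1 mu f -> cL1 m (fun s => f (j s)).
Proof.
by move=> [fr fi]; split; [exact: (unfolds_integrable fr)|
  exact: (unfolds_integrable fi)].
Qed.

Lemma unfolds_cint (f : T -> R[i]) : cL1 mu f ->
  cint mu f = c%:C * cint m (fun s => f (j s)).
Proof.
move=> fL; have [gr gi] := unfolds_cL1 fL; have [fr fi] := fL.
apply: complex_ext; rewrite ?(cReM, cImM) /= ?(mul0r, subr0, addr0) /Rintegral.
- by rewrite (unfolds_integral fr) fineM//; exact: integrable_fin_num.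
- by rewrite (unfolds_integral fi) fineM//; exact: integrable_fin_num.
Qed.

Lemma unfolds_energy (f : T -> R[i]) : cmeas f ->
  energy mu f = (c%:E * energy m (fun s => f (j s)))%E.
Proof.
move=> mf; apply: uj.2; first exact/measurable_EFinP/measurable_nsq.
by move=> x; rewrite lee_fin nsq_ge0.
Qed.

End unfolding.

(* [T] is folded by a lattice: [zj (k, a)] translates the point [a] of the
   fundamental domain by the lattice vector [k], [zj'] does the same for the
   dual lattice, and the Fourier character splits along the two unfoldings
   (Zak transform). The covolumes of the lattices are [c] and [zc']. *)
Record zak (R : realType) d (T : measurableType d)
    (mu : {sigma_finite_measure set T -> \bar R}) (dot : T -> T -> R) (c : R) := Zak {
  zdK : measure_display;
  zdA : measure_display;
  zK : measurableType zdK;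
  zA : measurableType zdA;
  zkap : {sigma_finite_measure set zK -> \bar R};
  zalp : {sigma_finite_measure set zA -> \bar R};
  ze : zK * zA -> R[i];
  ze3 : zA * zA -> R[i];
  zj : zK * zA -> T;
  zj' : zA * zK -> T;
  zc' : R;
  z_dot : measurable_fun [set: T * T] (fun u => dot u.1 u.2);
  z_c : 0 < c;
  z_c' : 0 < zc';
  z_e : unimodular ze;
  z_e3 : unimodular ze3;
  z_disc : forall S, measurable S -> (zkap S < 1 -> zkap S = 0)%E;
  z_prob : zalp [set: zA] = 1%E;
  z_j : unfolds (sigma_finite_prod zkap zalp) mu c zj;
  z_j' : unfolds (sigma_finite_prod zalp zkap) mu zc' zj';
  z_char : forall k a b m, expN2pii (dot (zj' (b, m)) (zj (k, a))) =
    ze (k, b) * ze (m, a) * ze3 (a, b);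
  z_plancherel : plancherel zkap zalp ze;
  z_plancherel' : plancherel zalp zkap (fun u => ze (u.2, u.1));
  z_rigid : rigid zalp zkap (fun u => ze (u.2, u.1)) }.

Arguments ze {R d T mu dot c} z.
Arguments ze3 {R d T mu dot c} z.
Arguments zj {R d T mu dot c} z.
Arguments zj' {R d T mu dot c} z.
Arguments z_plancherel {R d T mu dot c} z.
Arguments z_plancherel' {R d T mu dot c} z.
Arguments z_rigid {R d T mu dot c} z.

Definition dot_char (R : realType) T (dot : T -> T -> R) (u : T * T) : R[i] :=
  expN2pii (dot u.2 u.1).

Lemma unimodular_swap (R : realType) dX dY (X : measurableType dX)
    (Y : measurableType dY) (e : X * Y -> R[i]) :
  unimodular e -> unimodular (fun u : Y * X => e (u.2, u.1)).
Proof.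
move=> [me e1]; split=> [|u]; last exact: e1.
by apply: (cmeas_comp me); exact: measurable_fun_pair.
Qed.

Lemma unimodular_dot (R : realType) d (T : measurableType d) (dot : T -> T -> R) :
  measurable_fun [set: T * T] (fun u => dot u.1 u.2) -> unimodular (dot_char dot).
Proof.
move=> md; split=> [|u]; last exact: nsq_expN2pii.
apply: cmeas_expN2pii.
exact: (measurableT_comp md (measurable_fun_pair measurable_snd measurable_fst)).
Qed.

Section zak_theory.
Context (R : realType) d (T : measurableType d)
    (mu : {sigma_finite_measure set T -> \bar R}) (dot : T -> T -> R) (c : R).
Variable z : zak mu dot c.
Local Notation e := (dot_char dot).
Local Notation mKA := (sigma_finite_prod (zkap z) (zalp z)).
Local Notation mAK := (sigma_finite_prod (zalp z) (zkap z)).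
Local Notation E := (comp_kernel (ze z) (fun u => ze z (u.2, u.1)) (ze3 z)).

Let ue : unimodular e. Proof. exact: unimodular_dot (z_dot z). Qed.

(** By [z_char] the Fourier kernel, read in both unfoldings, is [comp_kernel]: a Fourier series from
    the lattice index k to b, the twist in a and b, then Fourier coefficients from a to m. The
    factor [c] is the covolume of the unfolded integral. *)
Lemma zak_FT h u : cL1 mu h ->
  FT mu e h (zj' z u) = c%:C * FT mKA E (fun v => h (zj z v)) u.
Proof.
move=> h1; rewrite /FT (unfolds_cint (z_c z) (z_j z)); last exact: cL1_FT.
congr (_ * _); apply: eq_cint => -[k a]; case: u => b m.
by rewrite /dot_char z_char.
Qed.

Lemma zak_plancherel h : cL1 mu h ->
  energy mu (FT mu e h) = ((c * zc' z)%:E * energy mu h)%E.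
Proof.
move=> h1; have hj := unfolds_cL1 (z_c z) (z_j z) h1.
rewrite (unfolds_energy (z_j' z)); last by apply: cmeas_FT; [exact: ue.1|exact: (cL1_cmeas h1)].
rewrite (unfolds_energy (z_j z) (cL1_cmeas h1)).
rewrite -(plancherel_comp (z_e z) (unimodular_swap (z_e z)) (z_e3 z)
  (z_plancherel z) (z_plancherel' z) hj).
(* The squared modulus of the factor in [zak_FT] gives [c ^+ 2] and the frequency side gives [zc'];
   one [c] is absorbed by the energy of [h] itself. *)
rewrite muleA -EFinM (_ : c * zc' z * c = zc' z * c ^+ 2); last by ring.
rewrite [in RHS]EFinM -muleA; congr (_ * _)%E; rewrite /energy -ge0_integralZl//.
- by apply: eq_integral => u _; rewrite zak_FT// nsqM -EFinM /nsq /= expr0n addr0.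
- apply/measurable_EFinP/measurable_nsq; apply: cmeas_FT; last exact: (cL1_cmeas hj).
  exact: (unimodular_comp (z_e z) (unimodular_swap (z_e z)) (z_e3 z)).1.
- by move=> u _; rewrite lee_fin nsq_ge0.
- by rewrite lee_fin sqr_ge0.
Qed.

(* Benedicks' theorem for functions whose support is smaller than the
   fundamental domain: the lattice translates of the support then miss a set of
   positive measure, on which the periodization of [h] vanishes. *)
Lemma zak_benedicks h : cL1 mu h -> (mu (supp h) < c%:E)%E ->
  (mu (supp (FT mu e h)) < +oo)%E -> {ae mu, forall x, h x = 0}.
Proof.
move=> h1 hsupp Fsupp; have hj := unfolds_cL1 (z_c z) (z_j z) h1.
have mh := cL1_cmeas h1; have mhj := cL1_cmeas hj.
have mF : cmeas (FT mu e h) by apply: cmeas_FT => //; exact: ue.1.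
set phi := (fun v => h (zj z v)) in hj mhj.
apply: energy_eq0 => //; rewrite (unfolds_energy (z_j z))//.
rewrite (_ : energy _ _ = 0%E) ?mule0//; apply: energy_ae0 => //.
have mphi := measurable_supp mhj.
(* Counts the lattice translates of [a] that fall in the support of [h]. *)
pose g a := zkap z [set k | supp phi (k, a)].
have mg : measurable_fun [set: zA z] g by exact: measurable_measure_section2.
pose D := [set a | (1 <= g a)%E].
have mD : measurable D.
  rewrite -[X in measurable X]setTI; exact: emeasurable_fun_c_infty.
(* The integral of [g] over the cell is the measure of the support divided by [c], hence below 1,
   while the cell has total mass 1. *)
have D1 : (zalp z D < 1)%E.
  apply: le_lt_trans (measure_ge1_le (zalp z) mg _) _ => //.
  rewrite -(prod_measure_section2 (zkap z) (zalp z) mphi).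
  move: hsupp; rewrite (unfolds_measure (z_j z)); last exact: measurable_supp.
  rewrite -[X in (_ < X)%E]mule1 lte_pmul2l// ?lte_fin ?(z_c z)//.
have DC0 : (0 < zalp z (~` D))%E.
  rewrite lt_neqAle measure_ge0 andbT eq_sym; apply/eqP => DC0.
  move: D1; rewrite (_ : zalp z D = 1%E) ?ltxx// -(z_prob z) -(setUv D).
  by rewrite measureU0//; exact: measurableC.
apply: (comp_vanish (z_e z) (unimodular_swap (z_e z)) (z_e3 z) hj (E := ~` D)
  (z_plancherel z) (z_rigid z)) => //.
- move: Fsupp; rewrite (unfolds_measure (z_j' z)); last exact: measurable_supp.
  rewrite (_ : zj' z @^-1` _ = supp (FT mKA E phi)).
    exact: pmule_lty (z_c' z).
  apply/seteqP; split => u /=; rewrite /supp /= zak_FT// mulf_eq0 negb_or.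
    by move=> /andP[].
  by move=> ->; rewrite andbT eq_complex /= gt_eqF// (z_c z).
- exact: measurableC.
(* Off [D] the count is below 1, hence 0 by discreteness: no translate of [a] meets the support. *)
- move=> a /= /negP; rewrite -ltNge => ga.
  apply: ae_eq0_supp; first exact: (cmeas_pair1 a mhj).
  by apply: z_disc => //; exact: (measurable_section2 a mphi).
Qed.

End zak_theory.

Section unfolds_constructions.
Context (R : realType).

Lemma unfolds_comp d1 d2 d3 (T1 : measurableType d1) (T2 : measurableType d2)
    (T3 : measurableType d3) (m1 : {measure set T1 -> \bar R})
    (m2 : {measure set T2 -> \bar R}) (m3 : {measure set T3 -> \bar R})
    (c c' : R) (i : T1 -> T2) (j : T2 -> T3) :
  unfolds m1 m2 c i -> unfolds m2 m3 c' j -> unfolds m1 m3 (c' * c) (j \o i).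
Proof.
move=> [mi ui] [mj uj]; split; first exact: measurableT_comp.
move=> f mf f0; rewrite (uj f mf f0).
by rewrite (ui (f \o j) (measurableT_comp mf mj) (fun=> f0 _)) EFinM muleA.
Qed.

Lemma unfolds_prod d1 d2 d1' d2' (S1 : measurableType d1) (S2 : measurableType d2)
    (T1 : measurableType d1') (T2 : measurableType d2')
    (m1 : {sigma_finite_measure set S1 -> \bar R})
    (m2 : {sigma_finite_measure set S2 -> \bar R})
    (mu1 : {sigma_finite_measure set T1 -> \bar R})
    (mu2 : {sigma_finite_measure set T2 -> \bar R})
    (c1 c2 : R) (j1 : S1 -> T1) (j2 : S2 -> T2) : 0 <= c1 -> 0 <= c2 ->
  unfolds m1 mu1 c1 j1 -> unfolds m2 mu2 c2 j2 ->
  unfolds (sigma_finite_prod m1 m2) (sigma_finite_prod mu1 mu2) (c1 * c2)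
    (fun s => (j1 s.1, j2 s.2)).
Proof.
move=> c10 c20 [mj1 u1] [mj2 u2].
have mj12 : measurable_fun [set: S1 * S2] (fun s => (j1 s.1, j2 s.2)).
  exact: (measurable_fun_pair (measurableT_comp mj1 measurable_fst)
    (measurableT_comp mj2 measurable_snd)).
have mj2' : measurable_fun [set: T1 * S2] (fun s => (s.1, j2 s.2)).
  exact: (measurable_fun_pair measurable_fst (measurableT_comp mj2 measurable_snd)).
split => // f mf f0.
rewrite tonelli1// (@tonelli1 _ _ _ _ _ m1 m2 (fun s => f (j1 s.1, j2 s.2)))//; last first.
  exact: (measurableT_comp mf mj12).
under eq_integral => x _.
  rewrite (u2 (fun y => f (x, y))); [over|exact: (measurable_slice2 _ mf)|by []].
have mG : measurable_fun [set: T1] (fun x => \int[m2]_s f (x, j2 s))%E.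
  apply: (measurable_fun_fubini_tonelli_F (fun s => f (s.1, j2 s.2))) => //.
  exact: (measurableT_comp mf mj2').
rewrite ge0_integralZl//; last by move=> x _; exact: integral_ge0.
rewrite u1//; last by move=> x; exact: integral_ge0.
by rewrite muleA -EFinM mulrC.
Qed.

(** Regroups two lattices and two cells into two pairs of a lattice and a cell. Both sides become
    fourfold iterated integrals that differ by one exchange of the middle pair. *)
Lemma unfolds_swap4 dK1 dK2 dA1 dA2 (K1 : measurableType dK1)
    (K2 : measurableType dK2) (A1 : measurableType dA1) (A2 : measurableType dA2)
    (k1 : {sigma_finite_measure set K1 -> \bar R})
    (k2 : {sigma_finite_measure set K2 -> \bar R})
    (a1 : {sigma_finite_measure set A1 -> \bar R})
    (a2 : {sigma_finite_measure set A2 -> \bar R}) :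
  unfolds (sigma_finite_prod (sigma_finite_prod k1 k2) (sigma_finite_prod a1 a2))
    (sigma_finite_prod (sigma_finite_prod k1 a1) (sigma_finite_prod k2 a2)) 1
    (fun s => ((s.1.1, s.2.1), (s.1.2, s.2.2))).
Proof.
have mj : measurable_fun [set: (K1 * K2) * (A1 * A2)]
    (fun s => ((s.1.1, s.2.1), (s.1.2, s.2.2))).
  have m11 := measurableT_comp (@measurable_fst _ _ K1 K2) (@measurable_fst _ _ _ (A1 * A2)%type).
  have m12 := measurableT_comp (@measurable_snd _ _ K1 K2) (@measurable_fst _ _ _ (A1 * A2)%type).
  have m21 := measurableT_comp (@measurable_fst _ _ A1 A2) (@measurable_snd _ _ (K1 * K2)%type _).
  have m22 := measurableT_comp (@measurable_snd _ _ A1 A2) (@measurable_snd _ _ (K1 * K2)%type _).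
  exact: (measurable_fun_pair (measurable_fun_pair m11 m21) (measurable_fun_pair m12 m22)).
split => // f mf f0; rewrite mul1e.
have mfj := measurableT_comp mf mj.
rewrite tonelli1// tonelli1//; last 2 first.
- exact: (measurable_fun_fubini_tonelli_F f).
- by move=> ?; exact: integral_ge0.
rewrite [RHS]tonelli1// tonelli1//; last 2 first.
- exact: (measurable_fun_fubini_tonelli_F _ mfj (fun=> f0 _)).
- by move=> ?; exact: integral_ge0.
apply: eq_integral => x1 _.
under eq_integral => y1 _.
  rewrite tonelli1; [over|exact: (measurable_slice2 _ mf)|by []].
under [RHS]eq_integral => x2 _.
  rewrite tonelli1; [over|exact: (measurable_slice2 _ mfj)|by []].
apply: (fubini_tonelli (fun u : A1 * K2 => \int[a2]_y2 f ((x1, u.1), (u.2, y2)))%E);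
  last by move=> ?; exact: integral_ge0.
apply: (measurable_fun_fubini_tonelli_F
  (fun v : (A1 * K2) * A2 => f ((x1, v.1.1), (v.1.2, v.2)))) => //.
apply: (measurableT_comp mf).
have m11 := measurableT_comp (@measurable_fst _ _ A1 K2) (@measurable_fst _ _ _ A2).
have m12 := measurableT_comp (@measurable_snd _ _ A1 K2) (@measurable_fst _ _ _ A2).
exact: (measurable_fun_pair (measurable_fun_pair (measurable_cst x1) m11)
  (measurable_fun_pair m12 measurable_snd)).
Qed.

Lemma unfolds_prod4 dK1 dK2 dA1 dA2 d1 d2 (K1 : measurableType dK1)
    (K2 : measurableType dK2) (A1 : measurableType dA1) (A2 : measurableType dA2)
    (T1 : measurableType d1) (T2 : measurableType d2)
    (k1 : {sigma_finite_measure set K1 -> \bar R})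
    (k2 : {sigma_finite_measure set K2 -> \bar R})
    (a1 : {sigma_finite_measure set A1 -> \bar R})
    (a2 : {sigma_finite_measure set A2 -> \bar R})
    (mu1 : {sigma_finite_measure set T1 -> \bar R})
    (mu2 : {sigma_finite_measure set T2 -> \bar R})
    (c1 c2 : R) (j1 : K1 * A1 -> T1) (j2 : K2 * A2 -> T2) :
  0 < c1 -> 0 < c2 ->
  unfolds (sigma_finite_prod k1 a1) mu1 c1 j1 ->
  unfolds (sigma_finite_prod k2 a2) mu2 c2 j2 ->
  unfolds (sigma_finite_prod (sigma_finite_prod k1 k2) (sigma_finite_prod a1 a2))
    (sigma_finite_prod mu1 mu2) (c1 * c2)
    (fun s => (j1 (s.1.1, s.2.1), j2 (s.1.2, s.2.2))).
Proof.
move=> c10 c20 u1 u2; rewrite -[c1 * c2]mulr1.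
exact: (unfolds_comp (unfolds_swap4 k1 k2 a1 a2)
  (unfolds_prod (ltW c10) (ltW c20) u1 u2)).
Qed.

End unfolds_constructions.

Section zak_product.
Context (R : realType) d1 d2 (T1 : measurableType d1) (T2 : measurableType d2)
  (mu1 : {sigma_finite_measure set T1 -> \bar R})
  (mu2 : {sigma_finite_measure set T2 -> \bar R})
  (dot1 : T1 -> T1 -> R) (dot2 : T2 -> T2 -> R) (c1 c2 : R).

(** The points whose section has measure at least 1 form, by Markov, a set of measure below 1, hence
    null; every other section is null too. *)
Lemma discrete_prod dX dY (X : measurableType dX) (Y : measurableType dY)
    (m1 : {sigma_finite_measure set X -> \bar R})
    (m2 : {sigma_finite_measure set Y -> \bar R}) :
  (forall S, measurable S -> m1 S < 1 -> m1 S = 0)%E ->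
  (forall S, measurable S -> m2 S < 1 -> m2 S = 0)%E ->
  (forall S, measurable S -> sigma_finite_prod m1 m2 S < 1 ->
    sigma_finite_prod m1 m2 S = 0)%E.
Proof.
move=> disc1 disc2 S mS; rewrite prod_measure_section1// => S1.
have mg := measurable_measure_section1 m2 mS.
rewrite (ae_eq_integral (cst 0%E))//; first by rewrite integral0.
have mD : measurable [set x | (1 <= m2 [set y | S (x, y)])%E].
  rewrite -[X in measurable X]setTI; exact: emeasurable_fun_c_infty.
exists [set x | (1 <= m2 [set y | S (x, y)])%E]; split => //.
  by apply: disc1 => //; apply: le_lt_trans S1; exact: measure_ge1_le.
move=> x /= /not_implyP[_ gx]; rewrite leNgt; apply/negP => h; apply: gx.
by apply: disc2 => //; exact: measurable_section1.
Qed.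

(** Kernels and twists are multiplied as [comp_kernel] with the constant twist 1, so Plancherel and
    rigidity of the product are instances of the composite results. *)
Definition zak_prod (z1 : zak mu1 dot1 c1) (z2 : zak mu2 dot2 c2) :
  zak (sigma_finite_prod mu1 mu2)
    (fun x y => dot1 x.1 y.1 + dot2 x.2 y.2) (c1 * c2).
Proof.
have u1 : unimodular (fun _ : zK z2 * zA z1 => 1 : R[i]).
  by split=> [|?]; [exact: cmeas_cst|exact: nsq1].
have u1' : unimodular (fun _ : zA z2 * zK z1 => 1 : R[i]).
  by split=> [|?]; [exact: cmeas_cst|exact: nsq1].
apply: (@Zak R _ _ _ _ _ _ _ (zK z1 * zK z2)%type (zA z1 * zA z2)%type
  (sigma_finite_prod (zkap z1) (zkap z2)) (sigma_finite_prod (zalp z1) (zalp z2))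
  (comp_kernel (ze z1) (ze z2) (fun=> 1))
  (comp_kernel (ze3 z1) (ze3 z2) (fun=> 1))
  (fun s => (zj z1 (s.1.1, s.2.1), zj z2 (s.1.2, s.2.2)))
  (fun s => (zj' z1 (s.1.1, s.2.1), zj' z2 (s.1.2, s.2.2)))
  (zc' z1 * zc' z2)).
- have p11 := measurableT_comp (@measurable_fst _ _ T1 T2) (@measurable_fst _ _ _ (T1 * T2)%type).
  have p12 := measurableT_comp (@measurable_snd _ _ T1 T2) (@measurable_fst _ _ _ (T1 * T2)%type).
  have p21 := measurableT_comp (@measurable_fst _ _ T1 T2) (@measurable_snd _ _ (T1 * T2)%type _).
  have p22 := measurableT_comp (@measurable_snd _ _ T1 T2) (@measurable_snd _ _ (T1 * T2)%type _).
  apply: measurable_funD.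
  + exact: (measurableT_comp (z_dot z1) (measurable_fun_pair p11 p21)).
  + exact: (measurableT_comp (z_dot z2) (measurable_fun_pair p12 p22)).
- by rewrite mulr_gt0 ?(z_c z1) ?(z_c z2).
- by rewrite mulr_gt0 ?(z_c' z1) ?(z_c' z2).
- exact: (unimodular_comp (z_e z1) (z_e z2) u1).
- apply: (unimodular_comp (z_e3 z1) (z_e3 z2)).
  by split=> [|?]; [exact: cmeas_cst|exact: nsq1].
- exact: (discrete_prod (@z_disc _ _ _ _ _ _ z1) (@z_disc _ _ _ _ _ _ z2)).
- rewrite -setXTT; transitivity (zalp z1 setT * zalp z2 setT)%E.
    exact: product_measure1E.
  by rewrite !z_prob mule1.
- exact: (unfolds_prod4 (z_c z1) (z_c z2) (z_j z1) (z_j z2)).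
- exact: (unfolds_prod4 (z_c' z1) (z_c' z2) (z_j' z1) (z_j' z2)).
- move=> [k1 k2] [a1 a2] [b1 b2] [m1 m2]; rewrite /comp_kernel /=.
  by rewrite expN2piiD !z_char; ring.
- exact: (plancherel_comp (z_e z1) (z_e z2) u1 (z_plancherel z1) (z_plancherel z2)).
- exact: (plancherel_comp (unimodular_swap (z_e z1)) (unimodular_swap (z_e z2)) u1'
    (z_plancherel' z1) (z_plancherel' z2)).
- exact: (rigid_comp (unimodular_swap (z_e z1)) (unimodular_swap (z_e z2)) u1'
    (@z_disc _ _ _ _ _ _ z2)
    (z_plancherel' z1) (z_rigid z1) (z_plancherel' z2) (z_rigid z2)).
Defined.

End zak_product.

(** Only the unfolding maps are composed with [i]; lattice, cell and kernels stay the same. *)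
Definition zak_transport (R : realType) d d' (T : measurableType d)
    (T' : measurableType d') (mu : {sigma_finite_measure set T -> \bar R})
    (mu' : {sigma_finite_measure set T' -> \bar R})
    (dot : T -> T -> R) (dot' : T' -> T' -> R) (c : R) (i : T -> T') :
  measurable_fun [set: T' * T'] (fun u => dot' u.1 u.2) ->
  unfolds mu mu' 1 i -> (forall x y, dot' (i x) (i y) = dot x y) ->
  zak mu dot c -> zak mu' dot' c.
Proof.
move=> mdot ui idot z.
apply: (@Zak R _ _ _ _ _ _ _ _ _ (zkap z) (zalp z) (ze z) (ze3 z)
  (i \o zj z) (i \o zj' z) (zc' z)) => //.
- exact: z_c z.
- exact: z_c' z.
- exact: z_e.
- exact: z_e3.
- exact: z_disc.
- exact: z_prob.
- by have := unfolds_comp (z_j z) ui; rewrite mul1r.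
- by have := unfolds_comp (z_j' z) ui; rewrite mul1r.
- by move=> k a b m; rewrite /= idot z_char.
- exact: (z_plancherel z).
- exact: (z_plancherel' z).
- exact: (z_rigid z).
Defined.

(** * Completeness of the square-integrable functions *)

Lemma cvg_geometric_increments (R : realType) (a : R^nat) (M : R) :
  (forall i, `|a i.+1 - a i| <= M * 2^-1 ^+ i) -> cvgn a.
Proof.
move=> aM; have M0 : 0 <= M.
  by have := le_trans (normr_ge0 _) (aM 0%N); rewrite expr0 mulr1.
have cs : cvgn (series (telescope a)).
  apply: normed_cvg; apply: (@series_le_cvg _ _ (geometric M 2^-1)) => //.
  - by move=> n; exact: normr_ge0.
  - by move=> n; rewrite /geometric /= mulr_ge0// exprn_ge0// invr_ge0.
  - by apply: is_cvg_geometric_series; rewrite ger0_norm ?invr_ge0// invf_lt1// ltr1n.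
rewrite (_ : a = (fun n => a 0%N + series (telescope a) n)).
  by apply: is_cvgD => //; exact: is_cvg_cst.
by apply/funext => n; exact: eq_sum_telescope.
Qed.

Lemma limn_einf_le_cst (R : realType) (u : (\bar R)^nat) (x : \bar R) :
  (forall n, u n <= x)%E -> (limn_einf u <= x)%E.
Proof.
move=> ux; rewrite limn_einf_lim; apply: lime_le; first exact: is_cvg_einfs.
near=> n; apply: (@le_trans _ _ (u n)) => //.
by apply: ereal_inf_lbound; exists n => //=.
Unshelve. all: by end_near. Qed.

Section riesz_fischer.
Context (R : realType) d (T : measurableType d) (mu : {measure set T -> \bar R}).

Lemma energyB_sym (f g : T -> R[i]) :
  energy mu (fun x => f x - g x) = energy mu (fun x => g x - f x).
Proof. by apply: eq_energy => x; rewrite -nsqN opprB. Qed.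

(** The weights [4^i] cancel the factors [4^-1 ^+ i], so the weighted squared increments have total
    integral at most 1 and are summable almost everywhere. Increments are then bounded by a constant
    times [2^-i]. *)
Lemma fast_cauchy_ae_cvg (v : nat -> T -> R[i]) : (forall i, cmeas (v i)) ->
  (forall i, energy mu (fun x => v i.+1 x - v i x)%R <=
    (4^-1 ^+ i * 2^-1 ^+ i.+1)%:E)%E ->
  {ae mu, forall x, cvgn (fun i => complex.Re (v i x)) /\
                    cvgn (fun i => complex.Im (v i x))}.
Proof.
move=> mv ve; pose g i x : \bar R := (4 ^+ i * nsq (v i.+1 x - v i x))%:E.
have mg i : measurable_fun [set: T] (g i).
  apply/measurable_EFinP; apply: measurable_funM => //.
  by apply: measurable_nsq; exact: cmeasB.
have g0 i x : (0 <= g i x)%E by rewrite lee_fin mulr_ge0 ?exprn_ge0 ?nsq_ge0.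
have Goo : (\int[mu]_x (\sum_(0 <= i <oo) g i x) < +oo)%E.
  rewrite integral_nneseries//; apply: (@le_lt_trans _ _ 1%:E); last exact: ltry.
  apply: le_trans (epsilon_trick0 xpredT ler01).
  apply: lee_nneseries => [i _ _|i _]; first exact: integral_ge0.
  rewrite /g; under eq_integral do rewrite EFinM.
  rewrite ge0_integralZl//; last 2 first.
  - by apply/measurable_EFinP; apply: measurable_nsq; exact: cmeasB.
  - by move=> x _; rewrite lee_fin nsq_ge0.
  apply: (@le_trans _ _ ((4 ^+ i)%:E * (4^-1 ^+ i * 2^-1 ^+ i.+1)%:E))%E.
    by apply: lee_wpmul2l; [rewrite lee_fin exprn_ge0|exact: ve].
  rewrite -EFinM lee_fin mulrA -exprMn divff ?expr1n ?mul1r//.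
  by rewrite exprVn natrX.
have mG : measurable_fun [set: T] (fun x => \sum_(0 <= i <oo) g i x)%E.
  exact: ge0_emeasurable_sum.
have Gi : mu.-integrable [set: T] (fun x => \sum_(0 <= i <oo) g i x)%E.
  apply/integrableP; split => //.
  by under eq_integral do rewrite gee0_abs ?nneseries_ge0//.
have := integrable_ae measurableT Gi; apply: filterS => x /(_ I) Gx.
set M := fine (\sum_(0 <= i <oo) g i x)%E.
have gM i : 4 ^+ i * nsq (v i.+1 x - v i x) <= M.
  rewrite -lee_fin /M fineK//.
  apply: le_trans (nneseries_lim_ge i.+1 (fun n _ _ => g0 n x)).
  rewrite big_nat_recr//=; apply: leeDr; exact: sume_ge0.
have M0 : 0 <= M by apply: le_trans (gM 0%N); rewrite mulr_ge0 ?nsq_ge0.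
(* The bound [M <= (1 + M)^2] avoids taking the square root of [M]. *)
have bnd (r : R) i : 4 ^+ i * r ^+ 2 <= M -> `|r| <= (1 + M) * 2^-1 ^+ i.
  move=> rM; rewrite exprVn ler_pdivlMr ?exprn_gt0// mulrC.
  rewrite -(@ler_pXn2r _ 2) ?nnegrE ?addr_ge0 ?mulr_ge0 ?exprn_ge0//.
  rewrite exprMn real_normK ?num_real// -exprM mulnC exprM.
  rewrite (_ : 2 ^+ 2 = 4); last by ring.
  by apply: le_trans rM _; nra.
have le2 (p : R) (z w : R[i]) i : 4 ^+ i * nsq (z - w) <= p ->
    4 ^+ i * (complex.Re z - complex.Re w) ^+ 2 <= p /\
    4 ^+ i * (complex.Im z - complex.Im w) ^+ 2 <= p.
  move=> h; split; apply: le_trans h; rewrite ler_wpM2l ?exprn_ge0//;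
    by rewrite /nsq !(cReD, cReN, cImD, cImN) ?lerDl ?lerDr sqr_ge0.
split; apply: (@cvg_geometric_increments _ _ (1 + M)) => i; apply: bnd;
  by have [] := le2 _ _ _ _ (gM i).
Qed.

(** A fast subsequence converges almost everywhere, and Fatou's lemma bounds the distance from [u k]
    to the limit by the Cauchy estimates. *)
Lemma riesz_fischer (u : nat -> T -> R[i]) : (forall k, cmeas (u k)) ->
  (forall e : R, 0 < e -> exists N, forall k l, (N <= k)%N -> (N <= l)%N ->
    (energy mu (fun x => u k x - u l x)%R <= e%:E)%E) ->
  exists2 H, cmeas H & forall e : R, 0 < e -> exists N, forall k, (N <= k)%N ->
    (energy mu (fun x => u k x - H x)%R <= e%:E)%E.
Proof.
move=> mu_ cau; pose eps i : R := 4^-1 ^+ i * 2^-1 ^+ i.+1.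
have eps0 i : 0 < eps i by rewrite mulr_gt0 ?exprn_gt0 ?invr_gt0.
have [N NP] := choice (fun i => cau (eps i) (eps0 i)).
(* The sum makes [s] nondecreasing and at least [N i]; the extra [i] makes [s (i + N0)] at least
   [N0], as the final Cauchy estimate requires. *)
pose s i := (\sum_(j < i.+1) N j + i)%N.
have Ns i : (N i <= s i)%N by rewrite /s big_ord_recr/= addnAC leq_addl.
have sS i : (s i <= s i.+1)%N.
  by rewrite /s leq_add// [leqRHS]big_ord_recr/= leq_addr.
pose v i := u (s i).
have mv i : cmeas (v i) by exact: mu_.
have vcvg : {ae mu, forall x, cvgn (fun i => complex.Re (v i x)) /\
                              cvgn (fun i => complex.Im (v i x))}.
  by apply: fast_cauchy_ae_cvg => // i; apply: NP => //; exact: leq_trans (sS _).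
(* An upper limit exists and is measurable everywhere; on the null set of divergence [fine] merely
   has to return some real. *)
pose lim (h : R[i] -> R) x := fine (limn_esup (fun i => (h (v i x))%:E)).
pose H x : R[i] := lim (@complex.Re R) x +i* lim (@complex.Im R) x.
have mlim (h : R[i] -> R) : (forall i, measurable_fun [set: T] (fun x => h (v i x))) ->
    measurable_fun [set: T] (lim h).
  move=> mh; apply: (measurableT_comp (fine_measurable measurableT)).
  apply: (@measurable_fun_limn_esup _ _ _ _ (fun i x => (h (v i x))%:E)) => i.
  exact/measurable_EFinP.
have mH : cmeas H by split; apply: mlim => i; have [] := mv i.
have limP (h : R[i] -> R) x : cvgn (fun i => h (v i x)) ->
    h (v i x) @[i --> \oo] --> lim h x.
  move=> hc; have hcE : (h (v i x))%:E @[i --> \oo] --> (limn (fun i => h (v i x)))%:E.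
    by apply: cvg_EFin; [exact: nearW|exact: hc].
  by rewrite /lim (cvg_limn_einf_sup hcE).2.
exists H => // e e0; have [N0 N0P] := cau e e0; exists N0 => k Nk.
have nsq_cvg x : cvgn (fun i => complex.Re (v i x)) ->
    cvgn (fun i => complex.Im (v i x)) ->
    (nsq (u k x - v (i + N0)%N x))%:E @[i --> \oo] --> (nsq (u k x - H x))%:E.
  move=> /limP cr /limP ci; apply: cvg_EFin; first exact: nearW.
  rewrite /comp /= /nsq !(cReD, cReN, cImD, cImN) /=.
  under eq_fun do rewrite !(cReD, cReN, cImD, cImN).
  have sh (a : R^nat) (l : R) : a i @[i --> \oo] --> l -> a (i + N0)%N @[i --> \oo] --> l.
    by move=> al; rewrite (cvg_shiftn N0 a).
  apply: cvgD; apply: cvgM; (apply: cvgB; [exact: cvg_cst|]).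
  - exact: sh cr.
  - exact: sh cr.
  - exact: sh ci.
  - exact: sh ci.
have mk i : measurable_fun [set: T] (fun x => (nsq (u k x - v (i + N0)%N x))%:E).
  by apply/measurable_EFinP; apply: measurable_nsq; exact: cmeasB.
rewrite /energy (ae_eq_integral
  (fun x => limn_einf (fun i => (nsq (u k x - v (i + N0)%N x))%:E)))//; last 3 first.
- by apply/measurable_EFinP; apply: measurable_nsq; exact: cmeasB.
- under eq_fun do rewrite -[limn_einf _]oppeK -limn_esupN.
  apply: measurableT_comp => //.
  apply: (@measurable_fun_limn_esup _ _ _ _
    (fun i x => - (nsq (u k x - v (i + N0)%N x))%:E)%E) => i.
  exact: measurableT_comp.
- by apply: filterS vcvg => x [cr ci] _; rewrite (cvg_limn_einf_sup (nsq_cvg x cr ci)).1.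
apply: le_trans (fatou mu measurableT mk _) _.
  by move=> i x _; rewrite lee_fin nsq_ge0.
apply: limn_einf_le_cst => i; apply: N0P => //.
by rewrite /s addnA leq_addl.
Qed.

End riesz_fischer.

(** * Fourier series *)

Section torus_measure.
Context (R : realType).

(** The circle is modelled by the whole line with the uniform probability of the closed unit
    interval; outside points and the doubled endpoint are invisible to the measure. *)
Definition torus : set (measurableTypeR R) -> \bar R := uniform_prob (@ltr01 R).
HB.instance Definition _ := Probability.on torus.

Lemma ge0_torus_integral (f : measurableTypeR R -> \bar R) :
  measurable_fun [set: measurableTypeR R] f -> (forall x, 0 <= f x)%E ->
  (\int[torus]_x f x = \int[@lebesgue_measure R]_(x in `[0%R, 1%R]) f x)%E.
Proof. by move=> mf f0; rewrite integral_uniform// subr0 invr1 mul1e. Qed.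

Lemma torus_integral (f : measurableTypeR R -> \bar R) :
  measurable_fun [set: measurableTypeR R] f ->
  (\int[torus]_x f x = \int[@lebesgue_measure R]_(x in `[0%R, 1%R]) f x)%E.
Proof.
move=> mf; rewrite integralE [RHS]integralE !ge0_torus_integral//.
- exact: measurable_funeneg.
- exact: measurable_funepos.
Qed.

Lemma torus_measureE (D : set R) : measurable D ->
  torus D = (@lebesgue_measure R) (D `&` `[0%R, 1%R]).
Proof.
move=> mD; rewrite measure_restrict1// ge0_torus_integral//.
- rewrite -[RHS]mul1e -integral_cst//; last exact: measurableI.
  by rewrite -integral_mkcondr setIC.
- exact/(measurable_restrictT _ mD).
- by move=> x; rewrite patchE; case: ifP.
Qed.

Lemma torus_ae (P : R -> Prop) :
  {ae @lebesgue_measure R, forall x, 0 <= x <= 1 -> P x} -> {ae torus, forall x, P x}.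
Proof.
move=> [N [mN N0 PN]]; pose I := [set` `[0 : R, 1]].
have mI : measurable (~` I) by apply: measurableC; exact: measurable_itv.
exists (N `|` ~` I); split; first exact: measurableU.
- have N0' : torus N = 0%E.
    apply/eqP; rewrite torus_measureE// eq_le measure_ge0 andbT -N0.
    by rewrite le_measure// inE//; exact: measurableI.
  have I0 : torus (~` I) = 0%E by rewrite torus_measureE// setICl measure0.
  by apply: null_set_setU.
- move=> x Px; have [Ix|nIx] := pselect (I x); [left|by right].
  by apply: PN => /= h; apply: Px; apply: h; move: Ix; rewrite /I /= in_itv.
Qed.

Lemma torus_countable (D : set R) : countable D -> measurable D /\ torus D = 0%E.
Proof.
move=> cD; have mD : measurable D by exact: countable_measurable.
split => //; apply/eqP; rewrite torus_measureE// eq_le measure_ge0 andbT.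
rewrite -(countable_lebesgue_measure0 cD) le_measure// inE//; exact: measurableI.
Qed.

End torus_measure.

Section frequencies.

(* [nat] enumerates the integers, so that the counting measure on [nat] can
   stand for the one on the dual group of the torus. *)
Definition freq (k : nat) : int := if odd k then Negz k./2 else Posz k./2.

Definition freq_inv (n : int) : nat :=
  match n with Posz m => m.*2 | Negz m => m.*2.+1 end.

Lemma freqK : cancel freq freq_inv.
Proof.
move=> k; rewrite /freq -[in RHS](odd_double_half k).
by case: (odd k).
Qed.

Lemma freq_invK : cancel freq_inv freq.
Proof.
case=> m; rewrite /freq_inv /freq.
  by rewrite odd_double doubleK.
by rewrite /= odd_double /= uphalf_double.
Qed.

Lemma freq_inj : injective freq. Proof. exact: can_inj freqK. Qed.

End frequencies.

Section torus_characters.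
Context (R : realType).
Implicit Types (n : int) (a : measurableTypeR R).
Local Notation tor := (@torus R).

(** The sign is that of the Fourier kernel, which is why trigonometric sums are later built from
    [echar (- n)]. *)
Definition echar n a : R[i] := expN2pii (n%:~R * (a : R)).

Lemma echarD n m a : echar (n + m) a = echar n a * echar m a.
Proof. by rewrite /echar intrD mulrDl expN2piiD. Qed.

Lemma echar0 a : echar 0 a = 1.
Proof. by rewrite /echar mul0r expN2pii0. Qed.

Lemma echarN n a : echar (- n) a = conjc (echar n a).
Proof. by rewrite /echar mulrNz mulNr expN2piiN. Qed.

Lemma nsq_echar n a : nsq (echar n a) = 1.
Proof. exact: nsq_expN2pii. Qed.

Lemma cmeas_echar n : cmeas (echar n : measurableTypeR R -> R[i]).
Proof. by apply: cmeas_expN2pii; exact: measurable_funM. Qed.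

Lemma integral01_deriv (f F : R -> R) :
  (forall x : R, is_derive x 1 F (f x)) -> continuous f ->
  (\int[@lebesgue_measure R]_(x in `[0%R, 1%R]) (f x)%:E = (F 1 - F 0)%:E)%E.
Proof.
move=> dF cf; have cF (x : R) : {for x, continuous F}.
  apply: differentiable_continuous; apply/derivable1_diffP.
  exact: (@ex_derive _ _ _ _ _ _ _ (dF x)).
rewrite (@continuous_FTC2 _ _ F) ?EFinB//.
- exact: continuous_subspaceT.
- split.
  + by move=> x _; exact: (@ex_derive _ _ _ _ _ _ _ (dF x)).
  + exact/cvg_at_right_filter/cF.
  + exact/cvg_at_left_filter/cF.
- by move=> x _; rewrite derive1E; exact: derive_val.
Qed.

(** For n nonzero the primitives [sin (w * a) / w] and [cos (w * a) / w] take equal values at 0 and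
    1, since [w] is a multiple of 2 pi. *)
Lemma cint_echar n : cint tor (echar n) = (n == 0)%:R.
Proof.
have [mr mi] := cmeas_echar n.
have [->|n0] := eqVneq n 0.
  rewrite (@eq_cint _ _ _ _ _ (fun=> 1)); last by move=> a; exact: echar0.
  apply: complex_ext; rewrite /= /Rintegral ?integral0//.
  by rewrite integral_cst//= mul1e probability_setT.
pose w : R := 2 * pi * n%:~R.
have w0 : w != 0 by rewrite !mulf_neq0 ?intr_eq0// gt_eqF// pi_gt0.
have wE a : 2 * pi * (n%:~R * a) = w * a by rewrite mulrA.
have dw (x : R) : is_derive x 1 (fun a => w * a) w.
  have := is_deriveZ w (is_derive_id x 1); by rewrite /GRing.scale /= mulr1.
have cw (x : R) : {for x, continuous (fun a => w * a)}.
  by apply: differentiable_continuous; apply/derivable1_diffP;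
    exact: (@ex_derive _ _ _ _ _ _ _ (dw x)).
have cosw : cos w = 1.
  exact: (congr1 (@complex.Re R) (expN2pii_int R n)).
have sinw : sin w = 0.
  have := expN2pii_int R n => /(congr1 (@complex.Im R)) /= /eqP.
  by rewrite oppr_eq0 => /eqP.
have dsin (x : R) : is_derive x 1 (fun a => w^-1 * sin (w * a)) (cos (w * x)).
  have := is_deriveZ w^-1 (is_derive1_comp (is_derive_sin (w * x)) (dw x)).
  by rewrite /GRing.scale /= mulrCA mulVf// mulr1.
have dcos (x : R) : is_derive x 1 (fun a => w^-1 * cos (w * a)) (- sin (w * x)).
  have := is_deriveZ w^-1 (is_derive1_comp (is_derive_cos (w * x)) (dw x)).
  by rewrite /GRing.scale /= mulrCA mulVf// mulr1.
apply: complex_ext; rewrite /cint /= /Rintegral torus_integral; do ?exact/measurable_EFinP.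
- under eq_integral do rewrite wE.
  rewrite (integral01_deriv dsin)/=; first by rewrite mulr1 mulr0 sin0 sinw subrr.
  by move=> x; apply: (continuous_comp (cw x)); exact: continuous_cos.
- under eq_integral do rewrite wE.
  rewrite (integral01_deriv dcos)/=; first by rewrite mulr1 mulr0 cos0 cosw subrr.
  move=> x; apply: (continuous_comp (continuous_comp (cw x) (@continuous_sin _ _))).
  exact: opp_continuous.
Qed.

End torus_characters.

(** * Uniqueness of the Fourier coefficients of an integrable function *)

Section step_polynomial.
Context (R : realType).

Lemma bernoulli_le (y : R) m : 0 <= y <= 1 -> 1 - m%:R * y <= (1 - y) ^+ m.
Proof.
move=> /andP[y0 y1]; elim: m => [|m IH]; first by rewrite mul0r subr0 expr0.
rewrite exprSr; apply: (@le_trans _ _ ((1 - m%:R * y) * (1 - y))).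
  rewrite -subr_ge0 [X in 0 <= X](_ : _ = m%:R * y ^+ 2); last by ring.
  by rewrite mulr_ge0 ?sqr_ge0.
by rewrite ler_wpM2r ?subr_ge0.
Qed.

Lemma bernoulli_ge (y : R) m : 0 <= y -> 1 + m%:R * y <= (1 + y) ^+ m.
Proof.
move=> y0; elim: m => [|m IH]; first by rewrite mul0r addr0 expr0.
rewrite exprSr; apply: (@le_trans _ _ ((1 + m%:R * y) * (1 + y))).
  rewrite -subr_ge0 [X in 0 <= X](_ : _ = m%:R * y ^+ 2); last by ring.
  by rewrite mulr_ge0 ?sqr_ge0.
by rewrite ler_wpM2r ?addr_ge0.
Qed.

(* Kuhn's polynomials, from his proof of the Weierstrass theorem. *)
Definition kuhn (n : nat) : {poly R} := 1 - (1 - 'X^n) ^+ (2 ^ n).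

Lemma kuhnE n x : (kuhn n).[x] = 1 - (1 - x ^+ n) ^+ (2 ^ n).
Proof. by rewrite /kuhn !hornerE. Qed.

Lemma kuhn_bound n x : 0 <= x <= 1 -> 0 <= (kuhn n).[x] <= 1.
Proof.
move=> /andP[x0 x1]; rewrite kuhnE.
have xn1 : x ^+ n <= 1 by rewrite exprn_ile1.
have h0 : 0 <= 1 - x ^+ n by rewrite subr_ge0.
have h1 : 1 - x ^+ n <= 1 by rewrite gerBl exprn_ge0.
by rewrite subr_ge0 exprn_ile1// gerBl exprn_ge0.
Qed.

(** Bernoulli's inequality bounds the value by [2^n * x^n], a geometric sequence of ratio below
    1. *)
Lemma kuhn_cvg0 x : 0 <= x -> x < 2^-1 -> (kuhn n).[x] @[n --> \oo] --> (0 : R).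
Proof.
move=> x0 x2; have x1 : x <= 1 by lra.
apply: (@squeeze_cvgr _ _ _ _ (fun=> 0) (fun n => (2 * x) ^+ n)).
- apply: nearW => n; have /andP[-> _] := kuhn_bound n (introT andP (conj x0 x1)).
  rewrite kuhnE lerBlDl -lerBlDr exprMn -natrX.
  by apply: bernoulli_le; rewrite exprn_ge0// exprn_ile1.
- exact: cvg_cst.
- by apply: cvg_expr; rewrite ger0_norm; lra.
Qed.

(** The product of [(1 - x^n)^(2^n)] and [(1 + x^n)^(2^n)] is at most 1, and by Bernoulli the second
    factor is at least [(2 * x)^n]. *)
Lemma kuhn_cvg1 x : 2^-1 < x -> x <= 1 -> (kuhn n).[x] @[n --> \oo] --> (1 : R).
Proof.
move=> x2 x1; have x0 : 0 < x by lra.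
apply: (@squeeze_cvgr _ _ _ _ (fun n => 1 - ((2 * x)^-1) ^+ n) (fun=> 1)).
- apply: nearW => n; have /andP[_ ->] := kuhn_bound n (introT andP (conj (ltW x0) x1)).
  rewrite andbT kuhnE lerD2l lerN2 exprVn.
  have xn0 : 0 < x ^+ n by rewrite exprn_gt0.
  have xn1 : x ^+ n <= 1 by rewrite exprn_ile1// ltW.
  rewrite -[leRHS]mul1r ler_pdivlMr ?exprn_gt0 ?mulr_gt0// exprMn -natrX.
  apply: (@le_trans _ _ ((1 - x ^+ n) ^+ (2 ^ n) * (1 + x ^+ n) ^+ (2 ^ n))).
    rewrite ler_wpM2l ?exprn_ge0 ?subr_ge0//.
    by apply: le_trans (bernoulli_ge _ (ltW xn0)); rewrite lerDr.
  rewrite -exprMn exprn_ile1//; nra.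
- rewrite -[X in _ --> X]subr0; apply: cvgB; first exact: cvg_cst.
  apply: cvg_expr; rewrite ger0_norm ?invr_ge0; last by lra.
  by rewrite invf_lt1; lra.
- exact: cvg_cst.
Qed.

End step_polynomial.

Section torus_uniqueness.
Context (R : realType).
Local Notation tor := (@torus R).
Implicit Types (phi : measurableTypeR R -> R[i]).

(* A trigonometric polynomial with values in [0, 1] that exceeds 1/2 on [0, 1]
   exactly in ]0, t[: Kuhn's polynomials of it approximate the indicator of
   ]0, t[, so an integrable function with zero Fourier coefficients integrates
   to 0 on ]0, t[. *)
Definition bump (t a : R) : R := 2^-1 + 2^-1 * (sin (pi * a) * sin (pi * (t - a))).

(** The product of sines is [(cos (pi * (2 * a - t)) - cos (pi * t)) / 2], which involves only the
    frequencies 0, 1 and -1. *)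
Lemma bump_echar t : exists b c d : R[i], forall a,
  (bump t a)%:C = b + c * echar 1 a + d * echar (-1) a.
Proof.
exists (2^-1 - 4^-1 * cos (pi * t))%:C.
exists ((8^-1 * cos (pi * t)) +i* (8^-1 * sin (pi * t))).
exists ((8^-1 * cos (pi * t)) +i* (- (8^-1 * sin (pi * t)))) => a.
have e2 : 2 * pi * a = pi * a + pi * a by ring.
rewrite echarN /echar /expN2pii mul1r /= e2 cosD sinD /bump mulrBr sinB.
apply: complex_ext => /=; last by ring.
have := cos2Dsin2 (pi * a).
set c := cos (pi * a); set s := sin (pi * a).
set ct := cos (pi * t); set st := sin (pi * t) => cs.
apply/eqP; rewrite -subr_eq0; apply/eqP.
transitivity (- 4^-1 * ct * (c ^+ 2 + s ^+ 2 - 1)); first by field.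
by rewrite cs subrr mulr0.
Qed.

Lemma bump_bound t a : 0 <= bump t a <= 1.
Proof.
have [s1 s2] : `|sin (pi * a)| <= 1 /\ `|sin (pi * (t - a))| <= 1.
  by split; rewrite ler_norml sin_geN1 sin_le1.
have : `|sin (pi * a) * sin (pi * (t - a))| <= 1 by rewrite normrM mulr_ile1.
by rewrite /bump ler_norml => /andP[h1 h2]; apply/andP; split; lra.
Qed.

Lemma bump_gt t a : 0 < a -> a < t -> t <= 1 -> 2^-1 < bump t a.
Proof.
move=> a0 at_ t1; rewrite /bump ltrDl mulr_gt0// mulr_gt0// sin_gt0_pi//.
- by rewrite mulr_gt0 ?pi_gt0//= gtr_pMr ?pi_gt0//; lra.
- by rewrite mulr_gt0 ?pi_gt0 ?subr_gt0//= gtr_pMr ?pi_gt0//; lra.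
Qed.

Lemma bump_lt t a : 0 < t -> t < a -> a < 1 -> bump t a < 2^-1.
Proof.
move=> t0 ta a1; rewrite /bump gtrDl pmulr_rlt0// pmulr_rlt0; last first.
  by apply: sin_gt0_pi; rewrite mulr_gt0 ?pi_gt0//= ?gtr_pMr ?pi_gt0//; lra.
rewrite -[t - a]opprB mulrN sinN oppr_lt0 sin_gt0_pi//.
by rewrite mulr_gt0 ?pi_gt0 ?subr_gt0//= gtr_pMr ?pi_gt0//; lra.
Qed.

Lemma measurable_bump t : measurable_fun [set: R] (bump t).
Proof.
have ms (h : R -> R) : measurable_fun [set: R] h ->
    measurable_fun [set: R] (fun a => sin (h a)).
  move=> mh; apply: measurableT_comp => //.
  by apply: continuous_measurable_fun; exact: continuous_sin.
apply: measurable_funD => //; apply: measurable_funM => //; apply: measurable_funM.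
- by apply: ms; exact: measurable_funM.
- by apply: ms; apply: measurable_funM => //; exact: measurable_funB.
Qed.

Section vanishing_coefficients.
Variable phi : measurableTypeR R -> R[i].
Hypothesis phi1 : cL1 tor phi.
Hypothesis phi0 : forall n : int, cint tor (fun a => phi a * echar n a) = 0.
Variable t : R.

(** Multiplication by [bump] moves a frequency by at most 1, so the induction must carry all n at
    once. *)
Lemma bump_exp_orth N (n : int) :
  cL1 tor (fun a => phi a * (bump t a ^+ N)%:C * echar n a) /\
  cint tor (fun a => phi a * (bump t a ^+ N)%:C * echar n a) = 0.
Proof.
elim: N n => [|N IH] n.
  rewrite (_ : (fun a => _) = (fun a => phi a * echar n a)); last first.
    by apply/funext => a; rewrite expr0 mulr1.
  split; last exact: phi0.
  by apply: cL1M_unit => //; [exact: cmeas_echar|exact: nsq_echar].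
have [b [c [d bE]]] := bump_echar t.
pose F m a := phi a * (bump t a ^+ N)%:C * echar m a.
rewrite (_ : (fun a => _) =
  (fun a => b * F n a + c * F (n + 1) a + d * F (n - 1) a)); last first.
  apply/funext => a; rewrite /F exprSr rmorphM /= bE !echarD; ring.
have [F1 I1] := IH n; have [F2 I2] := IH (n + 1); have [F3 I3] := IH (n - 1).
have b1 := cL1Z b F1; have c1 := cL1Z c F2; have d1 := cL1Z d F3.
split; first by apply: cL1D => //; exact: cL1D.
by rewrite cintD//; [rewrite cintD// !cintZ// I1 I2 I3 !mulr0 !addr0|exact: cL1D].
Qed.

Lemma bump_poly_orth (p : {poly R}) :
  cL1 tor (fun a => phi a * (p.[bump t a])%:C) /\
  cint tor (fun a => phi a * (p.[bump t a])%:C) = 0.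
Proof.
pose F (i : 'I_(size p)) a := (p`_i)%:C * (phi a * (bump t a ^+ i)%:C * echar 0 a).
rewrite (_ : (fun a => _) = (fun a => \sum_(i < size p) F i a)); last first.
  apply/funext => a; rewrite horner_coef rmorph_sum mulr_sumr.
  by apply: eq_bigr => i _; rewrite /F echar0 mulr1 rmorphM; ring.
have F1 i : cL1 tor (F i) by apply: cL1Z; exact: (bump_exp_orth i 0).1.
split; first exact: cL1_sum.
rewrite cint_sum// big1// => i _; rewrite cintZ; last exact: (bump_exp_orth i 0).1.
by rewrite (bump_exp_orth i 0).2 mulr0.
Qed.

(** Kuhn's polynomials of [bump] are bounded by 1 and tend to the indicator of the open interval
    from 0 to [t], so dominated convergence carries the vanishing over. It is stated for real [h],
    to be used on each coordinate. *)
Lemma vanishing_integral0 (h : R -> R) :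
  0 < t <= 1 -> tor.-integrable [set: R] (EFin \o h) ->
  (forall p : {poly R}, \int[tor]_a (h a * p.[bump t a]) = 0) ->
  \int[@lebesgue_measure R]_(a in `[0, t]) h a = 0.
Proof.
move=> /andP[t0 t1] hi hp; have mh : measurable_fun [set: R] h.
  by apply/measurable_EFinP; exact: measurable_int hi.
pose F n a := (h a * (kuhn R n).[bump t a])%:E.
have mF n : measurable_fun [set: measurableTypeR R] (F n).
  apply/measurable_EFinP; apply: measurable_funM => //.
  apply: measurableT_comp; last exact: measurable_bump.
  by apply: continuous_measurable_fun; exact: continuous_horner.
have mI : measurable_fun [set: measurableTypeR R] (fun a => (h a * \1_`]0, t[ a)%:E).
  by apply/measurable_EFinP; apply: measurable_funM => //; exact: measurable_indic.
have hb : {ae tor, forall a, forall n, [set: measurableTypeR R] a ->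
    (`|F n a| <= `|(h a)%:E|)%E}.
  apply: nearW => a n _; rewrite /F abse_EFin lee_fin normrM.
  have /andP[k0 k1] := kuhn_bound n (bump_bound t a).
  by rewrite ler_piMr// ger0_norm.
(* At these three points [bump] equals 1/2, the threshold where neither limit of Kuhn's polynomials
   is available. *)
have ae4 : {ae tor, forall a : measurableTypeR R, a != 0 :> R /\ a != 1 :> R /\ a != t :> R}.
  have /torus_countable[mD D0] : countable [set 0; 1; t] by exact: finite_set_countable.
  exists [set 0; 1; t]; split => // a /= ha; apply: contrapT => hb'; apply: ha.
  by split; last split; apply/eqP => ae; apply: hb'; rewrite ae; [left; left|left; right|right].
have cF : {ae tor, forall a, [set: measurableTypeR R] a ->
    F n a @[n --> \oo] --> (h a * \1_`]0, t[ a)%:E}.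
  have a01 : {ae tor, forall a : measurableTypeR R, (0 : R) <= a <= 1} by apply: torus_ae; exact: nearW.
  apply: (@filterS2 _ _ (ae_filter_ringOfSetsType tor) _ _ _ _ ae4 a01) => a [a0 [a1 at_]] /andP[a0' a1'] _.
  have {a0 a0'} a0 : 0 < a by rewrite lt_neqAle eq_sym a0.
  have {a1 a1'} a1 : a < 1 by rewrite lt_neqAle a1.
  have /andP[b0 b1] := bump_bound t a.
  apply: cvg_EFin; first exact: nearW.
  apply: cvgM; first exact: cvg_cst.
  rewrite indicE; have [ta|ta|ta] := ltgtP a t; last by rewrite ta eqxx in at_.
  - rewrite mem_set; first by apply: kuhn_cvg1 => //; exact: bump_gt.
    by rewrite /= in_itv/= a0.
  - rewrite memNset; first by apply: kuhn_cvg0 => //; exact: bump_lt.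
    by rewrite /= in_itv/= a0/= => /(lt_trans ta); rewrite ltxx.
have hi' : tor.-integrable [set: measurableTypeR R] (fun a => `|(h a)%:E|%E).
  exact: integrable_abse.
have F0 n : (\int[tor]_a F n a = 0)%E.
  have Fi : tor.-integrable [set: measurableTypeR R] (F n).
    apply: (le_integrable measurableT (mF n) _ hi) => a _.
    have /andP[k0 k1] := kuhn_bound n (bump_bound t a).
    by rewrite /F abse_EFin lee_fin normrM ler_piMr// ger0_norm.
  rewrite -[LHS]fineK; last exact: integrable_fin_num.
  by congr EFin; exact: (hp (kuhn R n)).
have [_ _ Fc] := dominated_convergence measurableT mF mI cF hi' hb.
have I0 : (\int[tor]_a (h a * \1_`]0%R, t[ a)%:E = 0)%E.
  rewrite -(cvg_lim (@ereal_hausdorff R) Fc) (_ : (fun n => _) = (fun=> 0%E)).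
    exact: lim_cst.
  by apply/funext => n; exact: F0.
rewrite /Rintegral (_ : (\int[_]_(_ in _) _)%E = 0%E)//.
rewrite -integral_itv_obnd_cbnd; last exact/measurable_EFinP/measurable_funTS.
rewrite -integral_itv_bndo_bndc; last exact/measurable_EFinP/measurable_funTS.
rewrite -[RHS]I0 torus_integral//.
rewrite (_ : (fun a => (h a * _)%:E) = (EFin \o h) \_ `]0%R, t[).
  rewrite -integral_mkcondr setIidr// => a /=; rewrite !in_itv/= => /andP[a0 at_].
  by rewrite (ltW a0)/= (ltW (lt_le_trans at_ t1)).
apply/funext => a; rewrite patchE indicE; case: ifPn => _ /=.
  by rewrite mulr1.
by rewrite mulr0.
Qed.

End vanishing_coefficients.

(** Lebesgue's differentiation theorem: almost everywhere [h] is the derivative of its primitive,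
    and that primitive is identically zero. *)
Lemma primitive0_ae (h : R -> R) : tor.-integrable [set: R] (EFin \o h) ->
  (forall t : R, 0 < t <= 1 -> \int[@lebesgue_measure R]_(a in `[0, t]) h a = 0) ->
  {ae tor, forall a, h a = 0}.
Proof.
move=> hi h0; have mh : measurable_fun [set: R] h.
  by apply/measurable_EFinP; exact: measurable_int hi.
have hi01 : (@lebesgue_measure R).-integrable `[0, 1] (EFin \o h).
  apply/integrableP; split; first exact/measurable_EFinP/measurable_funTS.
  move/integrableP: hi => [_]; rewrite torus_integral//.
  by apply: measurableT_comp => //; exact/measurable_EFinP.
(* Cutting [h] off outside the unit interval makes the primitive from 0 vanish at every real x, so
   that it is literally a constant function. *)
pose h' := h \_ `[0, 1].
have hi' : (@lebesgue_measure R).-integrable [set: R] (EFin \o h').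
  rewrite (_ : _ \o _ = (EFin \o h) \_ `[0, 1]); last by rewrite restrict_EFin.
  by apply/(integrable_mkcond _ _).1.
have F0 (x : R) : \int[@lebesgue_measure R]_(a in `[0, x]) h' a = 0.
  rewrite -Rintegral_mkcondr.
  have [x0|x0] := ltP 0 x.
    rewrite (_ : _ `&` _ = `[0, Num.min x 1]%classic).
      by apply: h0; rewrite lt_min x0 ltr01 ge_min lexx orbT.
    apply/seteqP; split => a /=; rewrite !in_itv/= le_min.
      by move=> [/andP[-> ->] /andP[_ ->]].
    by move=> /and3P[-> -> ->].
  have [x0'|x0'] := ltP x 0.
    rewrite (_ : _ `&` _ = set0) ?Rintegral_set0//.
    apply/seteqP; split => a //=; rewrite !in_itv/= => -[/andP[a0 ax] _].
    by have := lt_le_trans x0' (le_trans a0 ax); rewrite ltxx.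
  rewrite (_ : _ `&` _ = [set 0]) ?Rintegral_set1//.
  have {x0 x0'} -> : x = 0 by apply/eqP; rewrite eq_le x0 x0'.
  apply/seteqP; split => a /=; rewrite !in_itv/=.
    by move=> [/andP[a0 a1] _]; apply/eqP; rewrite eq_le a0 a1.
  by move=> ->; rewrite lexx ler01.
have hiy (y : R) : (@lebesgue_measure R).-integrable
    [set` Interval (BLeft 0) (BRight y)] (EFin \o h').
  by apply: integrableS hi'.
have := @FTC1 R h' (BLeft 0) hiy (integrable_locally (measurable_itv _) hi01).
rewrite (_ : (fun x => _) = cst 0); last by apply/funext => x; exact: F0.
move=> ae0; apply: torus_ae.
have ne0 : {ae @lebesgue_measure R, forall x : measurableTypeR R, x != 0 :> R}.
  exists [set 0]; split; [by []|exact: lebesgue_measure_set1|].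
  by move=> x /= /negP; rewrite negbK => /eqP.
apply: (@filterS2 _ _ (ae_filter_ringOfSetsType (@lebesgue_measure R)) _ _ _ _ ne0 ae0).
move=> x /= xn0 hx /andP[x0 x1].
have [|_] := hx; first by rewrite lte_fin lt_neqAle eq_sym xn0.
rewrite derive1_cst /h' patchE mem_set//=.
by rewrite in_itv/= x0 x1.
Qed.

Lemma torus_uniq (phi : measurableTypeR R -> R[i]) : cL1 tor phi ->
  (forall n : int, cint tor (fun a => phi a * echar n a) = 0) ->
  {ae tor, forall a, phi a = 0}.
Proof.
move=> p1 p0; have [pr pi_] := p1.
have hr : {ae tor, forall a, complex.Re (phi a) = 0}.
  apply: (primitive0_ae pr) => t t01; apply: (vanishing_integral0 t01 pr) => p.
  have [_ /(congr1 (@complex.Re R)) /= <-] := bump_poly_orth p1 p0 t p.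
  by apply: eq_Rintegral => a _; rewrite cReM /= mulr0 subr0.
have hi : {ae tor, forall a, complex.Im (phi a) = 0}.
  apply: (primitive0_ae pi_) => t t01; apply: (vanishing_integral0 t01 pi_) => p.
  have [_ /(congr1 (@complex.Im R)) /= <-] := bump_poly_orth p1 p0 t p.
  by apply: eq_Rintegral => a _; rewrite cImM /= mulr0 add0r.
apply: (@filterS2 _ _ (ae_filter_ringOfSetsType tor) _ _ _ _ hr hi) => a.
by move=> h1 h2; apply: complex_ext.
Qed.

End torus_uniqueness.

(** * Parseval's identity on the torus *)

Section counting_nat.
Context (R : realType).

(* A synonym of [counting], whose sigma-finiteness canonical inference misses. *)
Definition count_nat : set nat -> \bar R := @counting nat R.
HB.instance Definition _ := Measure.copy count_nat (@counting nat R).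
HB.instance Definition _ := Measure_isSigmaFinite.Build _ _ _ count_nat
  (sigma_finite_counting R).

Lemma ge0_count_nat_integral (f : nat -> \bar R) : (forall k, 0 <= f k)%E ->
  (\int[count_nat]_k f k = \sum_(k <oo) f k)%E.
Proof. exact: ge0_integral_count. Qed.

End counting_nat.

Section torus_parseval.
Context (R : realType).
Local Notation tor := (@torus R).
Local Notation cnt := (@count_nat R).
Implicit Types (phi psi : measurableTypeR R -> R[i]) (c : nat -> R[i]).

Definition torus_char (u : nat * measurableTypeR R) : R[i] := echar (freq u.1) u.2.
Local Notation tc := (fun u : measurableTypeR R * nat => torus_char (u.2, u.1)).

Lemma measurable_nat_fun d (T : measurableType d) (f : nat -> T) :
  measurable_fun [set: nat] f.
Proof. by []. Qed.

Lemma unimodular_torus_char : unimodular torus_char.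
Proof.
split=> [|u]; last exact: nsq_echar.
apply: cmeas_expN2pii; apply: measurable_funM; last exact: measurable_snd.
apply: (measurableT_comp (measurable_nat_fun (fun k => (freq k)%:~R : R))).
exact: measurable_fst.
Qed.

Lemma energy_counting c : energy cnt c = (\sum_(k <oo) (nsq (c k))%:E)%E.
Proof. by rewrite /energy ge0_count_nat_integral// => k; rewrite lee_fin nsq_ge0. Qed.

Definition trig_sum c (N : nat) (a : measurableTypeR R) : R[i] :=
  \sum_(k < N) c k * echar (- freq k) a.

Lemma cL1_const (z : R[i]) : cL1 tor (fun=> z).
Proof. by split; exact: finite_measure_integrable_cst. Qed.

Lemma cL1_echar n : cL1 tor (echar n).
Proof.
rewrite (_ : echar n = (fun a => 1 * echar n a)); last first.
  by apply/funext => a; rewrite mul1r.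
apply: cL1M_unit; [exact: cL1_const|exact: cmeas_echar|exact: nsq_echar].
Qed.

Lemma cL1_trig_sum c N : cL1 tor (trig_sum c N).
Proof. by apply: cL1_sum => k; apply: cL1Z; exact: cL1_echar. Qed.

Lemma FT_echar phi k : FT tor tc phi k = cint tor (fun a => phi a * echar (freq k) a).
Proof. by []. Qed.

Lemma FT_trig_sum c N j :
  FT tor tc (trig_sum c N) j = if (j < N)%N then c j else 0.
Proof.
rewrite FT_echar /trig_sum.
rewrite (@eq_cint _ _ _ _ _
  (fun a => \sum_(k < N) c k * echar (- freq k + freq j) a)); last first.
  by move=> a; rewrite mulr_suml; apply: eq_bigr => k _; rewrite echarD mulrA.
rewrite cint_sum; last by move=> k; apply: cL1Z; exact: cL1_echar.
under eq_bigr => k _.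
  rewrite cintZ; last exact: cL1_echar.
  rewrite cint_echar addrC subr_eq0 (inj_eq freq_inj).
  over.
case: ltnP => [jN|Nj].
  rewrite (bigD1 (Ordinal jN))//= eqxx mulr1 big1 ?addr0// => k kj.
  by rewrite (_ : j == k = false) ?mulr0//; apply: contraNF kj => /eqP jk; exact/eqP/val_inj.
rewrite big1// => k _; rewrite (_ : j == k = false) ?mulr0//.
by apply/negbTE; rewrite gtn_eqF// (leq_trans (ltn_ord k)).
Qed.

Lemma cint_trig_conj phi c N : cL1 tor phi ->
  cL1 tor (fun a => phi a * conjc (trig_sum c N a)) /\
  cint tor (fun a => phi a * conjc (trig_sum c N a)) =
    \sum_(k < N) conjc (c k) * FT tor tc phi k.
Proof.
move=> p1; rewrite (_ : (fun a => _) =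
  (fun a => \sum_(k < N) conjc (c k) * (phi a * echar (freq k) a))); last first.
  apply/funext => a; rewrite rmorph_sum mulr_sumr; apply: eq_bigr => k _.
  by rewrite /= conjcM -echarN opprK mulrCA.
have e1 (k : nat) : cL1 tor (fun a => phi a * echar (freq k) a).
  by apply: cL1M_unit => //; [exact: cmeas_echar|exact: nsq_echar].
split; first by apply: cL1_sum => k; exact: cL1Z.
rewrite cint_sum; last by move=> k; exact: cL1Z.
by apply: eq_bigr => k _; rewrite cintZ.
Qed.

(** The pairing of the sum with itself is integrable, and its real part is the squared modulus. *)
Lemma energy_trig_sum_lty c N : (energy tor (trig_sum c N) < +oo)%E.
Proof.
have [ss1 _] := cint_trig_conj c N (cL1_trig_sum c N).
rewrite /energy (eq_integral (fun a =>
  (complex.Re (trig_sum c N a * conjc (trig_sum c N a)))%:E)).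
  by have := integrable_lty measurableT ss1.1.
by move=> a _; rewrite mulcJ_nsq.
Qed.

(* Pythagoras: the partial Fourier sums are orthogonal projections. *)
Lemma energy_partial_sum phi N : cL1 tor phi -> (energy tor phi < +oo)%E ->
  energy tor phi = (energy tor (fun a => phi a - trig_sum (FT tor tc phi) N a)%R +
    (\sum_(k < N) nsq (FT tor tc phi k))%:E)%E.
Proof.
move=> p1 poo; set c := FT tor tc phi; set s := trig_sum c N.
have s1 : cL1 tor s := cL1_trig_sum c N.
have ms := cL1_cmeas s1; have mp := cL1_cmeas p1.
have g1 : cL1 tor (fun a => phi a - s a) by exact: cL1B.
(* The real part of [w] is what [|phi|^2] exceeds [|phi - s|^2] by. Since [phi - s] has zero
   coefficients below [N], the first factor of [w] still has coefficients [c] there. *)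
pose w a := (2 * (phi a - s a) + s a) * conjc (s a).
have h1 : cL1 tor (fun a => 2 * (phi a - s a) + s a) by apply: cL1D => //; exact: cL1Z.
have [w1 wE] := cint_trig_conj c N h1.
have FTg (k : nat) : (k < N)%N -> FT tor tc (fun a => 2 * (phi a - s a) + s a) k = c k.
  move=> kN; rewrite FT_echar.
  have e1 psi : cL1 tor psi -> cL1 tor (fun a => psi a * echar (freq k) a).
    by move=> q1; apply: cL1M_unit => //; [exact: cmeas_echar|exact: nsq_echar].
  rewrite (@eq_cint _ _ _ _ _ (fun a => 2 * ((phi a * echar (freq k) a) -
    (s a * echar (freq k) a)) + s a * echar (freq k) a)); last by move=> a; ring.
  rewrite cintD; [|by apply: cL1Z; apply: cL1B; exact: e1|exact: e1].
  rewrite cintZ; last by apply: cL1B; exact: e1.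
  rewrite cintB; [|exact: e1|exact: e1].
  by rewrite -!FT_echar FT_trig_sum kN subrr mulr0 add0r.
have {}wE : cint tor w = (\sum_(k < N) nsq (c k))%:C.
  rewrite wE rmorph_sum; apply: eq_bigr => k _.
  by rewrite FTg// mulrC mulcJ_nsq.
have Ew : (\int[tor]_a (complex.Re (w a))%:E = (\sum_(k < N) nsq (c k))%:E)%E.
  rewrite -[LHS]fineK; last exact: (integrable_fin_num measurableT w1.1).
  by congr EFin; exact: (congr1 (@complex.Re R) wE).
rewrite -Ew /energy -integralD//; last 2 first.
- have soo := energy_trig_sum_lty c N.
  apply/integrableP; split.
    by apply/measurable_EFinP; apply: measurable_nsq; exact: cmeasB.
  under eq_integral do rewrite gee0_abs ?lee_fin ?nsq_ge0//.
  apply: le_lt_trans (energyB_le tor mp ms) _.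
  by rewrite lte_add_pinfty// lte_mul_pinfty.
- exact: w1.1.
apply: eq_integral => a _; rewrite -EFinD; congr EFin.
by rewrite /w /nsq !cReImE/=; ring.
Qed.

(** Pythagoras applied to the longer sum, truncated once at [M], where the remainder is zero, and
    once at [N]. *)
Lemma energy_trig_diff c M N : (N <= M)%N ->
  energy tor (fun a => trig_sum c M a - trig_sum c N a)%R =
  (\sum_(k < M) nsq (c k) - \sum_(k < N) nsq (c k))%:E.
Proof.
move=> NM; have soo := energy_trig_sum_lty c M.
have trigE K : (K <= M)%N ->
    trig_sum (FT tor tc (trig_sum c M)) K = trig_sum c K.
  move=> KM; apply/funext => a; apply: eq_bigr => k _.
  by rewrite FT_trig_sum (leq_trans (ltn_ord k) KM).
have nsqE K : (K <= M)%N -> \sum_(k < K) nsq (FT tor tc (trig_sum c M) k) =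
    \sum_(k < K) nsq (c k).
  by move=> KM; apply: eq_bigr => k _; rewrite FT_trig_sum (leq_trans (ltn_ord k) KM).
have := energy_partial_sum M (cL1_trig_sum c M) soo.
have E0 : energy tor (fun a => trig_sum c M a - trig_sum c M a)%R = 0%E.
  rewrite (@eq_energy _ _ _ _ _ (fun=> 0)); last by move=> a; rewrite subrr.
  by apply: energy_ae0; [exact: cmeas_cst|exact: nearW].
rewrite trigE// nsqE// E0 add0e.
have -> := energy_partial_sum N (cL1_trig_sum c M) soo.
rewrite trigE// nsqE// EFinB => <-.
by rewrite addeK.
Qed.

Lemma cL1_energy phi : cmeas phi -> (energy tor phi < +oo)%E -> cL1 tor phi.
Proof.
move=> mp poo; apply: (@cL1_le _ _ _ _ _ (fun a => 1 + nsq (phi a))) => //.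
- rewrite (_ : _ \o _ = (fun a => 1%:E + (nsq (phi a))%:E)%E)//.
  apply: integrableD => //; first exact: finite_measure_integrable_cst.
  apply/integrableP; split; first exact/measurable_EFinP/measurable_nsq.
  by under eq_integral do rewrite gee0_abs ?lee_fin ?nsq_ge0//.
- by move=> a; exact: norm1_le_nsq.
Qed.

Lemma bessel phi N : cL1 tor phi ->
  ((\sum_(k < N) nsq (FT tor tc phi k))%:E <= energy tor phi)%E.
Proof.
move=> p1; have [->|poo] := eqVneq (energy tor phi) +oo%E; first exact: leey.
rewrite (energy_partial_sum N p1); first by rewrite leeDr// energy_ge0.
by rewrite ltey.
Qed.

Lemma bessel_term phi k : cL1 tor phi ->
  ((nsq (FT tor tc phi k))%:E <= energy tor phi)%E.
Proof.
move=> p1; apply: le_trans (bessel k.+1 p1); rewrite lee_fin.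
by rewrite big_ord_recr/= lerDr sumr_ge0// => i _; rewrite nsq_ge0.
Qed.

(** The partial sums are Cauchy and converge by completeness. Bessel's inequality for the
    differences identifies the coefficients of the limit, then its energy follows from Pythagoras
    and Bessel. *)
Lemma square_summable_limit c : (\sum_(k <oo) (nsq (c k))%:E < +oo)%E ->
  exists2 psi, cL1 tor psi /\ (forall k, FT tor tc psi k = c k) &
    energy tor psi = (\sum_(k <oo) (nsq (c k))%:E)%E.
Proof.
move=> coo; have c0 k : (0 <= (nsq (c k))%:E)%E by rewrite lee_fin nsq_ge0.
pose S N := \sum_(k < N) nsq (c k).
set L := (\sum_(k <oo) _)%E in coo *.
have L0 : (0 <= L)%E by exact: nneseries_ge0.
have Lfin : L \is a fin_num by rewrite ge0_fin_numE.
have SE N : (S N)%:E = (\sum_(0 <= k < N) (nsq (c k))%:E)%E.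
  by rewrite /S sumEFin big_mkord.
have SL N : S N <= fine L.
  by rewrite -lee_fin fineK// SE; exact: nneseries_lim_ge.
have cS e : 0 < e -> exists N, forall k, (N <= k)%N -> fine L - e <= S k.
  move=> e0; have cSE : (S N)%:E @[N --> \oo] --> (fine L)%:E.
    rewrite fineK// (_ : (fun N => (S N)%:E) = (fun N => \sum_(0 <= k < N) (nsq (c k))%:E)%E).
      exact: is_cvg_nneseries.
    by apply/funext => N; exact: SE.
  have /fine_cvgP[_ /cvgrPdist_le /(_ e e0) [N _ NP]] := cSE.
  exists N => k Nk; have := NP k Nk => /=; rewrite ler_norml => /andP[_].
  by rewrite lerBlDr -lerBlDl.
have ms k : cmeas (trig_sum c k) by exact: cL1_cmeas (cL1_trig_sum c k).
have cau e : 0 < e -> exists N, forall k l, (N <= k)%N -> (N <= l)%N ->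
    (energy tor (fun x => trig_sum c k x - trig_sum c l x)%R <= e%:E)%E.
  move=> e0; have [N NP] := cS e e0; exists N => k l Nk Nl.
  wlog lk : k l Nk Nl / (l <= k)%N => [H|].
    by have [/H->//|/ltnW/H kl] := leqP l k; rewrite energyB_sym kl.
  rewrite energy_trig_diff// lee_fin lerBlDl -lerBlDr.
  by apply: le_trans (NP l Nl); rewrite lerD2r; exact: SL.
have [psi mpsi psiP] := riesz_fischer ms cau.
have psioo : (energy tor psi < +oo)%E.
  have [N /(_ N (leqnn N)) NP] := psiP 1 ltr01.
  rewrite (@eq_energy _ _ _ _ _ (fun a => trig_sum c N a - (trig_sum c N a - psi a))).
    apply: le_lt_trans (energyB_le tor (ms N) (cmeasB (ms N) mpsi)) _.
    rewrite lte_add_pinfty// lte_mul_pinfty//; first exact: energy_trig_sum_lty.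
    by apply: le_lt_trans NP _; rewrite ltry.
  by move=> a; rewrite subKr.
have psi1 := cL1_energy mpsi psioo.
have ut := unimodular_swap unimodular_torus_char.
have FTpsi k : FT tor tc psi k = c k.
  apply/eqP; rewrite eq_sym -subr_eq0 -nsq_eq0 eq_le nsq_ge0 andbT.
  apply/ler_addgt0Pr => e e0; rewrite add0r -lee_fin.
  (* An index beyond [k] ensures that the partial sum already has [c k] as its k-th coefficient. *)
  have [N NP] := psiP e e0; apply: le_trans (NP (maxn N k.+1) (leq_maxl _ _)).
  have s1 := cL1_trig_sum c (maxn N k.+1).
  apply: le_trans (bessel_term k (cL1B s1 psi1)).
  by rewrite FTB// FT_trig_sum leq_maxr.
exists psi => //; apply/eqP; rewrite eq_le; apply/andP; split.
- apply/lee_addgt0Pr => e e0; have [N NP] := psiP e e0.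
  rewrite (energy_partial_sum N psi1 psioo) addeC; apply: leeD.
    rewrite -(fineK Lfin) lee_fin; apply: le_trans (SL N).
    by apply: ler_sum => k _; rewrite FTpsi.
  rewrite (_ : trig_sum _ N = trig_sum c N); first by rewrite energyB_sym; exact: NP.
  by apply/funext => a; apply: eq_bigr => k _; rewrite FTpsi.
- apply/lee_addgt0Pr => e e0; have [N /(_ N (leqnn N)) NP] := cS e e0.
  rewrite -(fineK Lfin) -leeBlDr// -EFinB.
  apply: le_trans (bessel N psi1); rewrite lee_fin; apply: le_trans NP _.
  by apply: ler_sum => k _; rewrite FTpsi.
Qed.

Lemma torus_FT_inj phi psi : cL1 tor phi -> cL1 tor psi ->
  (forall k, FT tor tc phi k = FT tor tc psi k) -> {ae tor, forall a, phi a = psi a}.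
Proof.
move=> p1 q1 pq; have : {ae tor, forall a, phi a - psi a = 0}.
  apply: torus_uniq; first exact: cL1B.
  move=> n; rewrite -(freq_invK n).
  have := FTB (freq_inv n) (unimodular_swap unimodular_torus_char) p1 q1.
  by rewrite pq subrr.
apply: (@filterS _ _ (ae_filter_ringOfSetsType tor)) => a /eqP.
by rewrite subr_eq0 => /eqP.
Qed.

(** If the coefficients are square-summable, they are those of some function of the right energy,
    which equals [phi] by uniqueness for integrable functions. If not, Bessel forces infinite
    energy. *)
Lemma plancherel_torus : plancherel tor cnt tc.
Proof.
move=> phi p1; rewrite energy_counting.
have [coo|] := ltP (\sum_(k <oo) (nsq (FT tor tc phi k))%:E)%E +oo%E.
  have [psi [q1 qE] <-] := square_summable_limit coo.
  apply: ae_eq_energy; [exact: (cL1_cmeas q1)|exact: (cL1_cmeas p1)|].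
  exact: torus_FT_inj.
rewrite leye_eq => /eqP Loo; rewrite Loo; apply/esym/eqP; rewrite -leye_eq -Loo.
apply: lime_le; first by apply: is_cvg_nneseries => k _ _; rewrite lee_fin nsq_ge0.
by apply: nearW => N; rewrite sumEFin big_mkord; exact: bessel.
Qed.

End torus_parseval.

(** * Zeros of trigonometric polynomials *)

Section torus_rigidity.
Context (R : realType).
Local Notation tor := (@torus R).
Local Notation cnt := (@count_nat R).
Local Notation tc := (fun u : measurableTypeR R * nat => torus_char (u.2, u.1)).
Implicit Types (phi : measurableTypeR R -> R[i]) (c : nat -> R[i]).

Lemma echar_exp (n : int) m (a : measurableTypeR R) :
  echar (n * m%:Z) a = echar n a ^+ m.
Proof.
elim: m => [|m IH]; first by rewrite mulr0 echar0 expr0.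
by rewrite intS mulrDr mulr1 echarD IH exprS.
Qed.

(** Equal values at a < b would give [cos (2 * pi * (b - a)) = 1], that is [sin (pi * (b - a)) = 0],
    but this sine is positive. *)
Lemma echarN1_inj : {in [pred a : R | 0 <= a < 1] &, injective (echar (-1) : R -> R[i])}.
Proof.
have H (a b : R) : 0 <= a < 1 -> 0 <= b < 1 -> a < b ->
    echar (-1) a <> echar (-1) b; last first.
  move=> a b; rewrite !inE => ha hb ab; have [h|h|//] := ltgtP a b.
    by case: (H _ _ ha hb h).
  by case: (H _ _ hb ha h).
move=> /andP[a0 a1] /andP[b0 b1] ab; rewrite /echar !mulN1r !expN2piiN.
  move=> /(can_inj (@conjcK R)) E; have : expN2pii (b - a) = 1.
  by rewrite expN2piiD expN2piiN E mulcJ_nsq nsq_expN2pii.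
move=> /(congr1 (@complex.Re R)) /= c1.
have e : 2 * pi * (b - a) = pi * (b - a) + pi * (b - a) by ring.
have s0 : 0 < sin (pi * (b - a)).
  by apply: sin_gt0_pi; rewrite mulr_gt0 ?pi_gt0 ?subr_gt0//= gtr_pMr ?pi_gt0//; lra.
move: c1; rewrite e cosD; have := cos2Dsin2 (pi * (b - a)); nra.
Qed.

Lemma freq_bound k : (0 : int) <= k.+1%:Z + freq k.
Proof.
rewrite /freq; case: (odd k); last by [].
rewrite NegzE subr_ge0 lez_nat ltnS.
by rewrite -divn2 leq_div.
Qed.

(** For k < N the enumeration gives [N + freq k >= 0], so after extracting [echar N] only
    nonnegative powers of [echar (-1)] remain. *)
Lemma trig_sum_poly c N : exists p : {poly R[i]}, forall a : measurableTypeR R,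
  trig_sum c N a = echar N%:Z a * p.[echar (-1) a].
Proof.
exists (\sum_(k < N) c k *: 'X^(`|N%:Z + freq k|)) => a.
rewrite horner_sum mulr_sumr; apply: eq_bigr => k _.
rewrite hornerZ hornerXn -echar_exp mulrCA -echarD; congr (_ * echar _ a).
rewrite gez0_abs; first by ring.
apply: le_trans (freq_bound k) _; rewrite lerD2r lez_nat; exact: ltn_ord.
Qed.

Lemma torus_ae_itv : {ae tor, forall a : measurableTypeR R, (0 : R) <= a < 1}.
Proof.
have n1 : {ae tor, forall a : measurableTypeR R, a != 1 :> R}.
  have /torus_countable[mD D0] : countable [set (1 : R)] by exact: countable1.
  by exists [set 1]; split => // a /= /negP; rewrite negbK => /eqP.
have a01 : {ae tor, forall a : measurableTypeR R, (0 : R) <= a <= 1}.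
  by apply: torus_ae; exact: nearW.
apply: (@filterS2 _ _ (ae_filter_ringOfSetsType tor) _ _ _ _ n1 a01).
by move=> a an1 /andP[-> a1]; rewrite lt_neqAle an1.
Qed.

(** More zeros in the half-open interval than the size of [p] would give too many distinct roots. *)
Lemma poly_echar_ae (p : {poly R[i]}) : p != 0 ->
  {ae tor, forall a : measurableTypeR R, p.[echar (-1) a] != 0}.
Proof.
move=> p0; pose Z := [set a : R | (0 <= a < 1) && (p.[echar (-1) a] == 0)].
have fZ : finite_set Z.
  apply: contrapT => /(@infinite_set_fset _ _ (size p))[B BZ Bs].
  pose rs : seq R[i] := [seq echar (-1) a | a <- finmap.enum_fset B].
  have urs : uniq rs.
    rewrite map_inj_in_uniq ?finmap.fset_uniq// => a b aB bB; apply: echarN1_inj.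
      by have /andP[] := BZ _ aB.
    by have /andP[] := BZ _ bB.
  have : (size rs < size p)%N.
    apply: max_poly_roots => //; apply/allP => z /mapP[a aB ->].
    by have /andP[_] := BZ _ aB.
  by rewrite size_map ltnNge Bs.
have /torus_countable[mZ Z0] := finite_set_countable fZ.
have nZ : {ae tor, forall a : measurableTypeR R, ~ Z a}.
  by exists Z; split => // a /= /contrapT.
apply: (@filterS2 _ _ (ae_filter_ringOfSetsType tor) _ _ _ _ nZ torus_ae_itv).
by move=> a Za a01; apply/negP => pa; apply: Za; rewrite /Z /= a01.
Qed.

Lemma finite_counting (S : set nat) : (cnt S < +oo)%E -> exists N, forall k, S k -> (k < N)%N.
Proof.
rewrite /count_nat /counting; case: ifPn => [/asboolP fS _|//].
exists (\max_(k <- finmap.enum_fset (fset_set S)) k).+1 => k Sk; rewrite ltnS.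
by apply: (@leq_bigmax_seq _ _ xpredT id) => //; rewrite in_fset_set ?inE.
Qed.

(** A set of finite counting measure is bounded, so by uniqueness [phi] is almost everywhere a
    trigonometric polynomial, which either is zero or vanishes on a null set only. *)
Lemma rigid_torus : rigid tor cnt tc.
Proof.
move=> phi E p1 /finite_counting[N SN] mE E0 phiE.
set c := FT tor tc phi in SN.
have cN k : (N <= k)%N -> c k = 0.
  by move=> Nk; apply/eqP; apply: contraLR Nk => ck; rewrite -ltnNge; exact: SN.
have phis : {ae tor, forall a, phi a = trig_sum c N a}.
  apply: torus_FT_inj => //; first exact: cL1_trig_sum.
  by move=> k; rewrite FT_trig_sum; case: ltnP => // /cN.
have [p pE] := trig_sum_poly c N.
have [p0|p0] := eqVneq p 0.
  apply: (@filterS _ _ (ae_filter_ringOfSetsType tor) _ _ _ phis) => a ->.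
  by rewrite pE p0 horner0 mulr0.
have [Nul [mNul Nul0 sNul]] : {ae tor, forall a, ~ E a}.
  apply: (@filterS2 _ _ (ae_filter_ringOfSetsType tor) _ _ _ _ phis (poly_echar_ae p0)).
  move=> a phia pa /phiE; rewrite phia pE => /eqP; rewrite mulf_eq0 (negbTE pa) orbF.
  by rewrite -nsq_eq0 nsq_echar oner_eq0.
suff h : (tor E <= 0)%E by have := lt_le_trans E0 h; rewrite ltxx.
rewrite -Nul0 le_measure// ?inE//.
by move=> a Ea; apply: sNul => /=.
Qed.

End torus_rigidity.

(** * The dual group: Plancherel for summable sequences *)

Section dual_of_torus.
Context (R : realType).
Local Notation tor := (@torus R).
Local Notation cnt := (@count_nat R).
Local Notation zc := (@torus_char R).
Local Notation tc := (fun u : measurableTypeR R * nat => zc (u.2, u.1)).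
Implicit Types (c : nat -> R[i]).

Lemma count_nat1 l : cnt [set l] = 1%E.
Proof.
by rewrite /count_nat /counting asboolT// fset_set1 finmap.cardfs1.
Qed.

Lemma count_nat_discrete (S : set nat) : measurable S -> (cnt S < 1 -> cnt S = 0)%E.
Proof.
move=> _; have [->|/set0P[k Sk]] := eqVneq S set0; first by rewrite measure0.
rewrite ltNge => /negP; case; rewrite -(count_nat1 k) le_measure// ?inE//.
by move=> _ ->.
Qed.

Lemma cint_count_single c l :
  cint cnt (fun k => c k * (k == l)%:R) = c l.
Proof.
have H (h : nat -> R) : \int[cnt]_k (h k * (k == l)%:R) = h l.
  rewrite (@eq_Rintegral _ _ _ _ _ ((fun=> h l) \_ [set l])).
    rewrite -Rintegral_mkcond; transitivity (h l * fine (cnt [set l])).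
      exact: Rintegral_cst.
    by rewrite count_nat1 mulr1.
  move=> k _; rewrite patchE; case: eqVneq => [->|kl].
    by rewrite mem_set ?mulr1.
  by rewrite memNset ?mulr0// => /eqP; rewrite (negbTE kl).
apply: complex_ext => /=.
- under eq_Rintegral => k _.
    rewrite cReM (_ : complex.Re (k == l)%:R = (k == l)%:R); last by case: eqP.
    rewrite (_ : complex.Im (k == l)%:R = 0) ?mulr0 ?subr0; last by case: eqP.
    over.
  exact: (H (fun k => complex.Re (c k))).
- under eq_Rintegral => k _.
    rewrite cImM (_ : complex.Re (k == l)%:R = (k == l)%:R); last by case: eqP.
    rewrite (_ : complex.Im (k == l)%:R = 0) ?mulr0 ?add0r; last by case: eqP.
    over.
  exact: (H (fun k => complex.Im (c k))).
Qed.

(** Summability of [c] allows the sum and the integral to be exchanged by Fubini; orthogonality then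
    leaves one term. *)
Lemma FT_count_coef c l : cL1 cnt c ->
  cL1 tor (FT cnt zc c) /\
  cint tor (fun a => FT cnt zc c a * conjc (echar (freq l) a)) = c l.
Proof.
move=> c1; have [mzc zc1] := unimodular_torus_char R.
have mc := cL1_cmeas c1.
have cc1 : cL1 (sigma_finite_prod cnt tor) (fun u => c u.1).
  have mcc : cmeas (fun u : nat * measurableTypeR R => c u.1).
    exact: (cmeas_comp mc measurable_fst).
  apply: cL1P => //; rewrite tonelli1; last 2 first.
  - exact/measurable_EFinP/measurable_norm1.
  - by move=> u; rewrite lee_fin norm1_ge0.
  under eq_integral => k _.
    rewrite /= integral_cst//= probability_setT mule1.
    over.
  exact: cL1_lty.
have cz1 := cL1M_unit cc1 mzc zc1.
have [F1 _] := cint_fubini2 cz1.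
have mel : cmeas (fun u : nat * measurableTypeR R => conjc (echar (freq l) u.2)).
  by apply: cmeasJ; exact: (cmeas_comp (cmeas_echar R (freq l)) measurable_snd).
have el1 (u : nat * measurableTypeR R) : nsq (conjc (echar (freq l) u.2)) = 1.
  by rewrite nsqJ nsq_echar.
have czl1 := cL1M_unit cz1 mel el1.
split; first exact: F1.
have [_ E2] := cint_fubini2 czl1; have [_ E1] := cint_fubini1 czl1.
transitivity (cint tor (fun a => cint cnt (fun k => c k * zc (k, a) * conjc (echar (freq l) a)))).
  apply: eq_cint => a; rewrite cintZr//.
  by apply: cL1M_unit => //; exact: (cmeas_pair1 a mzc).
rewrite -E2 E1 -[RHS](cint_count_single c); apply: eq_cint => k /=.
rewrite (@eq_cint _ _ _ _ _ (fun a => c k * echar (freq k - freq l) a)).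
  rewrite cintZ; last exact: cL1_echar.
  by rewrite cint_echar subr_eq0 (inj_eq freq_inj).
by move=> a; rewrite /torus_char /= echarD echarN mulrA.
Qed.

(** Deduced from the torus. Conjugating the Fourier series turns its coefficients into [conjc (c l)]
    for the kernel of the same sign, and squared moduli are unaffected. *)
Lemma plancherel_count : plancherel cnt tor zc.
Proof.
move=> c c1; have [F1 _] := FT_count_coef 0 c1.
rewrite -(@eq_energy _ _ _ _ (fun a => conjc (FT cnt zc c a))); last first.
  by move=> a; rewrite nsqJ.
rewrite -(plancherel_torus (cL1J F1)); apply: eq_energy => l.
rewrite FT_echar -(nsqJ (c l)) -(FT_count_coef l c1).2 -cintJ.
  by congr nsq; apply: eq_cint => a; rewrite conjcM conjcK.
apply: cL1M_unit => //; first by apply: cmeasJ; exact: cmeas_echar.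
by move=> a; rewrite nsqJ nsq_echar.
Qed.

End dual_of_torus.

(** * The line *)

Section line.
Context (R : realType).
Local Notation tor := (@torus R).
Local Notation cnt := (@count_nat R).
Local Notation leb := (@lebesgue_measure R).
Local Notation L := (measurableTypeR R).

Lemma measurable_affine (l b : R) : measurable_fun [set: L] (fun x : L => l * (x : R) + b : L).
Proof. by apply: measurable_funD => //; exact: measurable_funM. Qed.

Lemma lebesgue_affine (l b : R) : 0 < l ->
  unfolds leb leb l (fun x : L => l * (x : R) + b : L).
Proof.
move=> l0; have ma := measurable_affine l b; split => // f mf f0.
pose P := measure_function_pushforward__canonical__measure_function_Measure leb ma.
pose m : {measure set L -> \bar R} := mscale (NngNum (ltW l0)) P.
transitivity (\int[m]_x f x)%E.
  (* Lebesgue measure is characterized by its values on half-open intervals, where the scaled image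
     is computed directly. *)
  apply: eq_measure_integral => A mA _; apply: lebesgue_measure_unique => //.
  move=> _ [[s t] _ <-] /=; rewrite /m /mscale /= /pushforward.
  rewrite (_ : _ @^-1` _ = `](s - b) / l, (t - b) / l]%classic).
    rewrite !lebesgue_measure_itv /= !lte_fin ltr_pM2r ?invr_gt0// ltrD2r.
    case: ifPn => _; last by rewrite mule0.
    by rewrite -!EFinB -EFinM; congr EFin; field; rewrite gt_eqF.
  apply/seteqP; split => x /=; rewrite !in_itv/= ltr_pdivrMr// ler_pdivlMr//.
    by rewrite ltrBlDr lerBrDr mulrC.
  by rewrite ltrBlDr lerBrDr mulrC.
rewrite ge0_integral_mscale//; congr (_ * _)%E.
by rewrite ge0_integral_pushforward//.
Qed.

(** The line is the disjoint union of the unit intervals starting at the integers, enumerated by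
    [freq]; the integer part finds the interval of a point. *)
Lemma line_unfolds_int :
  unfolds (sigma_finite_prod cnt tor) leb 1
    (fun u : nat * L => (u.2 : R) + (freq u.1)%:~R : L).
Proof.
have mj : measurable_fun [set: nat * L] (fun u : nat * L => (u.2 : R) + (freq u.1)%:~R : L).
  apply: measurable_funD; first exact: measurable_snd.
  apply: (measurableT_comp (measurable_nat_fun (fun k => (freq k)%:~R : R))).
  exact: measurable_fst.
split => // f mf f0; rewrite mul1e.
rewrite (@tonelli1 _ _ _ _ _ cnt tor (fun u => f ((u.2 : R) + (freq u.1)%:~R)))//; last first.
  exact: (measurableT_comp mf mj).
rewrite ge0_count_nat_integral; last by move=> k; exact: integral_ge0.
pose F k := [set` `[(freq k)%:~R : R, (freq k)%:~R + 1[].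
have FT : \bigcup_k F k = [set: R].
  apply/seteqP; split => // x _; exists (freq_inv (Num.floor x)) => //=.
  by rewrite /F /= freq_invK in_itv/= -intrD1 floor_itv.
rewrite -[X in (\int[leb]_(_ in X) _)%E]FT ge0_integral_bigcup//; last 3 first.
- by move=> k; exact: measurable_itv.
- by rewrite FT.
- apply/trivIsetP => i k _ _ ik; apply/seteqP; split => // x [].
  rewrite /F /= !in_itv/= => /andP[i1 i2] /andP[k1 k2].
  have : Num.floor x = freq i by apply: floor_def; rewrite i1 intrD.
  rewrite (_ : Num.floor x = freq k); last by apply: floor_def; rewrite k1 intrD.
  by move=> /freq_inj ki; rewrite ki eqxx in ik.
apply: eq_eseriesr => k _.
have mfk : measurable_fun [set: L] (fun x : L => f ((x : R) + (freq k)%:~R)).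
  by apply: (measurableT_comp mf); exact: measurable_funD.
rewrite ge0_torus_integral// -integral_itv_bndo_bndc; last exact: measurable_funTS.
have [mS uS] := lebesgue_affine (freq k)%:~R ltr01.
rewrite integral_mkcond (uS (f \_ (F k))) ?mul1e; last 2 first.
- by apply/(measurable_restrictT _ (measurable_itv _)); exact: (measurable_funTS mf).
- by move=> x; rewrite patchE; case: ifP.
rewrite [RHS]integral_mkcond; apply: eq_integral => x _; rewrite !patchE mul1r.
have E : (((freq k)%:~R : R) <= x + (freq k)%:~R < (freq k)%:~R + 1) = (0 <= (x : R) < 1).
  by rewrite lerDr (addrC (freq k)%:~R 1) ltrD2r.
by congr (if _ then _ else _); apply/idP/idP; rewrite !inE /F /= !in_itv/= E.
Qed.

Lemma unfolds_swap d1 d2 (X : measurableType d1) (Y : measurableType d2)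
    (m1 : {sigma_finite_measure set X -> \bar R})
    (m2 : {sigma_finite_measure set Y -> \bar R}) :
  unfolds (sigma_finite_prod m1 m2) (sigma_finite_prod m2 m1) 1
    (fun u => (u.2, u.1)).
Proof.
have ms : measurable_fun [set: X * Y] (fun u => (u.2, u.1)).
  exact: (measurable_fun_pair measurable_snd measurable_fst).
split => // f mf f0; rewrite mul1e tonelli1// tonelli2//.
exact: (measurableT_comp mf ms).
Qed.

Lemma line_unfolds (l : R) : 0 < l ->
  unfolds (sigma_finite_prod cnt tor) leb l
    (fun u : nat * L => l * ((u.2 : R) + (freq u.1)%:~R) + 0 : L).
Proof.
move=> l0; rewrite -[X in unfolds _ _ X]mulr1.
exact: (unfolds_comp line_unfolds_int (lebesgue_affine 0 l0)).
Qed.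

Definition line_dot (x y : L) : R := (x : R) * (y : R).

(** The lattice is [l] times the integers, its dual [l^-1] times the integers; the cells are
    rescaled unit intervals, so the torus with its kernel is the same for all [l]. *)
Definition zak_line (l : R) : 0 < l -> zak leb line_dot l.
Proof.
move=> l0; have li0 : 0 < l^-1 by rewrite invr_gt0.
apply: (@Zak R _ _ leb line_dot l _ _ nat L cnt tor (@torus_char R)
  (fun u => expN2pii ((u.1 : R) * (u.2 : R)))
  (fun u => l * ((u.2 : R) + (freq u.1)%:~R) + 0)
  (fun u => l^-1 * ((u.1 : R) + (freq u.2)%:~R) + 0) l^-1) => //.
- exact: measurable_funM.
- exact: unimodular_torus_char.
- split=> [|u]; last exact: nsq_expN2pii.
  by apply: cmeas_expN2pii; exact: measurable_funM.
- exact: count_nat_discrete.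
- exact: probability_setT.
- exact: line_unfolds.
- have := unfolds_comp (unfolds_swap tor cnt) (line_unfolds li0).
  by rewrite mulr1.
- move=> k a b m; rewrite /torus_char /echar /= -!expN2piiD /line_dot !addr0.
  (* The product of the two lattice indices is an integer and disappears from the character; [a * b]
     is the twist. *)
  have -> : l^-1 * (b + (freq m)%:~R) * (l * (a + (freq k)%:~R)) =
      (freq k * freq m)%:~R + ((freq k)%:~R * b + (freq m)%:~R * a + a * b) :> R.
    by rewrite intrM; field; rewrite gt_eqF.
  by rewrite [LHS]expN2piiD expN2pii_int mul1r.
- exact: plancherel_count.
- exact: plancherel_torus.
- exact: rigid_torus.
Defined.

End line.

(** * Euclidean and Heisenberg coordinates *)

Section euclid_zak.
Context (R : realType).
Local Notation leb := (@lebesgue_measure R).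

Lemma unfolds_tuple_cons n :
  unfolds (sigma_finite_prod leb (lebesgue_euclid R n)) (lebesgue_euclid R n.+1) 1
    (@tuple_cons R n).
Proof.
have mc : measurable_fun [set: measurableTypeR R * euclid R n] (@tuple_cons R n).
  exact: measurable_cons.
split => // f mf f0; rewrite mul1e.
by rewrite /= ge0_integral_pushforward.
Qed.

Lemma euclid_dot_cons n (u v : measurableTypeR R * euclid R n) :
  euclid_dot (tuple_cons u) (tuple_cons v) = line_dot u.1 v.1 + euclid_dot u.2 v.2.
Proof.
rewrite /euclid_dot big_ord_recl /line_dot; congr (_ + _).
by apply: eq_bigr => i _; rewrite !(tnth_nth 0).
Qed.

Lemma measurable_euclid_dot n :
  measurable_fun [set: euclid R n * euclid R n] (fun u => euclid_dot u.1 u.2).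
Proof.
rewrite /euclid_dot; apply: measurable_sum => i; apply: measurable_funM.
- exact: (measurableT_comp (measurable_tnth i) measurable_fst).
- exact: (measurableT_comp (measurable_tnth i) measurable_snd).
Qed.

Lemma unfolds_tuple1 :
  unfolds leb (lebesgue_euclid R 1) 1 (fun x : measurableTypeR R => tuple_cons (x, [tuple])).
Proof.
have [mc uc] := unfolds_tuple_cons 0.
have mx : measurable_fun [set: measurableTypeR R] (fun x : measurableTypeR R => tuple_cons (x, [tuple])).
  apply: (measurableT_comp mc); exact: measurable_fun_pair.
split => // f mf f0; rewrite uc// !mul1e tonelli1//; last exact: (measurableT_comp mf mc).
apply: eq_integral => x _; rewrite integral_dirac//= ?diracT ?mul1e//.
exact: (measurable_slice2 x (measurableT_comp mf mc)).
Qed.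

(** The lattice of integer points, built coordinate by coordinate from the line as base case. *)
Definition zak_euclid n : zak (lebesgue_euclid R n.+1) (@euclid_dot R n.+1) 1.
Proof.
elim: n => [|n IH].
  apply: (zak_transport (@measurable_euclid_dot 1) unfolds_tuple1 _ (zak_line ltr01)).
  by move=> x y; rewrite euclid_dot_cons /= [X in _ + X]big_ord0 addr0.
rewrite -[1](mulr1 (1 : R)).
apply: (zak_transport (@measurable_euclid_dot n.+2) (unfolds_tuple_cons n.+1) _
  (zak_prod (zak_line ltr01) IH)).
exact: euclid_dot_cons.
Defined.

Lemma unfolds_id d (T : measurableType d) (mu : {measure set T -> \bar R}) :
  unfolds mu mu 1 id.
Proof. by split => // f mf f0; rewrite mul1e. Qed.

Lemma measurable_heis_dot n :
  measurable_fun [set: heis R n * heis R n] (fun u => heis_dot u.1 u.2).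
Proof.
rewrite (_ : (fun u => _) = (fun u : heis R n * heis R n =>
    euclid_dot u.1.1.1 u.2.1.1 + euclid_dot u.1.1.2 u.2.1.2 + (u.1.2 : R) * (u.2.2 : R))).
  have m1 := @measurable_fst _ _ (heis R n) (heis R n).
  have m2 := @measurable_snd _ _ (heis R n) (heis R n).
  have m11 := measurableT_comp measurable_fst m1.
  have m12 := measurableT_comp measurable_snd m1.
  have m21 := measurableT_comp measurable_fst m2.
  have m22 := measurableT_comp measurable_snd m2.
  have p1 := measurable_fun_pair (measurableT_comp measurable_fst m11)
    (measurableT_comp measurable_fst m21).
  have p2 := measurable_fun_pair (measurableT_comp measurable_snd m11)
    (measurableT_comp measurable_snd m21).
  apply: measurable_funD; last exact: measurable_funM.
  exact: (measurable_funD (measurableT_comp (@measurable_euclid_dot n) p1)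
    (measurableT_comp (@measurable_euclid_dot n) p2)).
by apply/funext => -[[[p q] t] [[p' q'] t']].
Qed.

(** Only the central coordinate is stretched, which already gives every positive covolume. *)
Definition zak_heis n (l : R) (l0 : 0 < l) :
  zak (heis_measure R n.+1) (@heis_dot R n.+1) (1 * 1 * l).
Proof.
apply: (zak_transport (@measurable_heis_dot n.+1) (unfolds_id _) _
  (zak_prod (zak_prod (zak_euclid n) (zak_euclid n)) (zak_line l0))).
by move=> [[p q] t] [[p' q'] t'].
Defined.

End euclid_zak.

(** * The Fourier transform on square-integrable functions *)

Section energy_limits.
Context (R : realType) d (T : measurableType d).
Variable mu : {sigma_finite_measure set T -> \bar R}.
Implicit Types (f g h : T -> R[i]) (u v : nat -> T -> R[i]).

(** L^2 convergence written with squared norms; [L2norm_cvg0] identifies it with convergence of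
    [L2norm] to 0. *)
Definition energy_cvg u h : Prop := forall e : R, 0 < e ->
  exists N, forall k, (N <= k)%N -> (energy mu (fun x => u k x - h x)%R <= e%:E)%E.

Lemma integrable_nsq f : cmeas f -> (energy mu f < +oo)%E ->
  mu.-integrable [set: T] (fun x => (nsq (f x))%:E).
Proof.
move=> mf foo; apply/integrableP; split; first exact/measurable_EFinP/measurable_nsq.
by under eq_integral do rewrite gee0_abs ?lee_fin ?nsq_ge0//.
Qed.

Lemma energy_le_dist f g : cmeas f -> cmeas g ->
  (energy mu f <= 2%:E * energy mu (fun x => g x - f x)%R + 2%:E * energy mu g)%E.
Proof.
move=> mf mg; rewrite [leLHS](@eq_energy _ _ _ _ _ (fun x => g x - (g x - f x))).
  rewrite addeC; apply: energyB_le => //; exact: cmeasB.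
by move=> x; rewrite subKr.
Qed.

(** The domain is cut down to sets of finite measure and the values are kept: on such a set finite
    energy already implies integrability. Dominated convergence, with [nsq f] as bound, gives the
    limit. *)
Lemma truncation_exists f : cmeas f -> (energy mu f < +oo)%E ->
  exists u, [/\ forall k, cL1 mu (u k), forall k, (energy mu (u k) < +oo)%E &
    energy_cvg u f].
Proof.
move=> mf foo; have /sigma_finiteP[S [ST Smono Soo]] := sigma_finiteT mu.
pose I k x : R[i] := (\1_(S k) x : R)%:C.
have mI k : cmeas (I k).
  split => /=; last exact: measurable_cst.
  by apply: measurable_indic; have [] := Soo k.
pose u k x := f x * I k x.
have mu_ k : cmeas (u k) by exact: cmeasM.
have nI k x : nsq (I k x) = \1_(S k) x.
  by rewrite /nsq /= expr0n addr0 indicE; case: (_ \in _); rewrite ?expr1n ?expr0n.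
have uf k x : nsq (u k x) <= nsq (f x).
  by rewrite nsqM nI ler_piMr ?nsq_ge0// indicE; case: (_ \in _).
have fi := integrable_nsq mf foo.
exists u; split.
- move=> k; have [mSk Skoo] := Soo k.
  apply: (@cL1_le _ _ _ _ _ (fun x => \1_(S k) x + nsq (f x))) => //.
    rewrite (_ : _ \o _ = (fun x => (\1_(S k) x)%:E + (nsq (f x))%:E)%E)//.
    apply: integrableD => //; apply/integrableP; split.
      exact/measurable_EFinP/measurable_indic.
    under eq_integral do rewrite gee0_abs ?lee_fin//.
    by rewrite integral_indic// setIT.
  move=> x; rewrite /u /I indicE; case: (_ \in _) => /=.
    by rewrite mulr1; exact: norm1_le_nsq.
  by rewrite add0r mulr0 /norm1 /= normr0 addr0 nsq_ge0.
- move=> k; apply: le_lt_trans foo; apply: ge0_le_integral => //.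
  + by move=> x _; rewrite lee_fin nsq_ge0.
  + exact/measurable_EFinP/measurable_nsq.
  + exact/measurable_EFinP/measurable_nsq.
  + by move=> x _; rewrite lee_fin.
pose D k x := (nsq (u k x - f x))%:E.
have mD k : measurable_fun [set: T] (D k).
  by apply/measurable_EFinP; apply: measurable_nsq; exact: cmeasB.
have Dle k x : nsq (u k x - f x) <= nsq (f x).
  rewrite /u /I indicE; case: (_ \in _) => /=.
    by rewrite mulr1 subrr nsq0 nsq_ge0.
  by rewrite mulr0 sub0r nsqN.
have cD : {ae mu, forall x, [set: T] x -> D k x @[k --> \oo] --> (0 : \bar R)}.
  apply: nearW => x _; have [N _ SNx] : (\bigcup_k S k) x by rewrite -ST.
  apply: cvg_near_cst; exists N => // k /= Nk.
  rewrite /D /u /I indicE mem_set; last by move/subsetPset : (Smono _ _ Nk); apply.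
  by rewrite mulr1 subrr nsq0.
have Db : {ae mu, forall x k, [set: T] x -> (`|D k x| <= (nsq (f x))%:E)%E}.
  by apply: nearW => x k _; rewrite gee0_abs lee_fin ?nsq_ge0//; exact: Dle.
have [_ _] := dominated_convergence measurableT mD (measurable_cst _) cD fi Db.
rewrite integral0 => Dc e e0.
have /fine_cvgP[[N1 _ N1P] /cvgrPdist_le /(_ e e0) [N2 _ N2P]] := Dc.
exists (maxn N1 N2) => k; rewrite geq_max => /andP[k1 k2].
have := N2P k k2 => /=; rewrite sub0r normrN => h.
rewrite -[leLHS]fineK; last exact: N1P.
by rewrite lee_fin; apply: le_trans h; exact: ler_norm.
Qed.

Lemma energy_cvg_lty u h : (forall k, cmeas (u k)) -> cmeas h ->
  (forall k, energy mu (u k) < +oo)%E -> energy_cvg u h -> (energy mu h < +oo)%E.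
Proof.
move=> mu_ mh uoo /(_ 1 ltr01)[N /(_ N (leqnn N)) NP].
apply: le_lt_trans (energy_le_dist mh (mu_ N)) _.
rewrite lte_add_pinfty// lte_mul_pinfty//; apply: le_lt_trans NP _; exact: ltry.
Qed.

End energy_limits.

Section zak_L2.
Context (R : realType) d (T : measurableType d)
    (mu : {sigma_finite_measure set T -> \bar R}) (dot : T -> T -> R) (c : R).
Variable z : zak mu dot c.
Local Notation e := (dot_char dot).
Implicit Types (f h H : T -> R[i]) (u : nat -> T -> R[i]).

Let ue : unimodular e. Proof. exact: unimodular_dot (z_dot z). Qed.

Let C : R := c * zc' z.

Let C0 : 0 < C. Proof. by rewrite mulr_gt0 ?(z_c z) ?(z_c' z). Qed.

Let cmeas_F h : cmeas h -> cmeas (FT mu e h).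
Proof. by move=> mh; apply: cmeas_FT => //; exact: ue.1. Qed.

Lemma zak_L2_exists f : cmeas f -> (energy mu f < +oo)%E ->
  exists H u, [/\ cmeas H, (energy mu H < +oo)%E,
    forall k, cL1 mu (u k) /\ (energy mu (u k) < +oo)%E,
    energy_cvg mu u f & energy_cvg mu (fun k => FT mu e (u k)) H].
Proof.
move=> mf foo; have [u [u1 uoo uf]] := truncation_exists mf foo.
have mu_ k : cmeas (u k) := cL1_cmeas (u1 k).
have mF k : cmeas (FT mu e (u k)) by exact: cmeas_F.
have cau : forall e0 : R, 0 < e0 -> exists N, forall k l, (N <= k)%N -> (N <= l)%N ->
    (energy mu (fun x => FT mu e (u k) x - FT mu e (u l) x)%R <= e0%:E)%E.
  (* [C] is the Plancherel constant; the fourth part of the error compensates the two factors 2 of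
     [energyB_le]. *)
  move=> e0 e00; have [|N NP] := uf (C^-1 * (4^-1 * e0)).
    by rewrite !mulr_gt0 ?invr_gt0.
  exists N => k l Nk Nl.
  rewrite (@eq_energy _ _ _ _ _ (FT mu e (fun x => u k x - u l x))); last first.
    by move=> x; rewrite FTB.
  rewrite (zak_plancherel z); last exact: cL1B.
  rewrite (@eq_energy _ _ _ _ _ (fun x => (u k x - f x) - (u l x - f x))); last first.
    by move=> x; congr nsq; ring.
  apply: (@le_trans _ _ (C%:E * (C^-1 * e0)%:E)%E); last first.
    by rewrite -EFinM mulVKf// gt_eqF.
  rewrite lee_pmul2l// ?lte_fin//.
  apply: le_trans (energyB_le mu (cmeasB (mu_ k) mf) (cmeasB (mu_ l) mf)) _.
  have -> : (C^-1 * e0)%:E =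
      (2%:E * (C^-1 * (4^-1 * e0))%:E + 2%:E * (C^-1 * (4^-1 * e0))%:E)%E.
    by rewrite -!EFinM -EFinD; congr EFin; field; rewrite gt_eqF.
  by apply: leeD; apply: lee_wpmul2l => //; exact: NP.
have [H mH HP] := riesz_fischer mF cau.
exists H, u; split => //.
apply: (energy_cvg_lty mF mH _ HP) => k.
by rewrite (zak_plancherel z)// lte_mul_pinfty ?lee_fin ?(ltW C0).
Qed.

(** If the transforms of [u k] tend to zero, then by Plancherel so do the energies of [u k], which
    tends to [f]. *)
Lemma zak_L2_inj f H u : cmeas f -> cmeas H ->
  (forall k, cL1 mu (u k)) -> energy_cvg mu u f ->
  energy_cvg mu (fun k => FT mu e (u k)) H ->
  {ae mu, forall x, H x = 0} -> {ae mu, forall x, f x = 0}.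
Proof.
move=> mf mH u1 uf uH H0; apply: energy_eq0 => //; apply/eqP.
rewrite eq_le energy_ge0 andbT; apply/lee_addgt0Pr => e0 e00; rewrite add0e.
have mu_ k : cmeas (u k) := cL1_cmeas (u1 k).
have [|N1 N1P] := uf (4^-1 * e0); first by rewrite mulr_gt0 ?invr_gt0.
have [|N2 N2P] := uH (C * (4^-1 * e0)); first by rewrite !mulr_gt0 ?invr_gt0 ?(z_c z) ?(z_c' z).
pose k := maxn N1 N2.
have h1 := N1P k (leq_maxl _ _); have h2 := N2P k (leq_maxr _ _).
apply: le_trans (energy_le_dist mu mf (mu_ k)) _.
have -> : e0%:E = (2%:E * (4^-1 * e0)%:E + 2%:E * (4^-1 * e0)%:E)%E.
  by rewrite -!EFinM -EFinD; congr EFin; field.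
apply: leeD; apply: lee_wpmul2l => //.
have : (energy mu (FT mu e (u k)) <= (C * (4^-1 * e0))%:E)%E.
  apply: le_trans h2; rewrite le_eqVlt; apply/orP; left; apply/eqP.
  apply: ae_eq_energy; [exact: cmeas_F|by apply: cmeasB => //; exact: cmeas_F|].
  by apply: filterS H0 => x ->; rewrite subr0.
by rewrite (zak_plancherel z)// [X in (_ <= X)%E]EFinM lee_pmul2l// ?lte_fin.
Qed.

End zak_L2.

(** * Translations of the Heisenberg group *)

Section L2norm_energy.
Context (R : realType) (n : nat).
Local Notation mu := (heis_measure R n).
Implicit Types (f h : heis R n -> R[i]) (u : nat -> heis R n -> R[i]).

Lemma L2norm_poweR f : L2norm f = (energy mu f `^ 2^-1)%E.
Proof.
rewrite /L2norm Lnorm.unlock /energy; congr (_ `^ _)%E.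
apply: eq_integral => x _; rewrite abse_EFin poweR_EFin; congr EFin.
by rewrite powR_mulrn// real_normK ?num_real// normc_sqr.
Qed.

Lemma L2norm_sqrt f r : energy mu f = r%:E -> L2norm f = (Num.sqrt r)%:E.
Proof.
move=> fr; have r0 : 0 <= r by rewrite -lee_fin -fr energy_ge0.
by rewrite L2norm_poweR fr poweR_EFin powR12_sqrt.
Qed.

Lemma L2norm_lty f : (L2norm f < +oo)%E <-> (energy mu f < +oo)%E.
Proof.
split; last first.
  by move=> foo; rewrite (L2norm_sqrt (esym (fineK _))) ?ltry ?ge0_fin_numE ?energy_ge0.
apply: contraTT; rewrite -!leNgt !leye_eq L2norm_poweR => /eqP ->.
by rewrite poweRyr// invr_eq0.
Qed.

Lemma L2norm_cvg0 u h :
  (L2norm (fun X => u k X - h X) @[k --> \oo] --> 0%E) <-> energy_cvg mu u h.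
Proof.
pose E k := energy mu (fun X => u k X - h X); split.
- move=> /fine_cvgP[[N1 _ N1P] /cvgrPdist_le uh] e e0.
  have [|N2 _ N2P] := uh (Num.sqrt e); first by rewrite sqrtr_gt0.
  exists (maxn N1 N2) => k; rewrite geq_max => /andP[k1 k2].
  have := N1P k k1; have := N2P k k2; rewrite /= sub0r normrN.
  have [Eoo|Eoo] := eqVneq (E k) +oo%E.
    by rewrite L2norm_poweR -/(E k) Eoo poweRyr// invr_eq0.
  have Efin : E k \is a fin_num by rewrite ge0_fin_numE ?energy_ge0// ltey.
  rewrite (L2norm_sqrt (esym (fineK Efin)))/= => hh _; move: hh.
  rewrite ger0_norm ?sqrtr_ge0// ler_sqrt ?(ltW e0)// => hh.
  by rewrite -/(E k) -(fineK Efin) lee_fin.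
- move=> uh; have Efin : exists N, forall k, (N <= k)%N -> E k \is a fin_num.
    have [N NP] := uh 1 ltr01; exists N => k /NP hh.
    by rewrite ge0_fin_numE ?energy_ge0// (le_lt_trans hh)// ltry.
  have [N1 N1P] := Efin; apply/fine_cvgP; split.
    exists N1 => // k /= Nk; rewrite (L2norm_sqrt (esym (fineK (N1P k Nk))))//.
  apply/cvgrPdist_le => e e0; have [|N2 N2P] := uh (e ^+ 2); first by rewrite exprn_gt0.
  exists (maxn N1 N2) => // k /=; rewrite geq_max => /andP[k1 k2].
  rewrite sub0r normrN (L2norm_sqrt (esym (fineK (N1P k k1))))/=.
  rewrite ger0_norm ?sqrtr_ge0// -[leRHS](@ger0_norm _ e) ?(ltW e0)// -sqrtr_sqr.
  by rewrite ler_sqrt ?sqr_ge0// -lee_fin fineK ?N1P//; exact: N2P.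
Qed.

End L2norm_energy.

Section heisenberg_translations.
Context (R : realType).

Lemma measurable_euclid_add n :
  measurable_fun [set: euclid R n * euclid R n] (fun u => euclid_add u.1 u.2).
Proof.
apply/measurable_fun_tnthP => i.
rewrite (_ : _ \o _ = (fun u : euclid R n * euclid R n =>
    (tnth u.1 i : R) + (tnth u.2 i : R))).
  apply: measurable_funD.
  - exact: (measurableT_comp (measurable_tnth i) measurable_fst).
  - exact: (measurableT_comp (measurable_tnth i) measurable_snd).
by apply/funext => u /=; rewrite tnth_mktuple.
Qed.

Lemma euclid_add_cons n (u v : measurableTypeR R * euclid R n) :
  euclid_add (tuple_cons u) (tuple_cons v) =
  tuple_cons ((u.1 : R) + (v.1 : R), euclid_add u.2 v.2).
Proof.
apply: eq_from_tnth => i; rewrite tnth_mktuple.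
case: (unliftP ord0 i) => [j|] ->; last by rewrite !(tnth_nth 0).
by rewrite !tnthS /= tnth_mktuple.
Qed.

Lemma unfolds_euclid_add n (a : euclid R n) :
  unfolds (lebesgue_euclid R n) (lebesgue_euclid R n) 1 (fun p => euclid_add p a).
Proof.
elim: n a => [|n IH] a.
  split; last first.
    move=> f mf f0; rewrite mul1e; apply: eq_integral => p _; congr f.
    by rewrite (tuple0 p) (tuple0 (euclid_add _ _)).
  exact: (measurable_slice1 a (@measurable_euclid_add 0)).
have ma := measurable_slice1 a (@measurable_euclid_add n.+1).
split => // f mf f0; rewrite mul1e.
have [mc uc] := unfolds_tuple_cons R n.
rewrite (uc f mf f0) (uc (fun p => f (euclid_add p a)) (measurableT_comp mf ma) (fun=> f0 _)).
rewrite !mul1e.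
have := unfolds_prod ler01 ler01 (lebesgue_affine (thead a) ltr01) (IH [tuple of behead a]).
move=> [mj uj]; rewrite (uj (f \o @tuple_cons R n) (measurableT_comp mf mc) (fun=> f0 _)) mulr1 mul1e.
apply: eq_integral => u _ /=; congr f; rewrite mul1r.
rewrite -(euclid_add_cons u (thead a, [tuple of behead a])).
by congr euclid_add; rewrite [RHS]tuple_eta; exact: val_inj.
Qed.

(** The common form of left and right Heisenberg translations: a translation of the horizontal
    coordinates combined with a shear of the central one. At fixed horizontal coordinates the shear
    is a translation of the line. *)
Lemma unfolds_skew n (a b : euclid R n) (s : euclid R n * euclid R n -> R) :
  measurable_fun [set: euclid R n * euclid R n] s ->
  unfolds (heis_measure R n) (heis_measure R n) 1
    (fun X : heis R n => (euclid_add X.1.1 a, euclid_add X.1.2 b, (X.2 : R) + s X.1)).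
Proof.
move=> ms; have m1 := @measurable_fst _ _ (euclid R n * euclid R n)%type (measurableTypeR R).
have m2 := @measurable_snd _ _ (euclid R n * euclid R n)%type (measurableTypeR R).
have [mt ut] := unfolds_prod ler01 ler01 (unfolds_euclid_add a) (unfolds_euclid_add b).
have ms1 : measurable_fun [set: heis R n] (fun X : heis R n => (X.2 : R) + s X.1 : measurableTypeR R).
  by apply: measurable_funD => //; exact: (measurableT_comp ms m1).
have mj := measurable_fun_pair (measurableT_comp mt m1) ms1.
split; first exact: mj.
move=> f mf f0; rewrite mul1e.
rewrite (@tonelli1 _ _ _ _ _ (sigma_finite_prod (lebesgue_euclid R n) (lebesgue_euclid R n))
  lebesgue_measure f)//.
rewrite (@tonelli1 _ _ _ _ _ (sigma_finite_prod (lebesgue_euclid R n) (lebesgue_euclid R n))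
  lebesgue_measure (fun X => f (euclid_add X.1.1 a, euclid_add X.1.2 b, (X.2 : R) + s X.1)))//;
  last exact: (measurableT_comp mf mj).
rewrite ut; last 2 first.
- exact: (measurable_fun_fubini_tonelli_F f).
- by move=> x; exact: integral_ge0.
rewrite mulr1 mul1e; apply: eq_integral => x _ /=.
have [_ ul] := lebesgue_affine (s x) ltr01.
rewrite (ul (fun t => f (euclid_add x.1 a, euclid_add x.2 b, t)))//; last first.
  exact: (measurable_slice2 _ mf).
by rewrite mul1e; apply: eq_integral => t _; rewrite mul1r.
Qed.

Lemma unfolds_heis_mulr n (P : heis R n) :
  unfolds (heis_measure R n) (heis_measure R n) 1 (fun X => heis_mul X P).
Proof.
case: P => [[p' q'] t'].
pose s (u : euclid R n * euclid R n) : R :=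
  (t' : R) + 2^-1 * (euclid_dot u.1 q' - euclid_dot u.2 p').
rewrite (_ : (fun X => _) = (fun X : heis R n =>
    (euclid_add X.1.1 p', euclid_add X.1.2 q', (X.2 : R) + s X.1))).
  apply: unfolds_skew; apply: measurable_funD => //; apply: measurable_funM => //.
  have md := @measurable_euclid_dot R n.
  apply: measurable_funB.
  - exact: (measurableT_comp (measurable_slice1 q' md) measurable_fst).
  - exact: (measurableT_comp (measurable_slice1 p' md) measurable_snd).
by apply/funext => -[[p q] t]; rewrite /s /= addrA.
Qed.

Lemma euclid_addC n (p q : euclid R n) : euclid_add p q = euclid_add q p.
Proof. by apply: eq_from_tnth => i; rewrite !tnth_mktuple addrC. Qed.

Lemma unfolds_heis_mull n (X : heis R n) :
  unfolds (heis_measure R n) (heis_measure R n) 1 (fun P => heis_mul X P).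
Proof.
case: X => [[p q] t].
pose s (u : euclid R n * euclid R n) : R :=
  (t : R) + 2^-1 * (euclid_dot p u.2 - euclid_dot q u.1).
rewrite (_ : (fun P => _) = (fun P : heis R n =>
    (euclid_add P.1.1 p, euclid_add P.1.2 q, (P.2 : R) + s P.1))).
  apply: unfolds_skew; apply: measurable_funD => //; apply: measurable_funM => //.
  have md := @measurable_euclid_dot R n.
  apply: measurable_funB.
  - exact: (measurableT_comp (measurable_slice2 p md) measurable_snd).
  - exact: (measurableT_comp (measurable_slice2 q md) measurable_fst).
apply/funext => -[[p' q'] t']; rewrite /s /=.
by rewrite (euclid_addC p) (euclid_addC q) addrA [(t : R) + _]addrC.
Qed.

Lemma measurable_heis_mul n :
  measurable_fun [set: heis R n * heis R n] (fun u => heis_mul u.1 u.2).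
Proof.
have m1 := @measurable_fst _ _ (heis R n) (heis R n).
have m2 := @measurable_snd _ _ (heis R n) (heis R n).
have m11 := measurableT_comp measurable_fst m1.
have m12 := measurableT_comp measurable_snd m1.
have m21 := measurableT_comp measurable_fst m2.
have m22 := measurableT_comp measurable_snd m2.
have p1 := measurableT_comp measurable_fst m11.
have q1 := measurableT_comp measurable_snd m11.
have p2 := measurableT_comp measurable_fst m21.
have q2 := measurableT_comp measurable_snd m21.
have ma := @measurable_euclid_add n; have md := @measurable_euclid_dot R n.
have mp := measurableT_comp ma (measurable_fun_pair p1 p2).
have mq := measurableT_comp ma (measurable_fun_pair q1 q2).
have d1 := measurableT_comp md (measurable_fun_pair p1 q2).
have d2 := measurableT_comp md (measurable_fun_pair q1 p2).
have mt : measurable_fun [set: heis R n * heis R n] (fun u : heis R n * heis R n =>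
    (u.1.2 : R) + (u.2.2 : R) + 2^-1 * (euclid_dot u.1.1.1 u.2.1.2 -
    euclid_dot u.1.1.2 u.2.1.1) : measurableTypeR R).
  apply: measurable_funD; first exact: measurable_funD.
  by apply: measurable_funM => //; exact: measurable_funB.
rewrite (_ : (fun u => _) = (fun u : heis R n * heis R n =>
  (euclid_add u.1.1.1 u.2.1.1, euclid_add u.1.1.2 u.2.1.2,
   (u.1.2 : R) + (u.2.2 : R) + 2^-1 * (euclid_dot u.1.1.1 u.2.1.2 -
    euclid_dot u.1.1.2 u.2.1.1)))).
  exact: (measurable_fun_pair (measurable_fun_pair mp mq) mt).
by apply/funext => -[[[p q] t] [[p' q'] t']].
Qed.

End heisenberg_translations.

Section fourierL2_properties.
Context (R : realType) (n : nat).
Local Notation mu := (heis_measure R n.+1).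
Implicit Types f : heis R n.+1 -> R[i].

(** Existence of one function in the relation is enough for the value picked by [xget] to be in it;
    it comes from the completeness argument with the unit lattice. *)
Lemma fourierL2P f : L2fun f -> is_fourierL2 f (fourierL2 f).
Proof.
move=> [mf /L2norm_lty foo]; apply: xgetPex.
have [H [u [mH Hoo u12 uf uH]]] := zak_L2_exists (zak_heis n (@ltr01 R)) mf foo.
exists H; split; first by split => //; exact/L2norm_lty.
exists u; split.
- move=> k; have [u1 u2] := u12 k; split => //; split; first exact: (cL1_cmeas u1).
  exact/L2norm_lty.
- exact/L2norm_cvg0.
- exact/(L2norm_cvg0 (fun k => fourier_integral (u k))).
Qed.

Lemma fourierL2_inj f : L2fun f ->
  {ae mu, forall X, fourierL2 f X = 0} -> {ae mu, forall X, f X = 0}.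
Proof.
move=> f2 F0; have [[mF _] [u [u12 uf uF]]] := fourierL2P f2.
apply: (zak_L2_inj (zak_heis n (@ltr01 R)) (u := u) f2.1 mF) => //.
- by move=> k; have [] := u12 k.
- exact/L2norm_cvg0.
- exact/(L2norm_cvg0 (fun k => fourier_integral (u k))).
Qed.

End fourierL2_properties.

(** * Products of a function with translates of a window *)

Section window_product.
Context (R : realType) (n : nat).
Local Notation mu := (heis_measure R n).
Variables F G : heis R n -> R[i].
Hypotheses (mF : cmeas F) (mG : cmeas G).
Hypotheses (F2 : (energy mu F < +oo)%E) (G2 : (energy mu G < +oo)%E).

Let GP (P X : heis R n) := G (heis_mul X P).

Let mGP P : cmeas (GP P).
Proof. by apply: (cmeas_comp mG); exact: (unfolds_heis_mulr P).1. Qed.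

Lemma energy_heis_mulr P : energy mu (GP P) = energy mu G.
Proof. by rewrite [RHS](unfolds_energy (unfolds_heis_mulr P))// mul1e. Qed.

Lemma cL1_window P : cL1 mu (fun X => F X * conjc (G (heis_mul X P))).
Proof.
apply: cL1_energyM => //; first exact: (cmeasJ (mGP P)).
rewrite (@eq_energy _ _ _ _ _ (GP P)); last by move=> X; rewrite nsqJ.
by rewrite energy_heis_mulr.
Qed.

Lemma measure_supp_window P :
  (mu (supp (fun X => (F X * conjc (G (heis_mul X P)))%R)) <= mu (supp G))%E.
Proof.
rewrite [leRHS](unfolds_measure (unfolds_heis_mulr P)); last exact: measurable_supp.
rewrite mul1e le_measure// ?inE.
- exact/measurable_supp/cL1_cmeas/cL1_window.
- by rewrite -[X in measurable X]setTI; apply: (unfolds_heis_mulr P).1 => //;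
    exact: measurable_supp.
- move=> X; rewrite /supp /= mulf_eq0 negb_or => /andP[_].
  by rewrite conjc_eq0.
Qed.

Lemma window_product_eq0 :
  {ae mu, forall P, {ae mu, forall X, F X * conjc (G (heis_mul X P)) = 0}} ->
  {ae mu, forall X, F X = 0} \/ {ae mu, forall X, G X = 0}.
Proof.
move=> FG0.
pose h (u : heis R n * heis R n) := F u.1 * conjc (G (heis_mul u.1 u.2)).
have mh : cmeas h.
  apply: cmeasM; first exact: (cmeas_comp mF measurable_fst).
  exact: (cmeasJ (cmeas_comp mG (@measurable_heis_mul R n))).
have := energy_ae0 mh ((ae_prod2 mu mu mh).2 FG0).
rewrite energy_prod1//; under eq_integral => X _.
  (* With [X] fixed the inner integral runs over [P], so it is invariance under left translation by
     [X] that makes it independent of [X]. *)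
  rewrite (_ : energy mu _ = ((nsq (F X))%:E * energy mu G)%E); last first.
    rewrite (unfolds_energy (unfolds_heis_mull X) mG) mul1e /energy.
    rewrite -ge0_integralZl//.
    - by apply: eq_integral => P _; rewrite /h /= nsqM nsqJ EFinM.
    - apply/measurable_EFinP/measurable_nsq/(cmeas_comp mG).
      exact: (unfolds_heis_mull X).1.
    - by move=> P _; rewrite lee_fin nsq_ge0.
    - by rewrite lee_fin nsq_ge0.
  over.
rewrite ge0_integralZr//; last 3 first.
- exact/measurable_EFinP/measurable_nsq.
- by move=> X _; rewrite lee_fin nsq_ge0.
- exact: energy_ge0.
move=> /eqP; rewrite mule_eq0 => /orP[/eqP F0|/eqP G0].
- by left; exact: energy_eq0.
- by right; exact: energy_eq0.
Qed.

End window_product.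

Theorem theorem3p1 (R : realType) (n : nat) (hn : (1 <= n)%N)
    (f g : heis R n -> R[i]) (hf : L2fun f) (hg : L2fun g)
    (hV : (heis2_measure R n (supp (stft g f)) < +oo)%E)
    (hFg : (heis_measure R n (supp (fourierL2 g)) < +oo)%E) :
  {ae heis_measure R n, forall X, f X = 0} \/
  {ae heis_measure R n, forall X, g X = 0}.
Proof.
case: n hn f g hf hg hV hFg => // n _ f g hf hg hV hFg.
have [[mF /L2norm_lty F2] _] := fourierL2P hf.
have [[mG /L2norm_lty G2] _] := fourierL2P hg.
set F := fourierL2 f in mF F2; set G := fourierL2 g in mG G2 hFg.
(* Any covolume larger than the measure of the support of [G] would do; adding 1 also makes [l]
   positive. By [hFg] the measure is finite, so [fine] loses nothing. *)
pose l := fine (heis_measure R n.+1 (supp G)) + 1.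
have l0 : 0 < l by rewrite ltr_wpDl// fine_ge0.
pose mu := heis_measure R n.+1.
pose h P X := F X * conjc (G (heis_mul X P)).
have VE : stft g f = fun u => FT mu (dot_char (@heis_dot R n.+1)) (h u.2) u.1.
  by apply/funext => -[Q P].
have mV : cmeas (stft g f).
  rewrite VE; apply: (cmeas_cint1 mu
    (f := fun u : heis R n.+1 * (heis R n.+1 * heis R n.+1) =>
      F u.1 * conjc (G (heis_mul u.1 u.2.2)) * expN2pii (heis_dot u.2.1 u.1))).
  have mX := @measurable_fst _ _ (heis R n.+1) (heis R n.+1 * heis R n.+1)%type.
  have mQP := @measurable_snd _ _ (heis R n.+1) (heis R n.+1 * heis R n.+1)%type.
  have mQ := measurableT_comp measurable_fst mQP.
  have mP := measurableT_comp measurable_snd mQP.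
  apply: cmeasM; first apply: cmeasM.
  - exact: (cmeas_comp mF mX).
  - apply: cmeasJ; apply: (cmeas_comp mG).
    exact: (measurableT_comp (@measurable_heis_mul R n.+1) (measurable_fun_pair mX mP)).
  - apply: cmeas_expN2pii.
    exact: (measurableT_comp (@measurable_heis_dot R n.+1) (measurable_fun_pair mQ mX)).
have mS := measurable_supp mV.
(* Slices are taken at fixed [P], the second variable, because [stft g f] is a Fourier transform in
   [Q]. *)
have Voo : (\int[mu]_P mu [set Q | supp (stft g f) (Q, P)] < +oo)%E.
  by have := prod_measure_section2 mu mu mS => <-; exact: hV.
have VP := ge0_integral_ae_lty (measurable_measure_section2 mu mS)
  (fun=> measure_ge0 _ _) Voo.
have h0 : {ae mu, forall P, {ae mu, forall X, h P X = 0}}.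
  apply: filterS VP => P VPoo.
  apply: (zak_benedicks (zak_heis n l0) (cL1_window mF mG F2 G2 P)).
    apply: le_lt_trans (measure_supp_window mF mG F2 G2 P) _.
    rewrite -[ltLHS]fineK; last by rewrite ge0_fin_numE.
    (* The covolume is [1 * 1 * l], so the comparison is between the measure of the support of [G]
       and one more. *)
    by rewrite lte_fin !mul1r ltrDl.
  by move: VPoo; rewrite VE.
have [F0|G0] := window_product_eq0 mF mG h0.
- by left; exact: fourierL2_inj.
- by right; exact: fourierL2_inj.
Qed.
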